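(* Let $\Gamma$ be a group and $A \leq \Gamma$ a subgroup such that the pair $(\Gamma, A)$ has relative property (T). If $A$ is infinite and $A$ is weakly normal or weakly quasi-normal in $\Gamma$, then $\beta_1(\Gamma) = 0$.
   Context: Groups are discrete. $\beta_1(\Gamma)$ denotes the first $\ell^2$-Betti number of $\Gamma$. Relative property (T): the pair $(\Gamma, A)$, with $A \leq \Gamma$ a subgroup, has relative property (T) if every unitary representation of $\Gamma$ on a Hilbert space that has almost invariant vectors (i.e. for every finite $F \subset \Gamma$ and $\epsilon > 0$ there is a unit vector $\xi$ with $\|\pi(\gamma)\xi - \xi\| < \epsilon$ for all $\gamma \in F$) has a nonzero $A$-invariant vector. Weakly normal: a subgroup $A \leq \Gamma$ is weakly normal if there is a family of intermediate subgroups $\{N_t : 0 \leq t \leq \tau\}$ of $\Gamma$, indexed by ordinals and well ordered by inclusion (so $N_s \leq N_t$ for $s \leq t$), with $N_0 = A$ and $N_\tau = \Gamma$, such that for each $0 < t \leq \tau$ the subgroup $\bigcup_{s<t} N_s$ is normal in $N_t$. Weakly quasi-normal: a subgroup $A \leq \Gamma$ is weakly quasi-normal if there is a family of intermediate subgroups $\{N_t : 0 \leq t \leq \tau\}$ of $\Gamma$, indexed by ordinals and well ordered by inclusion, with $N_0 = A$ and $N_\tau = \Gamma$, such that: for each non-limit ordinal $0 < t \leq \tau$, $N_t$ is the subgroup of $\Gamma$ generated by $\{\gamma \in \Gamma : |N_{t-1} \cap \gamma N_{t-1} \gamma^{-1}| = \infty\}$; and for each limit ordinal $0 < t \leq \tau$,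 $N_t = \bigcup_{s<t} N_s$. *)

(* Defs.v *)
From HB Require Import structures.
From mathcomp Require Import all_boot all_order all_algebra.
From mathcomp Require Import all_classical all_reals all_analysis.
From mathcomp Require Import complex ring lra.
Import Order.TTheory GRing.Theory Num.Theory.
Import numFieldNormedType.Exports.

Set Implicit Arguments.
Unset Strict Implicit.
Unset Printing Implicit Defensive.

Local Open Scope classical_set_scope.
Local Open Scope ring_scope.
Local Open Scope complex_scope.

Section Subgroups.
Variable G : groupType.
Implicit Types A N U : set G.

Definition is_subgroup A : Prop :=
  [/\ A 1%g, (forall x y, A x -> A y -> A (x * y)%g)
    & forall x, A x -> A (x^-1)%g].

Definition is_normal U N : Prop :=
  [/\ is_subgroup U, U `<=` N
    & forall g x, N g -> U x -> U (g * x * g^-1)%g].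

Definition conj_set (g : G) N : set G := [set (g * x * g^-1)%g | x in N].

Definition gen_subgroup (S : set G) : set G :=
  \bigcap_(N in [set N | is_subgroup N /\ S `<=` N]) N.

End Subgroups.

(* The closed intervals [0, tau] of ordinals are, up to isomorphism, the      *)
(* well-founded total orders with a least and a greatest element; the         *)
(* non-limit t > 0 are then the t having an immediate predecessor.            *)

Section WeaklyNormal.
Variable G : groupType.

Definition ordinal_interval d (T : tbOrderType d) : Prop :=
  well_founded (fun s t : T => (s < t)%O).

Definition subgroup_chain d (T : tbOrderType d) (A : set G)
    (N : T -> set G) : Prop :=
  [/\ forall t, is_subgroup (N t), forall s t, (s <= t)%O -> N s `<=` N t,
      N \bot%O = A & N \top%O = [set: G]].

Definition is_pred d (T : tbOrderType d) (s t : T) : Prop :=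
  (s < t)%O /\ forall r, (r < t)%O -> (r <= s)%O.

Definition is_limit d (T : tbOrderType d) (t : T) : Prop :=
  (\bot < t)%O /\ ~ exists s, is_pred s t.

Definition weakly_normal (A : set G) : Prop :=
  exists d (T : tbOrderType d) (N : T -> set G),
    [/\ ordinal_interval T, subgroup_chain A N
      & forall t, (\bot < t)%O ->
          is_normal (\bigcup_(s in [set s | (s < t)%O]) N s) (N t)].

Definition weakly_quasi_normal (A : set G) : Prop :=
  exists d (T : tbOrderType d) (N : T -> set G),
    [/\ ordinal_interval T, subgroup_chain A N,
        (forall s t, is_pred s t ->
          N t = gen_subgroup
                  [set g | infinite_set (N s `&` conj_set g (N s))])
      & forall t, is_limit t ->
          N t = \bigcup_(s in [set s | (s < t)%O]) N s].

End WeaklyNormal.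

Section RelativeT.
Variables (R : realType) (G : groupType).
Local Notation C := R[i].

(* A complex Hilbert space is a Banach space whose norm comes from a          *)
(* positive definite Hermitian form, linear in its first argument.            *)
Definition is_hilbert (H : completeNormedModType C)
    (dot : {dot H for Num.conj}) : Prop :=
  forall x : H, `|x| ^+ 2 = dot x x.

Definition unitary_rep (H : completeNormedModType C)
    (dot : {dot H for Num.conj}) (pi : G -> {linear H -> H}) : Prop :=
  [/\ forall x, pi 1%g x = x, forall g h x, pi (g * h)%g x = pi g (pi h x)
    & forall g x y, dot (pi g x) (pi g y) = dot x y].

Definition almost_invariant (H : completeNormedModType C)
    (pi : G -> {linear H -> H}) : Prop :=
  forall (F : set G) (eps : R), finite_set F -> 0 < eps ->
    exists xi : H, `|xi| = 1 /\ forall g, F g -> `|pi g xi - xi| < eps%:C.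

Definition relative_T (A : set G) : Prop :=
  forall (H : completeNormedModType C) (dot : {dot H for Num.conj})
    (pi : G -> {linear H -> H}),
    is_hilbert dot -> unitary_rep dot pi -> almost_invariant pi ->
    exists xi : H, xi != 0 /\ forall a, A a -> pi a xi = xi.

End RelativeT.

Section L2.
Variables (R : realType) (G : groupType).
Local Notation C := R[i].
Implicit Types f g : G -> C.

Definition sqmod (z : C) : R := complex.Re z ^+ 2 + complex.Im z ^+ 2.

Definition sqnorm f : \bar R := \esum_(x in [set: G]) (sqmod (f x))%:E.

Definition sq_summable : {pred G -> C} := fun f => `[< (sqnorm f < +oo)%E >].

Lemma sqmod_ge0 z : (0 <= (sqmod z)%:E)%E.
Proof. by rewrite lee_fin addr_ge0 ?sqr_ge0. Qed.

Lemma sqnorm_ge0 f : (0 <= sqnorm f)%E.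
Proof. by apply: esum_ge0 => x _; exact: sqmod_ge0. Qed.

Lemma sqnormB f g :
  (sqnorm (fun x => f x - g x)%R <=
     (sqnorm f + sqnorm f) + (sqnorm g + sqnorm g))%E.
Proof.
rewrite /sqnorm -!esumD; try by move=> *; rewrite ?adde_ge0 ?sqmod_ge0.
apply: le_esum => x _; rewrite -!EFinD lee_fin /sqmod.
case: (f x) (g x) => [a b] [c d] /=.
have := addr_ge0 (sqr_ge0 (a + c)) (sqr_ge0 (b + d)); lra.
Qed.

Lemma sqmodM z w : sqmod (z * w) = sqmod z * sqmod w.
Proof. by case: z w => [a b] [c d]; rewrite /sqmod /=; ring. Qed.

Lemma sqnormZ (k : C) f :
  (sqnorm (fun x => k * f x)%R <= (sqmod k)%:E * sqnorm f)%E.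
Proof.
apply: ge_ereal_sup => _ [A /= [finA _] <-].
under eq_fsbigr do rewrite sqmodM EFinM.
rewrite -ge0_mule_fsumr; last by move=> ?; exact: sqmod_ge0.
apply: lee_wpmul2l; first exact: sqmod_ge0.
by apply: ereal_sup_ubound; exists A.
Qed.

Lemma sqnorm_reindex f (s : G -> G) : bijective s ->
  sqnorm (fun x => f (s x)) = sqnorm f.
Proof.
move=> bs; rewrite /sqnorm [RHS](reindex_esum [set: G] [set: G] s) //.
by rewrite setTT_bijective.
Qed.

Lemma sqnorm_delta : sqnorm (fun x : G => (x == 1%g)%:R) = 1%E.
Proof.
rewrite /sqnorm (esumID [set 1%g]) ?setTI; last by move=> *; exact: sqmod_ge0.
rewrite esum_set1; last exact: sqmod_ge0.
rewrite [X in (_ + X)%E]esum1 => [|x /eqP/negPf xn1].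
  by rewrite adde0 eqxx /sqmod /= expr1n expr0n addr0.
by rewrite xn1 /sqmod /= expr0n addr0.
Qed.

Fact sq_summable_submod : submod_closed (sq_summable : {pred G -> C^o}).
Proof.
split.
  apply/asboolP; rewrite /sqnorm esum1 ?ltry // => x _.
  by rewrite /sqmod /= expr0n addr0.
move=> k f g /asboolP fS /asboolP gS; apply/asboolP.
have -> : k *: f + g = (fun x => k * f x - (-1) * g x) :> (G -> C).
  by apply/funext => x; rewrite mulN1r opprK.
have fin h (c : C) : (sqnorm h < +oo)%E ->
    (sqnorm (fun x => c * h x)%R < +oo)%E.
  move=> hS; apply: le_lt_trans (sqnormZ _ _) _.
  by rewrite lte_mul_pinfty ?sqmod_ge0.
by apply: le_lt_trans (sqnormB _ _) _; rewrite !lte_add_pinfty // fin.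
Qed.

HB.instance Definition _ :=
  GRing.isSubmodClosed.Build C (G -> C^o) sq_summable sq_summable_submod.

Definition l2 := {f : G -> C^o | f \in sq_summable}.
HB.instance Definition _ := SubChoice.on l2.
HB.instance Definition _ := [SubChoice_isSubLmodule of l2 by <:].

Fact translate_subproof (s : G -> G) (f : l2) : bijective s ->
  (fun x => val f (s x)) \in sq_summable.
Proof.
move=> bs; apply/asboolP; rewrite sqnorm_reindex //.
by have /asboolP := valP f.
Qed.

Fact ltr_bij (g : G) : bijective (fun x : G => g^-1 * x)%g.
Proof. by exists (fun x => g * x)%g => x; rewrite ?mulVKg ?mulKg. Qed.

Fact rtr_bij (g : G) : bijective (fun x : G => x * g)%g.
Proof. by exists (fun x => x * g^-1)%g => x; rewrite ?mulgK ?mulgVK. Qed.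

Definition ltr (g : G) (f : l2) : l2 :=
  exist (fun h => h \in sq_summable) _ (translate_subproof f (ltr_bij g)).
Definition rtr (g : G) (f : l2) : l2 :=
  exist (fun h => h \in sq_summable) _ (translate_subproof f (rtr_bij g)).

Fact delta_subproof : (fun x : G => (x == 1%g)%:R) \in sq_summable.
Proof. by apply/asboolP; rewrite sqnorm_delta ltry. Qed.

Definition delta1 : l2 := exist (fun h => h \in sq_summable) _ delta_subproof.

(* N(G) is the algebra of bounded operators on l2 commuting with the right    *)
(* translations, so that it contains the left translations ltr g.             *)
(* Boundedness is expressed with squared norms.                               *)

Definition is_vN (T : l2 -> l2) : Prop :=
  [/\ linear T,
      exists M : R, forall f : l2, (sqnorm (val (T f)) <= M%:E * sqnorm (val f))%E
    & forall (g : G) (f : l2), T (rtr g f) = rtr g (T f)].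

Definition vN_pred : {pred l2 -> l2} := fun T => `[< is_vN T >].

Definition vN := {T : l2 -> l2 | T \in vN_pred}.
HB.instance Definition _ := SubChoice.on vN.

Fact vN_zmod : zmod_closed vN_pred.
Proof.
split=> [|S T /asboolP[Slin [M MS] Srtr] /asboolP[Tlin [N NT] Trtr]].
  apply/asboolP; split=> [k f g||g f].
  - by rewrite /= scaler0 addr0.
  - exists 0 => f; rewrite mul0e; apply: (le_trans (y := sqnorm (fun=> 0))).
      by [].
    by rewrite /sqnorm esum1 // => x _; rewrite /sqmod /= expr0n addr0.
  - by apply: val_inj.
apply/asboolP; split=> [k f g||g f].
- by rewrite !fctE Slin Tlin scalerBr opprD addrACA.
- exists (`|M| + `|M| + (`|N| + `|N|)) => f; apply: le_trans (sqnormB _ _) _.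
  have bound (K : R) (U : l2 -> l2) :
      (sqnorm (val (U f)) <= K%:E * sqnorm (val f) ->
       sqnorm (val (U f)) <= `|K|%:E * sqnorm (val f))%E.
    move=> /le_trans; apply; apply: lee_wpmul2r; first exact: sqnorm_ge0.
    by rewrite lee_fin ler_norm.
  rewrite !EFinD !ge0_muleDl ?adde_ge0 ?lee_fin //.
  by rewrite !leeD ?bound.
- by rewrite !fctE Srtr Trtr; apply: val_inj.
Qed.
HB.instance Definition _ := GRing.isZmodClosed.Build (l2 -> l2) vN_pred vN_zmod.
HB.instance Definition _ := [SubChoice_isSubZmodule of vN by <:].

Fact vN_one_subproof : id \in vN_pred.
Proof. by apply/asboolP; split=> //; exists 1 => f; rewrite mul1e. Qed.

Fact vN_mul_subproof (S T : vN) : val S \o val T \in vN_pred.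
Proof.
have /asboolP[Slin [M MS] Srtr] := valP S.
have /asboolP[Tlin [N NT] Trtr] := valP T.
apply/asboolP; split=> [k f g||g f] /=.
- by rewrite Tlin Slin.
- exists (`|M| * N) => f; apply: le_trans (MS _) _; rewrite EFinM -muleA.
  apply: (le_trans (y := (`|M|%:E * sqnorm (val (val T f)))%E)).
    by apply: lee_wpmul2r; rewrite ?sqnorm_ge0 // lee_fin ler_norm.
  by apply: lee_wpmul2l; rewrite ?lee_fin.
- by rewrite Trtr Srtr.
Qed.

Definition vN_one : vN := exist (fun T => T \in vN_pred) _ vN_one_subproof.
Definition vN_mul (S T : vN) : vN :=
  exist (fun T => T \in vN_pred) _ (vN_mul_subproof S T).

Fact vN_mulA : associative vN_mul.
Proof. by move=> ? ? ?; exact: val_inj. Qed.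
Fact vN_mul1 : left_id vN_one vN_mul.
Proof. by move=> ?; exact: val_inj. Qed.
Fact vN_mulr1 : right_id vN_one vN_mul.
Proof. by move=> ?; exact: val_inj. Qed.
Fact vN_mulDl : left_distributive vN_mul +%R.
Proof. by move=> ? ? ?; exact: val_inj. Qed.
Fact vN_mulDr : right_distributive vN_mul +%R.
Proof.
move=> S T U; apply: val_inj; apply/funext => f /=.
have /asboolP[Slin _ _] := valP S.
by have := Slin 1 (val T f) (val U f); rewrite !scale1r.
Qed.

HB.instance Definition _ :=
  GRing.Zmodule_isPzRing.Build vN vN_mulA vN_mul1 vN_mulr1 vN_mulDl vN_mulDr.

Fact vN_ltr_subproof (g : G) : ltr g \in vN_pred.
Proof.
apply/asboolP; split=> [k f h||h f].
- by apply: val_inj.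
- by exists 1 => f; rewrite mul1e /= sqnorm_reindex //; exact: ltr_bij.
- by apply: val_inj; apply/funext => x /=; rewrite mulgA.
Qed.

Definition vN_ltr (g : G) : vN :=
  exist (fun T => T \in vN_pred) _ (vN_ltr_subproof g).

Definition vN_tr (a : vN) : C := val (val a delta1) 1%g.

End L2.

Section L2Betti.
Variables (R : realType) (G : groupType).
Local Notation N := (vN R G).

(* The extended von Neumann dimension of the left N-module Z / B (Lueck): the *)
(* supremum of the dimensions of its finitely generated projective            *)
(* submodules. Such a submodule is an injective image of the left module      *)
(* P = {v | v *m e = v} of an idempotent matrix e, whose dimension is the     *)
(* trace of e (the trace of an idempotent over N is real and nonnegative).    *)
(* Since P is a projective direct summand of 'rV_n, a linear map P -> Z / B   *)
(* is the same as one induced by a linear map phi : 'rV_n -> Z.               *)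
Definition vN_dim (M : lmodType N) (Z B : set M) : \bar R :=
  ereal_sup [set d | exists n (e : 'M[N]_n) (phi : {linear 'rV[N]_n -> M}),
    [/\ e *m e = e,
        forall v, Z (phi v),
        forall v, v *m e = v -> B (phi v) -> v = 0
      & d = (complex.Re (\sum_(i < n) vN_tr (e i i)))%:E]].

(* The complex N (x)_{Z[G]} F, for F the bar resolution of Z by free left     *)
(* Z[G]-modules: a chain with coefficients c is sum_x c(x) [x], and           *)
(*   d (a [g])     = a g [] - a [],                                           *)
(*   d (a [g | h]) = a g [h] - a [g h] + a [g].                               *)
Definition finite_chain (X : Type) (c : X -> N) : Prop :=
  finite_set [set x | c x != 0].

Definition bdry1 (c : G -> N) : N :=
  \sum_(g \in [set: G]) (c g * vN_ltr R g - c g).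

Definition bdry2 (c : G * G -> N) (x : G) : N :=
  \sum_(g \in [set: G]) c (g, x) * vN_ltr R g
  - \sum_(g \in [set: G]) c (g, (g^-1 * x)%g)
  + \sum_(h \in [set: G]) c (x, h).

Definition cycles1 : set (G -> N^o) :=
  [set z | finite_chain z /\ bdry1 z = 0].

Definition boundaries1 : set (G -> N^o) :=
  [set z | exists2 c, finite_chain c & z = bdry2 c].

(* The first L^2-Betti number, as the dimension of H_1(G; N).                 *)
Definition beta1 : \bar R := vN_dim cycles1 boundaries1.

End L2Betti.

(* Main.v *)
Require Import Defs.
From HB Require Import structures.
From mathcomp Require Import all_boot all_order all_algebra.
From mathcomp Require Import all_classical all_reals all_analysis.
From mathcomp Require Import complex ring lra.
Import Order.TTheory GRing.Theory Num.Theory.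
Import numFieldNormedType.Exports.

(** The first homology of G with coefficients in N, the von Neumann algebra,
    has dimension 0 if no idempotent matrix e <> 0 has its module of rows
    embedded in it.  Two facts together exclude such an embedding.

    The first is about rows over N (dense_annihilator).  A submodule K of N^J is
    dense in its closure, the rows vanishing on the common kernel of K in
    l2^J: the quotient of the closure by K has dimension 0.  This follows from
    the equality of the ranks of an equivariant operator and of its adjoint
    (index_formula), applied to finite parts of K.  Hence it is enough to show
    that cycles lie in the closure of the boundaries, among the chains carried
    by a large finite set: if a tuple rho of square-summable functions is
    orthogonal to boundaries in the sense that its pairing with them is 0, then
    its pairing with cycles is 0 too (cycle_pairing).

    The second is about cocycles.  Such a rho gives a cocycle with values in l2
    on the subgroup of those g whose elementary chain [g] is homologous to a
    chain carried by the finite set.  By relative property (T) there is a finite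
    set F such that a cocycle on any subgroup containing F is bounded on an
    infinite subgroup B, of finite index in a conjugate of A
    (relative_T_cocycle): otherwise the kernels 1 / (1 + c |b(x^-1 y)|^2) would
    be positive definite, close to 1 on finite sets and small along A, and their
    reproducing kernel Hilbert space would have almost invariant vectors without
    invariant vectors for A.  A bounded cocycle is inner, the centre of its
    values being fixed by the affine action (chebyshev_center).

    After subtraction of a coboundary, the pairing with rho vanishes on B.  The
    condition that (1 - n) [g] = 0 for infinitely many n forces values in l2 to
    vanish at [g], as no nonzero square-summable function is invariant under
    infinitely many translations; by density again, this persists for relations
    involving [g] (vanish_on_sum).  If g n g^-1 = m and the pairing vanishes at
    [n] and [m], then (1 - m) [g] = [m] - g [n] up to a boundary.  Therefore, in
    a maximal submodule of chains on which the pairing vanishes where it is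
    defined, the group of those g with [g] in the submodule contains every g
    moving it to a position with an infinite intersection.  Such a group
    contains the conjugate of A, then all of G by weak normality or weak
    quasi-normality (absorbing_full).  So the pairing is a coboundary, and it
    vanishes on cycles. *)

Set Implicit Arguments.
Unset Strict Implicit.
Unset Printing Implicit Defensive.

Local Open Scope classical_set_scope.
Local Open Scope ring_scope.
Local Open Scope complex_scope.

(** * Hilbert spaces *)

(** Only the squared norm is part of the structure: the inner product is
    recovered from it by polarization, and the spaces met below (square-summable
    functions, direct sums, kernel spaces) all come with a squared norm that is
    a sum or a supremum. *)
HB.mixin Record isHilbert (R : realType) H of GRing.Lmodule R[i] H := {
  sqn : H -> R;
  sqn_ge0 : forall x, 0 <= sqn x;
  sqn_eq0 : forall x, sqn x = 0 -> x = 0;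
  sqnZ : forall (c : R[i]) x, sqn (c *: x) = sqmod c * sqn x;
  sqn_parallelogram : forall x y,
    sqn (x + y) + sqn (x - y) = (sqn x + sqn y) *+ 2;
  sqn_complete : forall u : nat -> H,
    (forall e : R, 0 < e -> exists n0 : nat, forall n m,
       (n0 <= n)%N -> (n0 <= m)%N -> sqn (u n - u m) < e) ->
    exists l, forall e : R, 0 < e -> exists n0 : nat, forall n,
       (n0 <= n)%N -> sqn (u n - l) < e }.

#[short(type="hilbertType")]
HB.structure Definition Hilbert (R : realType) :=
  {H of isHilbert R H & GRing.Lmodule R[i] H}.

Section InnerProduct.
Variables (R : realType) (H : hilbertType R).
Implicit Types (x y z : H) (t : R).

(** The real part of the Hermitian inner product. *)
Definition ip x y : R := (sqn (x + y) - sqn (x - y)) / 4.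

Lemma sqmodR t : sqmod (t%:C) = t ^+ 2.
Proof. by rewrite /sqmod /= expr0n addr0. Qed.

Lemma sqmod_i : sqmod ('i%C : R[i]) = 1.
Proof. by rewrite /sqmod /= expr0n expr1n add0r. Qed.

Lemma sqnN x : sqn (- x) = sqn x.
Proof.
by rewrite -scaleN1r sqnZ /sqmod /= oppr0 expr0n addr0 sqrrN expr1n mul1r.
Qed.

Lemma sqn0 : sqn (0 : H) = 0.
Proof. by rewrite -(scale0r (0 : H)) sqnZ /sqmod /= expr0n addr0 mul0r. Qed.

Lemma sqnB x y : sqn (x - y) = sqn (y - x).
Proof. by rewrite -sqnN opprB. Qed.

Lemma ipC x y : ip x y = ip y x.
Proof. by rewrite /ip (addrC x) (sqnB x y). Qed.

Lemma ipxx x : ip x x = sqn x.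
Proof.
rewrite /ip subrr sqn0 subr0 -mulr2n -scaler_nat sqnZ.
have -> : (2%:R : R[i]) = (2%:R)%:C by rewrite rmorph_nat.
by rewrite sqmodR; lra.
Qed.

Lemma ipNl x y : ip (- x) y = - ip x y.
Proof. by rewrite /ip (addrC (- x)) (sqnB y x) -opprD sqnN (addrC x); lra. Qed.

Lemma ip0l x : ip 0 x = 0.
Proof. by rewrite /ip sub0r sqnN add0r subrr mul0r. Qed.

Let ip_sum x y z : ip (x + y) z + ip (x - y) z = ip x z *+ 2.
Proof.
have P a b : sqn (a + b) = (sqn a + sqn b) *+ 2 - sqn (a - b).
  by rewrite -(sqn_parallelogram a b) addrK.
rewrite /ip.
have := sqn_parallelogram (x + z) y; have := sqn_parallelogram (x - z) y.
rewrite -!addrA !(addrC (- z)) !(addrC z) !addrA; lra.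
Qed.

Lemma ipDl x y z : ip (x + y) z = ip x z + ip y z.
Proof.
pose a := 2^-1%:C *: (x + y); pose b := 2^-1%:C *: (x - y).
have half : (2^-1%:C + 2^-1%:C : R[i]) = 1.
  by rewrite -rmorphD /= -[RHS](rmorph1 (real_complex R)); congr (_%:C); lra.
have ea : a + b = x.
  by rewrite /a /b -scalerDr addrACA subrr addr0 scalerDr -scalerDl half scale1r.
have eb : a - b = y.
  rewrite /a /b -scalerBr opprB [X in _ *: X]addrC addrA subrK.
  by rewrite scalerDr -scalerDl half scale1r.
have -> : x + y = a + a by rewrite /a -scalerDl half scale1r.
have := ip_sum a a z; rewrite subrr ip0l addr0 => ->.
by rewrite -(ip_sum a b z) ea eb.
Qed.

Lemma ipDr x y z : ip z (x + y) = ip z x + ip z y.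
Proof. by rewrite ipC ipDl !(ipC z). Qed.

Lemma ipNr x y : ip y (- x) = - ip y x.
Proof. by rewrite ipC ipNl ipC. Qed.

Lemma ipBl x y z : ip (x - y) z = ip x z - ip y z.
Proof. by rewrite ipDl ipNl. Qed.

Lemma ipBr x y z : ip z (x - y) = ip z x - ip z y.
Proof. by rewrite ipDr ipNr. Qed.

Lemma ip0r x : ip x 0 = 0.
Proof. by rewrite ipC ip0l. Qed.

Lemma sqnD x y : sqn (x + y) = sqn x + ip x y *+ 2 + sqn y.
Proof. by rewrite -!ipxx ipDl !ipDr (ipC y x); lra. Qed.

Lemma sqnBE x y : sqn (x - y) = sqn x - ip x y *+ 2 + sqn y.
Proof. by rewrite sqnD ipNr sqnN; lra. Qed.

Lemma ip_bound x y : `|ip x y| <= (sqn x + sqn y) / 2.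
Proof.
rewrite ler_norml; have := sqn_ge0 (x + y); have := sqn_ge0 (x - y).
by rewrite sqnBE sqnD; lra.
Qed.

(** Additivity of the inner product yields homogeneity for rational scalars
    only; the bound rules out the wild solutions of Cauchy's equation. *)
Lemma additive_bounded_linear (f : R -> R) (C : R) :
  (forall s t, f (s + t) = f s + f t) ->
  (forall t, 0 <= t <= 1 -> `|f t| <= C) -> forall t, f t = t * f 1.
Proof.
move=> fD fC.
have f0 : f 0 = 0 by have := fD 0 0; rewrite addr0; lra.
have fN t : f (- t) = - f t by have := fD t (- t); rewrite subrr f0; lra.
have fn (n : nat) t : f (t *+ n) = f t *+ n.
  by elim: n => [|n IH]; rewrite ?mulr0n // !mulrS fD IH.
have fz (n : int) t : f (t *~ n) = f t *~ n.
  by case: n => n; rewrite ?NegzE ?mulrNz ?fN -!pmulrn fn.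
pose g t := f t - t * f 1.
have gz (n : int) t : g (t *~ n) = g t *~ n.
  by rewrite /g fz mulrzBl mulrzAl.
have gD s u : g (s + u) = g s + g u by rewrite /g fD; ring.
have g1 : g 1 = 0 by rewrite /g mul1r subrr.
have gC u : `|g u| <= C + `|f 1|.
  have -> : g u = g (u - (Num.floor u)%:~R).
    rewrite -[in LHS](subrK (Num.floor u)%:~R u) [LHS]gD.
    by rewrite [X in _ + X]gz g1 mul0rz addr0.
  have /andP[lo hi] : 0 <= u - (Num.floor u)%:~R <= 1.
    have := floor_itv u; rewrite intrD => /andP[]; lra.
  rewrite /g (le_trans (ler_normB _ _)) // lerD ?fC ?lo //.
  by rewrite normrM ger0_norm // ler_piMl.
move=> t; apply/eqP; rewrite -subr_eq0; apply/eqP; rewrite -/(g t).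
apply/eqP; rewrite -normr_le0; apply/ler_addgt0Pr => e e0; rewrite add0r.
have [n /ltW nP] : exists n : nat, (C + `|f 1|) / e < n%:R.
  exists (Num.bound ((C + `|f 1|) / e)); apply: archi_boundP.
  by rewrite divr_ge0 ?(ltW e0) // (le_trans _ (gC 0)).
have := gC (t *+ n.+1); rewrite pmulrn gz -pmulrn normrMn => h.
rewrite -(@ler_pMn2r _ n.+1) // (le_trans h) // -mulr_natl -ler_pdivrMr //.
by rewrite (le_trans nP) // ler_nat.
Qed.

Lemma ipZl t x y : ip (t%:C *: x) y = t * ip x y.
Proof.
rewrite -[in RHS](scale1r x) -[1](rmorph1 (real_complex R)).
apply: (@additive_bounded_linear (fun t => ip (t%:C *: x) y)
  ((sqn x + sqn y) / 2)) => [s u|s /andP[s0 s1]].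
  by rewrite rmorphD /= scalerDl ipDl.
apply: le_trans (ip_bound _ _) _; rewrite sqnZ sqmodR.
rewrite ler_pM2r ?invr_gt0 // lerD2r ler_piMl ?sqn_ge0 //.
by rewrite expr_le1.
Qed.

Lemma ipZr t x y : ip x (t%:C *: y) = t * ip x y.
Proof. by rewrite ipC ipZl ipC. Qed.

Lemma ipi x y : ip ('i *: x) ('i *: y) = ip x y.
Proof. by rewrite /ip -scalerDr -scalerBr !sqnZ sqmod_i !mul1r. Qed.

Lemma ip_il x y : ip ('i *: x) y = - ip x ('i *: y).
Proof.
rewrite -[LHS]ipi scalerA -expr2 sqr_i scaleN1r ipNl //.
Qed.

Lemma cauchy_schwarz x y : ip x y ^+ 2 <= sqn x * sqn y.
Proof.
have h t : 0 <= sqn x - t * ip x y *+ 2 + t ^+ 2 * sqn y.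
  by rewrite -sqmodR -sqnZ -ipZr -sqnBE sqn_ge0.
have := sqn_ge0 y; rewrite le_eqVlt => /orP[/eqP y0|y0].
  by move/esym/sqn_eq0: (y0) => ->; rewrite ip0r sqn0 mulr0 expr0n.
have := h (ip x y / sqn y); set a := ip x y; set b := sqn y.
have b0 : b != 0 by rewrite gt_eqF.
have -> : sqn x - a / b * a *+ 2 + (a / b) ^+ 2 * b = (sqn x * b - a ^+ 2) / b.
  by field.
by rewrite pmulr_lge0 ?invr_gt0 // subr_ge0.
Qed.

Lemma sqnD_le x y : sqn (x + y) <= (sqn x + sqn y) *+ 2.
Proof. by rewrite -sqn_parallelogram lerDl sqn_ge0. Qed.

Lemma ip_nondeg x y : (forall z, ip x z = ip y z) -> x = y.
Proof.
move=> e; apply/eqP; rewrite -subr_eq0; apply/eqP/sqn_eq0.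
by rewrite -ipxx ipBl e subrr.
Qed.

End InnerProduct.

(** * From Hilbert structures to normed modules *)

Lemma sqnB_lt (R : realType) (H : hilbertType R) (x y z : H) (d e : R) :
  sqn (x - y) < d -> sqn (z - y) < e -> sqn (x - z) < (d + e) *+ 2.
Proof.
move=> xy zy; have -> : x - z = (x - y) + (y - z) by rewrite addrA subrK.
by apply: le_lt_trans (sqnD_le _ _) _; rewrite (sqnB y); lra.
Qed.

(** The Hilbert space H under a head symbol to which its normed structure can
    be attached. *)
Definition normed_copy (R : realType) (H : hilbertType R) : Type := H.

Section NormedCopy.
Variables (R : realType) (H : hilbertType R).
Local Notation C := R[i].

HB.instance Definition _ := GRing.Lmodule.on (normed_copy H).

Definition hnorm (x : normed_copy H) : C := (Num.sqrt (sqn (x : H)))%:C.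

Fact hnormD (x y : normed_copy H) : hnorm (x + y) <= hnorm x + hnorm y.
Proof.
rewrite /hnorm -rmorphD lecR -(@ler_pXn2r _ 2) ?nnegrE ?addr_ge0 ?sqrtr_ge0 //.
rewrite sqrrD !sqr_sqrtr ?sqn_ge0 // sqnD lerD2r lerD2l lerMn2r /=.
rewrite -sqrtrM ?sqn_ge0 // (le_trans (ler_norm _)) // -sqrtr_sqr.
by rewrite ler_wsqrtr // cauchy_schwarz.
Qed.

Fact hnormZ (c : C) (x : normed_copy H) : hnorm (c *: x) = `|c| * hnorm x.
Proof.
rewrite /hnorm sqnZ sqrtrM ?addr_ge0 ?sqr_ge0 // rmorphM; congr (_ * _).
by rewrite normc_def.
Qed.

Fact hnorm_eq0 (x : normed_copy H) : hnorm x = 0 -> x = 0.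
Proof.
move=> [/eqP]; rewrite sqrtr_eq0 => x0.
by apply: (@sqn_eq0 R H x); apply/eqP; rewrite eq_le x0 sqn_ge0.
Qed.

HB.instance Definition _ :=
  Lmodule_isNormed.Build C (normed_copy H) hnormD hnormZ hnorm_eq0.

Lemma norm_ltE (x : normed_copy H) (e : R) : 0 < e ->
  (`|x| < e%:C) = (sqn (x : H) < e ^+ 2).
Proof.
move=> e0; have -> : `|x| = hnorm x by [].
rewrite /hnorm ltcR -(@ltr_pXn2r _ 2) ?nnegrE ?sqrtr_ge0 ?(ltW e0) //.
by rewrite sqr_sqrtr ?sqn_ge0.
Qed.

Lemma gt0_complexP (e : C) : 0 < e -> exists2 r : R, 0 < r & e = r%:C.
Proof.
case: e => a b; rewrite ltcE /= => /andP[/eqP b0 a0]; by exists a; rewrite // b0.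
Qed.

Fact normed_copy_complete (F : set_system (normed_copy H)) :
  ProperFilter F -> cauchy F -> cvg F.
Proof.
move=> FF /cauchyP Fc.
have e_gt0 (n : nat) : 0 < (n.+1%:R^-1 : R) by rewrite invr_gt0 ltr0n.
have /choice[u uP] (n : nat) : exists x : normed_copy H,
    F [set y | sqn (x - y : H) < n.+1%:R^-1 ^+ 2].
  have [|x xF] := Fc (n.+1%:R^-1)%:C; first by rewrite ltcR.
  exists x; apply: filterS xF => y; rewrite -ball_normE /ball_ /=.
  by rewrite norm_ltE.
have inv_small (e : R) : 0 < e -> exists n0 : nat, forall n, (n0 <= n)%N ->
    n.+1%:R^-1 ^+ 2 *+ 4 < e.
  move=> e0; exists (Num.bound (4 / e)) => n nn.
  have h : 4 / e < n.+1%:R.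
    apply: (lt_le_trans (archi_boundP _)); first by rewrite divr_ge0 ?ltW.
    by rewrite ler_nat (leq_trans nn).
  rewrite ltr_pdivrMr // mulrC -ltr_pdivrMr // in h.
  rewrite -mulr_natr mulrC; apply: le_lt_trans h; rewrite ler_pM2l // expr2.
  by rewrite ler_piMl ?invr_ge0 // invf_le1 // ler1n.
have [|l lP] := @sqn_complete _ H u.
  move=> e e0; have [n0 n0P] := inv_small e e0; exists n0 => n m nn nm.
  have [y [/= y1 y2]] := filter_ex (filterI (uP n) (uP m)).
  apply: lt_trans (sqnB_lt y1 y2) _.
  move: (n0P _ nn) (n0P _ nm).
  by move: (n.+1%:R^-1 ^+ 2) (m.+1%:R^-1 ^+ 2) => a b; lra.
apply: (cvgP (l : normed_copy H)); apply/fcvgrPdist_lt => _ /gt0_complexP[e e0 ->].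
have e2 : 0 < e ^+ 2 / 4 by rewrite divr_gt0 ?exprn_gt0.
have [n1 n1P] := lP _ e2; have [n2 n2P] := inv_small _ e2.
have := uP (maxn n1 n2); apply: filterS => y /= yP; rewrite norm_ltE //.
have := n1P _ (leq_maxl n1 n2); rewrite sqnB => lu; rewrite sqnB in yP.
apply: lt_trans (sqnB_lt lu yP) _.
by move: (n2P _ (leq_maxr n1 n2)); move: (_^-1 ^+ 2) => a; lra.
Qed.

HB.instance Definition _ :=
  Uniform_isComplete.Build (normed_copy H) normed_copy_complete.

(** The Hermitian form with real part ip. *)
Definition cform (x y : normed_copy H) : C :=
  ip (x : H) y +i* ip (x : H) ('i *: (y : H)).

Let cformZl (c : C) x y : cform (c *: x) y = c * cform x y.
Proof.
case: c => a b; have -> : (a +i* b) = a%:C + 'i * b%:C by simpc.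
rewrite /cform !scalerDl -!scalerA !ipDl !ip_il !ipZl.
rewrite scalerA -expr2 sqr_i scaleN1r ipNr.
by apply/eqP; rewrite eq_complex /=; apply/andP; split; apply/eqP; ring.
Qed.

Let cform_herm x y : cform x y = (-1) ^+ false * (cform y x)^*.
Proof.
rewrite expr0 mul1r /cform /=; congr (_ +i* _); first exact: ipC.
by rewrite ipC ip_il.
Qed.

Fact cform_bilinear : bilinear_for *%R (Num.conj \; *%R) cform.
Proof.
split=> [y a x z|x a y z] /=.
  rewrite -cformZl /cform !ipDl; by apply/eqP; rewrite eq_complex /= !eqxx.
rewrite cform_herm expr0 mul1r.
have -> : cform (a *: y + z) x = a * cform y x + cform z x.
  rewrite -cformZl /cform !ipDl; by apply/eqP; rewrite eq_complex /= !eqxx.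
rewrite rmorphD rmorphM /=; congr (_ * _ + _).
  by rewrite [RHS]cform_herm mul1r.
by rewrite [RHS]cform_herm mul1r.
Qed.

HB.instance Definition _ := bilinear_isBilinear.Build C (normed_copy H)
  (normed_copy H) C *%R (Num.conj \; *%R) cform cform_bilinear.
HB.instance Definition _ := isHermitianSesquilinear.Build C (normed_copy H)
  false Num.conj cform cform_herm.

Fact cform_gt0 (x : normed_copy H) : x != 0 -> 0 < cform x x.
Proof.
move=> x0; rewrite /cform.
have -> : ip (x : H) ('i *: (x : H)) = 0.
  have := ip_il (x : H) x; rewrite ipC; lra.
rewrite ltcR ipxx lt_def sqn_ge0 andbT; apply: contra x0 => /eqP.
by move/sqn_eq0 => ->.
Qed.
HB.instance Definition _ := isDotProduct.Build C (normed_copy H) cform cform_gt0.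

Lemma cform_hilbert : is_hilbert (cform : {dot normed_copy H for Num.conj}).
Proof.
move=> x; have -> : `|x| = hnorm x by [].
rewrite /hnorm -rmorphXn sqr_sqrtr ?sqn_ge0 //= /cform ipxx.
have -> // : ip (x : H) ('i *: (x : H)) = 0.
have := ip_il (x : H) x; rewrite ipC; lra.
Qed.

End NormedCopy.

(** Relative property (T) in terms of squared norms only, the form in which it
    is applied to a kernel space. *)
Lemma relative_T_hilbert (R : realType) (G : groupType) (A : set G)
  (H : hilbertType R) (pi : G -> H -> H) :
  relative_T R A ->
  (forall g, linear (pi g)) -> (forall x, pi 1%g x = x) ->
  (forall g h x, pi (g * h)%g x = pi g (pi h x)) ->
  (forall g x, sqn (pi g x) = sqn x) ->
  (forall (F : set G) (e : R), finite_set F -> 0 < e ->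
     exists xi : H, sqn xi = 1 /\ forall g, F g -> sqn (pi g xi - xi) < e) ->
  exists xi : H, xi != 0 /\ forall a, A a -> pi a xi = xi.
Proof.
move=> T pilin pi1 piM piN piA.
pose pil g : {linear normed_copy H -> normed_copy H} :=
  HB.pack (pi g : normed_copy H -> normed_copy H)
    (GRing.isLinear.Build _ _ _ _ (pi g : normed_copy H -> normed_copy H) (pilin g)).
have [|||] := T (normed_copy H) (@cform R H : {dot normed_copy H for Num.conj}) pil.
- exact: cform_hilbert.
- split=> // g x y.
  have piD u v : pi g (u + v) = pi g u + pi g v by exact: (linearD (pil g)).
  have piB u v : pi g (u - v) = pi g u - pi g v by exact: (linearB (pil g)).
  have piZ c u : pi g (c *: u) = c *: pi g u by exact: (linearZ_LR (pil g)).
  have ipp (u v : H) : ip (pi g u) (pi g v) = ip u v.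
    by rewrite /ip -piD -piB !piN.
  by rewrite /= /cform ipp -piZ ipp.
- move=> F e Ff e0; have [xi [x1 xP]] := piA F _ Ff (exprn_gt0 2 e0).
  exists xi; split; first by rewrite -[LHS]/(hnorm xi) /hnorm x1 sqrtr1.
  by move=> g /xP; rewrite -norm_ltE.
by move=> xi xiP; exists xi.
Qed.

(** * Closest points, projections and adjoints *)

Section Projection.
Variables (R : realType) (H : hilbertType R).
Implicit Types (x y z : H) (C V : set H).

Definition hclosed C := forall l,
  (forall e : R, 0 < e -> exists2 x, C x & sqn (x - l) < e) -> C l.

(** Lower semicontinuity of the norm. *)
Lemma sqn_lim_le x (c : R) l :
  (forall e : R, 0 < e -> exists2 z, sqn (z - l) < e & sqn (z - x) < c + e) ->
  sqn (l - x) <= c.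
Proof.
move=> h; rewrite leNgt; apply/negP => cl.
set s := sqn (l - x) in cl *.
have s0 : 0 <= s by exact: sqn_ge0.
pose d := s - c; have d0 : 0 < d by rewrite subr_gt0.
(* the radius e is small enough for 2 sqrt(s e) + 2 e <= d *)
pose e := Num.min (d / 4) (d ^+ 2 / (16 * (s + 1))).
have e0 : 0 < e.
  by rewrite lt_min !divr_gt0 ?mulr_gt0 ?exprn_gt0 // ltr_wpDl.
have [z zl zx] := h _ e0.
have e1 : e <= d / 4 by rewrite ge_min lexx.
have e2 : e * (16 * (s + 1)) <= d ^+ 2.
  by rewrite -ler_pdivlMr ?ge_min ?lexx ?orbT // mulr_gt0 // ltr_wpDl.
have eq1 : z - x = (z - l) + (l - x) by rewrite addrA subrK.
have := sqnD (z - l) (l - x); rewrite -eq1 -/s => sz.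
have cs := cauchy_schwarz (z - l) (l - x); rewrite -/s in cs.
set a := ip (z - l) (l - x) in sz cs.
have ad : - (d / 4) < a.
  rewrite ltNge; apply/negP => ad.
  have : (d / 4) ^+ 2 <= a ^+ 2.
    by rewrite -[a ^+ 2]sqrrN lerXn2r ?nnegrE; lra.
  apply/negP; rewrite -ltNge; apply: le_lt_trans cs _.
  have : sqn (z - l) * s <= e * s by rewrite ler_wpM2r // ltW.
  move: e2 e0; nra.
have := sqn_ge0 (z - l); rewrite /d in e1 ad *; lra.
Qed.

(** The midpoint inequality makes every minimizing sequence a Cauchy sequence.
    This covers closest points as well as centres of bounded sets. *)
Lemma strongly_convex_min C (f : H -> R) (m0 : R) :
  (exists x, C x) -> (forall x, C x -> m0 <= f x) ->
  (forall x y, C x -> C y -> C (2^-1%:C *: (x + y)) /\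
     f (2^-1%:C *: (x + y)) <= (f x + f y) / 2 - sqn (x - y) / 4) ->
  (forall l c, (forall e : R, 0 < e ->
     exists x, [/\ C x, sqn (x - l) < e & f x < c + e]) -> C l /\ f l <= c) ->
  exists2 x, C x & forall y, C y -> f x <= f y.
Proof.
move=> [x0 Cx0] fm mid lsc; pose E := f @` C; pose m := inf E.
have hE : has_inf E.
  by split; [exists (f x0), x0 | exists m0 => _ [x Cx <-]; exact: fm].
have mle x : C x -> m <= f x by move=> Cx; apply: inf_lbound; [case: hE|exists x].
have inv0 (n : nat) : 0 < (n.+1%:R^-1 : R) by rewrite invr_gt0 ltr0n.
have /choice[u uP] (n : nat) : exists x, C x /\ f x < m + n.+1%:R^-1.
  by have [_ [x Cx <-] xm] := inf_adherent (inv0 n) hE; exists x.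
have inv_lt (e : R) : 0 < e -> exists n0 : nat, forall n, (n0 <= n)%N ->
    n.+1%:R^-1 < e.
  move=> e0; exists (Num.bound e^-1) => n nn.
  rewrite invf_plt ?posrE // (lt_le_trans (archi_boundP _)) ?invr_ge0 ?ltW //.
  by rewrite ltr_nat ltnS.
have [|l lP] := @sqn_complete _ H u.
  move=> e e0; have [|n0 n0P] := inv_lt (e / 4); first by rewrite divr_gt0.
  exists n0 => n k /n0P hn /n0P hk.
  have [[Cn fn] [Ck fk]] := (uP n, uP k).
  have [Cm fmid] := mid _ _ Cn Ck; have := mle _ Cm.
  move: hn hk fn fk; move: (n.+1%:R^-1) (k.+1%:R^-1) => a b; lra.
have [e e0|Cl fl] := lsc l m.
  have [n1 n1P] := lP _ e0; have [n2 n2P] := inv_lt _ e0.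
  have [Cu fu] := uP (maxn n1 n2); exists (u (maxn n1 n2)); split=> //.
    by apply: n1P; exact: leq_maxl.
  by apply: lt_trans fu _; rewrite ltrD2l n2P ?leq_maxr.
by exists l => // y /mle; apply: le_trans.
Qed.

Lemma mid_sqnB x y z :
  sqn (2^-1%:C *: (x + y) - z) =
  (sqn (x - z) + sqn (y - z)) / 2 - sqn (x - y) / 4.
Proof.
rewrite !sqnBE sqnZ sqmodR ipZl sqnD ipDl; lra.
Qed.

Lemma closest_point C z : (exists x, C x) -> hclosed C ->
  (forall x y, C x -> C y -> C (2^-1%:C *: (x + y))) ->
  exists2 p, C p & forall y, C y -> sqn (p - z) <= sqn (y - z).
Proof.
move=> C0 Ccl Cmid.
apply: (@strongly_convex_min C (fun x => sqn (x - z)) 0) => //.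
- by move=> x _; exact: sqn_ge0.
- by move=> x y Cx Cy; rewrite mid_sqnB; split=> //; exact: Cmid.
- move=> l c h; split.
    by apply: Ccl => e /h[x [Cx xl _]]; exists x.
  by apply: sqn_lim_le => e /h[x [_ xl xc]]; exists x.
Qed.

(** The points of a bounded set lie in a unique smallest ball; its centre is
    fixed by every isometry of the set. *)
Lemma chebyshev_center (I : Type) (b : I -> H) (B : set I) (M : R) :
  (exists i, B i) -> (forall i, B i -> sqn (b i) <= M) ->
  exists2 c, (exists r : R, forall i, B i -> sqn (c - b i) <= r) &
    forall x, (forall r : R, (forall i, B i -> sqn (c - b i) <= r) ->
       forall i, B i -> sqn (x - b i) <= r) -> x = c.
Proof.
move=> [i0 Bi0] bM; pose f x := sup [set sqn (x - b i) | i in B].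
have fb x : has_sup [set sqn (x - b i) | i in B].
  split; first by exists (sqn (x - b i0)), i0.
  exists ((sqn x + M) *+ 2) => _ [i Bi <-].
  have := sqnD_le x (- b i); rewrite sqnN; have := bM i Bi; lra.
have fge x i : B i -> sqn (x - b i) <= f x.
  by move=> Bi; apply: sup_upper_bound; [exact: fb | exists i].
have fle x c : (forall i, B i -> sqn (x - b i) <= c) -> f x <= c.
  by move=> h; apply: ge_sup; [case: (fb x) | move=> _ [i Bi <-]; exact: h].
have fmid x y : f (2^-1%:C *: (x + y)) <= (f x + f y) / 2 - sqn (x - y) / 4.
  apply: fle => i Bi; rewrite mid_sqnB; have := fge x i Bi; have := fge y i Bi.
  lra.
have [||||c _ cP] := @strongly_convex_min setT f 0.
- by exists 0.
- by move=> x _; apply: le_trans (fge x i0 Bi0); exact: sqn_ge0.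
- by [].
- move=> l r h; split=> //; apply: fle => i Bi; apply: sqn_lim_le => e e0.
  have [x [_ xl xr]] := h _ e0; exists x => //.
  exact: le_lt_trans (fge _ _ Bi) xr.
exists c; first by exists (f c); exact: fge.
move=> x xP; have fx : f x <= f c by apply: fle => i; apply: xP; exact: fge.
have := cP (2^-1%:C *: (x + c)) Logic.I; have := fmid x c => h1 h2.
apply/eqP; rewrite -subr_eq0; apply/eqP/sqn_eq0/eqP.
by rewrite eq_le sqn_ge0 andbT; lra.
Qed.

Definition closed_subspace V :=
  [/\ V 0, forall (c : R[i]) x y, V x -> V y -> V (c *: x + y) & hclosed V].

Lemma quad_ge0 (a b : R) : (forall t, 0 <= t ^+ 2 * a - t * b *+ 2) -> b = 0.
Proof.
move=> h; have h1 : 0 <= a by have := h 1; have := h (-1); lra.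
have := h (b / (a + 1)); have a1 : a + 1 != 0 by rewrite gt_eqF ?ltr_wpDl.
have -> : (b / (a + 1)) ^+ 2 * a - b / (a + 1) * b *+ 2 =
    - (b ^+ 2 * ((a + 2) / (a + 1) ^+ 2)) by field.
rewrite oppr_ge0 pmulr_lle0; last first.
  by rewrite divr_gt0 ?exprn_gt0 ?ltr_wpDl.
by move=> b0; apply/eqP; rewrite -sqrf_eq0 eq_le b0 sqr_ge0.
Qed.

Section Subspace.
Variables (V : set H) (Vs : closed_subspace V).

Lemma subspace0 : V 0. Proof. by case: Vs. Qed.
Lemma subspaceP c x y : V x -> V y -> V (c *: x + y).
Proof. by case: Vs => _ h _; exact: h. Qed.
Lemma subspaceD x y : V x -> V y -> V (x + y).
Proof. by move=> Vx Vy; rewrite -(scale1r x); exact: subspaceP. Qed.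
Lemma subspaceZ c x : V x -> V (c *: x).
Proof. by move=> Vx; rewrite -[_ *: _]addr0; apply: subspaceP => //; case: Vs. Qed.
Lemma subspaceB x y : V x -> V y -> V (x - y).
Proof. by move=> Vx Vy; rewrite addrC -scaleN1r; exact: subspaceP. Qed.

(** The closest point p satisfies |p - x|^2 <= |p + t v - x|^2 for all real t
    and all v in V, so that the linear term in t vanishes. *)
Lemma hproj_exists x : exists p, V p /\ forall v, V v -> ip (x - p) v = 0.
Proof.
have [||v w Vv Vw|p Vp pP] := @closest_point V x.
- by exists 0; exact: subspace0.
- by case: Vs.
- by apply: subspaceZ; exact: subspaceD.
exists p; split=> // v Vv; apply: (@quad_ge0 (sqn v)) => t.
have := pP (p + t%:C *: v) (subspaceD Vp (subspaceZ _ Vv)).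
rewrite (sqnB p) (sqnB (p + _)) opprD addrA.
by rewrite [X in _ <= X -> _]sqnBE ipZr sqnZ sqmodR; lra.
Qed.
End Subspace.

Definition hproj V x : H := xget 0 [set p | V p /\ forall v, V v -> ip (x - p) v = 0].

Section ProjTheory.
Variables (V : set H) (Vs : closed_subspace V).

Lemma hprojP x : V (hproj V x) /\ forall v, V v -> ip (x - hproj V x) v = 0.
Proof. exact: (xgetPex 0 (hproj_exists Vs x)). Qed.

Lemma hproj_in x : V (hproj V x). Proof. by case: (hprojP x). Qed.

Lemma ip_hproj x v : V v -> ip (hproj V x) v = ip x v.
Proof. by move=> Vv; have := (hprojP x).2 v Vv; rewrite ipBl; lra. Qed.

Lemma hproj_unique x p : V p -> (forall v, V v -> ip p v = ip x v) -> p = hproj V x.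
Proof.
move=> Vp pP; apply/eqP; rewrite -subr_eq0; apply/eqP/sqn_eq0; rewrite -ipxx.
have Vd : V (p - hproj V x) by apply: subspaceB => //; exact: hproj_in.
by rewrite ipBl pP // ip_hproj // subrr.
Qed.

Lemma hproj_id v : V v -> hproj V v = v.
Proof. by move=> Vv; apply/esym/hproj_unique. Qed.

Lemma ip_hprojl x y : ip (hproj V x) y = ip x (hproj V y).
Proof. by rewrite -(ip_hproj x (hproj_in y)) ipC -(ip_hproj y (hproj_in x)) ipC. Qed.

Lemma sqn_hproj x : sqn (hproj V x) = ip (hproj V x) x.
Proof. by rewrite -ipxx (ip_hproj x (hproj_in x)) ipC. Qed.

Lemma sqn_hprojB x : sqn (x - hproj V x) = sqn x - sqn (hproj V x).
Proof. by rewrite sqnBE ipC -sqn_hproj; lra. Qed.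

Lemma sqn_hproj_le x : sqn (hproj V x) <= sqn x.
Proof. by rewrite -subr_ge0 -sqn_hprojB sqn_ge0. Qed.

Lemma hproj_linear : linear (hproj V).
Proof.
move=> c x y; apply/esym/hproj_unique => [|v Vv].
  by apply: subspaceP => //; exact: hproj_in.
have cipZ (u w : H) : V w -> ip (c *: hproj V u) w = ip (c *: u) w.
  move=> Vw; case: c => a b; have -> : (a +i* b) = a%:C + b%:C * 'i.
    by simpc.
  rewrite !scalerDl -!scalerA !ipDl !ipZl !ip_il !ip_hproj //.
  exact: subspaceZ.
by rewrite !ipDl cipZ // ip_hproj.
Qed.
End ProjTheory.

(** A nonzero functional is the inner product with a multiple of the point of
    least norm on the affine hyperplane where it takes the value 1. *)
Lemma riesz (f : H -> R) (M : R) : (forall x y, f (x + y) = f x + f y) ->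
  (forall (t : R) x, f (t%:C *: x) = t * f x) ->
  (forall x, f x ^+ 2 <= M * sqn x) -> exists y, forall x, f x = ip x y.
Proof.
move=> fD fZ fM.
have fB x y : f (x - y) = f x - f y.
  have -> : - y = (-1)%:C *: y by rewrite rmorphN rmorph1 scaleN1r.
  by rewrite fD fZ; lra.
have [|f0] := pselect (exists x, f x != 0); last first.
  exists 0 => x; rewrite ip0r; apply/eqP; apply: contrapT => fx.
  by apply: f0; exists x; apply/negP.
move=> [x0 fx0]; pose C := [set x | f x = 1].
have [|l h|x y fx fy|p fp pP] := @closest_point C 0.
- by exists ((f x0)^-1%:C *: x0); rewrite /C /= fZ mulVf.
- have M0 : 0 <= M.
    have : 0 < M * sqn x0.
      by apply: lt_le_trans (fM x0); rewrite lt_def sqr_ge0 sqrf_eq0 fx0.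
    by move=> /ltW; rewrite pmulr_lge0 // lt_def sqn_ge0 andbT;
      apply: contra fx0 => /eqP /sqn_eq0 ->; rewrite -(scale0r (0 : H)) fZ mul0r.
  rewrite /C /=; apply/eqP; rewrite -subr_eq0 -sqrf_eq0 eq_le sqr_ge0 andbT.
  apply/ler_addgt0Pr => e e0; rewrite add0r.
  have [|x fx xl] := h (e / (M + 1)); first by rewrite divr_gt0 // ltr_wpDl.
  have -> : f l - 1 = f (l - x) by rewrite fB fx.
  apply: le_trans (fM _) _; rewrite sqnB.
  rewrite ltr_pdivlMr ?ltr_wpDl // in xl; have := sqn_ge0 (x - l); nra.
- by rewrite /C /= fZ fD fx fy; lra.
have p0 : sqn p != 0.
  apply/eqP => /sqn_eq0 p0; move: fp; rewrite /C /= p0 -(scale0r (0 : H)) fZ mul0r.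
  by move/esym/eqP; rewrite oner_eq0.
have orth v : f v = 0 -> ip p v = 0.
  move=> fv; apply: (@quad_ge0 (sqn v)) => t.
  have := pP (p - t%:C *: v); rewrite /C /= fB fZ fv mulr0 !subr0 fp => /(_ erefl).
  by rewrite sqnBE ipZr sqnZ sqmodR; lra.
exists ((sqn p)^-1%:C *: p) => x.
have := orth (x - (f x)%:C *: p); rewrite fB fZ fp mulr1 subrr => /(_ erefl).
rewrite ipBr !ipZr ipxx => /eqP; rewrite subr_eq0 ipC => /eqP ->.
by rewrite mulrC mulfK.
Qed.

End Projection.

Definition bounded_op (R : realType) (H K : hilbertType R) (T : H -> K) :=
  linear T /\ exists M : R, forall x, sqn (T x) <= M * sqn x.

Section Adjoint.
Variables (R : realType) (H K : hilbertType R).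

Section OpTheory.
Variables (T : H -> K) (Tb : bounded_op T).
Lemma opP c x y : T (c *: x + y) = c *: T x + T y. Proof. exact: Tb.1. Qed.
Lemma opD x y : T (x + y) = T x + T y.
Proof. by have := opP 1 x y; rewrite !scale1r. Qed.
Lemma op0 : T 0 = 0.
Proof. by apply: (addrI (T 0)); rewrite -opD !addr0. Qed.
Lemma opZ c x : T (c *: x) = c *: T x.
Proof. by have := opP c x 0; rewrite op0 !addr0. Qed.
Lemma opN x : T (- x) = - T x. Proof. by rewrite -scaleN1r opZ scaleN1r. Qed.
Lemma opB x y : T (x - y) = T x - T y. Proof. by rewrite opD opN. Qed.
Lemma op_bound : exists2 M : R, 0 < M & forall x, sqn (T x) <= M * sqn x.
Proof.
have [_ [M MT]] := Tb; exists (`|M| + 1); first by rewrite ltr_wpDl.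
move=> x; apply: le_trans (MT x) _; rewrite ler_wpM2r ?sqn_ge0 //.
by have := ler_norm M; lra.
Qed.

Lemma ker_closed_subspace : closed_subspace [set x | T x = 0].
Proof.
split=> [|c x y /= Tx Ty|l h] /=; first exact: op0.
  by rewrite opP Tx Ty scaler0 addr0.
have [M M0 MT] := op_bound.
apply: sqn_eq0; apply/eqP; rewrite eq_le sqn_ge0 andbT.
apply/ler_addgt0Pr => e e0; rewrite add0r.
have [|x /= Tx xl] := h (e / M); first by rewrite divr_gt0.
have -> : T l = T (l - x) by rewrite opB Tx subr0.
by apply: le_trans (MT _) _; rewrite sqnB mulrC -ler_pdivlMr // ltW.
Qed.

Lemma adjoint_exists y : exists z, forall x, ip (T x) y = ip x z.
Proof.
have [M M0 MT] := op_bound.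
apply: (@riesz _ _ _ (M * sqn y)) => [x x'|t x|x].
- by rewrite opD ipDl.
- by rewrite opZ ipZl.
- apply: le_trans (cauchy_schwarz _ _) _; rewrite mulrAC ler_wpM2r ?sqn_ge0 //.
Qed.
End OpTheory.

Definition adj (T : H -> K) (y : K) : H :=
  xget 0 [set z | forall x, ip (T x) y = ip x z].

Lemma adjP T : bounded_op T -> forall x y, ip (T x) y = ip x (adj T y).
Proof. by move=> Tb x y; have := xgetPex 0 (adjoint_exists Tb y); apply. Qed.

Lemma adjP' T : bounded_op T -> forall x y, ip (adj T y) x = ip y (T x).
Proof. by move=> Tb x y; rewrite ipC -adjP // ipC. Qed.

Lemma adj_bounded T : bounded_op T -> bounded_op (adj T).
Proof.
move=> Tb; split.
  move=> c x y; apply: ip_nondeg => z; rewrite ipDl adjP' // ipDl.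
  rewrite !adjP' //; congr (_ + _); case: c => a b.
  have -> : (a +i* b) = a%:C + b%:C * 'i by simpc.
  by rewrite !scalerDl -!scalerA !ipDl !ipZl !ip_il !adjP' // opZ.
have [M M0 MT] := op_bound Tb; exists M => y.
have [->|/eqP y0] := eqVneq (sqn (adj T y)) 0.
  by rewrite mulr_ge0 ?sqn_ge0 ?ltW.
have yp : 0 < sqn (adj T y) by rewrite lt_def sqn_ge0 andbT; apply/eqP.
rewrite -(ler_pM2r yp) -expr2 -[in X in X ^+ 2]ipxx adjP' // ipC.
apply: le_trans (cauchy_schwarz _ _) _; rewrite [leRHS]mulrAC.
by rewrite ler_wpM2r ?sqn_ge0.
Qed.

End Adjoint.

Section OpAlgebra.
Variables (R : realType) (H K L : hilbertType R).

Lemma bounded_opD (S T : H -> K) : bounded_op S -> bounded_op T ->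
  bounded_op (fun x => S x + T x).
Proof.
move=> Sb Tb; split=> [c x y|]; first by rewrite (opP Sb) (opP Tb) scalerDr addrACA.
have [M M0 MS] := op_bound Sb; have [N N0 NT] := op_bound Tb.
exists ((M + N) *+ 2) => x; apply: le_trans (sqnD_le _ _) _.
by have := MS x; have := NT x; lra.
Qed.

Lemma bounded_opZ (c : R[i]) (T : H -> K) : bounded_op T ->
  bounded_op (fun x => c *: T x).
Proof.
move=> Tb; split=> [d x y|]; first by rewrite (opP Tb) scalerDr !scalerA mulrC.
have [M M0 MT] := op_bound Tb; exists (sqmod c * M) => x.
by rewrite sqnZ -mulrA ler_wpM2l // -lee_fin sqmod_ge0.
Qed.

Lemma bounded_op_id : bounded_op (fun x : H => x).
Proof. by split=> //; exists 1 => x; rewrite mul1r. Qed.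

Lemma bounded_op_comp (S : K -> L) (T : H -> K) :
  bounded_op S -> bounded_op T -> bounded_op (fun x => S (T x)).
Proof.
move=> Sb Tb; split=> [c x y|]; first by rewrite (opP Tb) (opP Sb).
have [M M0 MS] := op_bound Sb; have [N N0 NT] := op_bound Tb.
exists (M * N) => x; apply: le_trans (MS _) _.
by rewrite -mulrA ler_pM2l.
Qed.

Lemma bounded_opB (S T : H -> K) : bounded_op S -> bounded_op T ->
  bounded_op (fun x => S x - T x).
Proof.
move=> Sb Tb; have := bounded_opD Sb (bounded_opZ (-1) Tb).
by congr bounded_op; apply/funext => x; rewrite scaleN1r.
Qed.

Lemma hproj_bounded (V : set H) : closed_subspace V -> bounded_op (hproj V).
Proof.
by move=> Vs; split; [exact: hproj_linear | exists 1 => x; rewrite mul1r sqn_hproj_le].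
Qed.

Lemma adj_eq (T : H -> K) (S : K -> H) : bounded_op T ->
  (forall x y, ip (T x) y = ip x (S y)) -> adj T = S.
Proof.
move=> Tb h; apply/funext => y; apply: ip_nondeg => z.
by rewrite adjP' // ipC h ipC.
Qed.

End OpAlgebra.

(** Iterating 1 - X kills everything except the kernel of X: the inner
    products of the iterates with v decrease, so the iterates form a Cauchy
    sequence, and X sends its limit to 0. *)
Section KernelLimit.
Variables (R : realType) (H : hilbertType R) (X : H -> H).
Hypotheses (Xb : bounded_op X) (Xsym : forall x y, ip (X x) y = ip x (X y)).
(* X^2 <= X, that is, the spectrum of X lies in [0, 1] *)
Hypothesis Xle : forall x, sqn (X x) <= ip (X x) x.

Let A x := x - X x.
Let Ab : bounded_op A. Proof. exact: (bounded_opB (bounded_op_id H) Xb). Qed.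
Let Asym x y : ip (A x) y = ip x (A y).
Proof. by rewrite /A ipBl ipBr Xsym. Qed.
Let Aksym k x y : ip (iter k A x) y = ip x (iter k A y).
Proof. by elim: k x y => //= k IH x y; rewrite Asym IH -iterSr. Qed.

Let s v k := ip (iter k A v) v.

Let sD v j k : ip (iter j A v) (iter k A v) = s v (j + k).
Proof. by rewrite -Aksym -iterD addnC. Qed.

Let s_dec v k : s v k.+1 <= s v k.
Proof.
have X0 u : 0 <= ip (X u) u by apply: le_trans (Xle u); exact: sqn_ge0.
pose h := k./2; pose u := iter h A v.
rewrite -(odd_double_half k) -/h; case: (odd k); rewrite ?add0n ?add1n.
  have -> : s v h.*2.+2 = ip (A u) (A u).
    by rewrite (sD v h.+1 h.+1) addnS addSn addnn.
  have -> : s v h.*2.+1 = ip (A u) u by rewrite (sD v h.+1 h) addSn addnn.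
  rewrite -subr_ge0 -ipBr [u - A u]subKr ipBl ipxx subr_ge0.
  by rewrite (ipC u).
have -> : s v h.*2.+1 = ip (A u) u by rewrite (sD v h.+1 h) addSn addnn.
have -> : s v h.*2 = ip u u by rewrite (sD v h h) addnn.
by rewrite /A ipBl; have := X0 u; lra.
Qed.

Let s_le v j k : (j <= k)%N -> s v k <= s v j.
Proof.
move/subnK <-; elim: (k - j)%N => [|i IH]; rewrite ?add0n // addSn.
by apply: le_trans IH; exact: s_dec.
Qed.

Let s_ge0 v k : 0 <= s v k.
Proof.
apply: le_trans (s_le v (leq_addl k k)).
by rewrite -sD ipxx sqn_ge0.
Qed.

Let s_cauchy v (e : R) : 0 < e -> exists n0 : nat, forall j k,
  (n0 <= j)%N -> (n0 <= k)%N -> `|s v j - s v k| < e.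
Proof.
move=> e0; pose E := range (s v).
have hE : has_inf E.
  by split; [exists (s v 0%N), 0%N | exists 0 => _ [k _ <-]; exact: s_ge0].
have [_ [n0 _ <-] n0P] := inf_adherent e0 hE; exists n0 => j k nj nk.
have lb i : inf E <= s v i by apply: inf_lbound; [case: hE | exists i].
by rewrite ltr_norml; have := s_le v nj; have := s_le v nk; have := lb j;
  have := lb k; lra.
Qed.

Lemma ip_small (d v : H) (e : R) : 0 < e ->
  sqn d < e ^+ 2 / (sqn v + 1) -> `|ip d v| < e.
Proof.
move=> e0; rewrite ltr_pdivlMr ?ltr_wpDl ?sqn_ge0 // => h.
rewrite -ltr_sqr ?nnegrE ?normr_ge0 ?(ltW e0) // real_normK ?num_real //.
apply: le_lt_trans (cauchy_schwarz _ _) _; apply: le_lt_trans h.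
by rewrite mulrDr mulr1 lerDl sqn_ge0.
Qed.

Lemma iter_kernel_proj v (e : R) : 0 < e -> exists n0 : nat, forall k,
  (n0 <= k)%N ->
  `|ip (iter k (fun x => x - X x) v) v - sqn (hproj [set x | X x = 0] v)| < e.
Proof.
have [|l lP] := @sqn_complete _ H (fun k => iter k A v).
  move=> r r0; have [|n0 n0P] := s_cauchy v (e := r / 4); first by rewrite divr_gt0.
  exists n0 => n m nn nm; rewrite sqnBE -!ipxx !sD.
  have := n0P (n + m)%N (n + n)%N; have := n0P (n + m)%N (m + m)%N.
  rewrite !(leq_trans nn (leq_addr _ _)) (leq_trans nm (leq_addr _ _)).
  move=> /(_ isT isT) h1 /(_ isT isT) h2; move: h1 h2.
  by rewrite !ltr_norml => /andP[? ?] /andP[? ?]; lra.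
have Ks := ker_closed_subspace Xb.
have Xl : X l = 0.
  apply: sqn_eq0; apply/eqP; rewrite eq_le sqn_ge0 andbT.
  apply/ler_addgt0Pr => r r0; rewrite add0r.
  have [M M0 MX] := op_bound Xb.
  have [|n1 n1P] := lP (r / (M * 4)); first by rewrite divr_gt0 ?mulr_gt0.
  have [|n2 n2P] := s_cauchy v (e := r / 4); first by rewrite divr_gt0.
  pose k := maxn n1 n2; have k1 : (n1 <= k)%N := leq_maxl _ _.
  have k2 : (n2 <= k)%N := leq_maxr _ _; pose u := iter k A v.
  have h1 : sqn (X (u - l)) <= r / 4.
    apply: le_trans (MX _) _; rewrite mulrC -ler_pdivlMr // -mulrA -invfM.
    by rewrite [4 * M]mulrC ltW // n1P.
  have h2 : sqn (X u) <= r / 4.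
    apply: le_trans (Xle u) _.
    have -> : X u = u - A u by rewrite /A subKr.
    have -> : ip (u - A u) u = s v (k + k) - s v (k.+1 + k) by rewrite -!sD ipBl.
    rewrite (le_trans (ler_norm _)) // ltW // n2P ?(leq_trans k2) ?leq_addr //.
    by rewrite addSn leqW ?leq_addr.
  have -> : X l = X u - X (u - l) by rewrite opB // subKr.
  by apply: le_trans (sqnD_le _ _) _; rewrite sqnN; lra.
have el : l = hproj [set x | X x = 0] v.
  apply: hproj_unique => // z Xz.
  have Az k : iter k A z = z by elim: k => //= k ->; rewrite /A Xz subr0.
  apply/eqP; rewrite -subr_eq0 -normr_le0; apply/ler_addgt0Pr => r r0.
  rewrite add0r.
  have [|n nP] := lP (r ^+ 2 / (sqn z + 1)).
    by rewrite divr_gt0 ?exprn_gt0 // ltr_wpDl ?sqn_ge0.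
  have := ip_small r0 (nP n (leqnn n)); rewrite ipBl Aksym Az distrC.
  by move/ltW.
move=> e0; have [|n nP] := lP (e ^+ 2 / (sqn v + 1)).
  by rewrite divr_gt0 ?exprn_gt0 // ltr_wpDl ?sqn_ge0.
exists n => k /nP /(ip_small e0); rewrite ipBl; congr (`|_ - _| < _).
by rewrite sqn_hproj // -el.
Qed.

End KernelLimit.

(** * Spaces of functions and square-summable functions on a group *)

Section PointwiseComplete.
Variables (R : realType) (X Q : Type) (q : Q -> (X -> R[i]) -> R).

Definition pointwise_cvg (u : nat -> X -> R[i]) (l : X -> R[i]) :=
  forall x, (complex.Re (u n x) @[n --> \oo] --> complex.Re (l x)) /\
            (complex.Im (u n x) @[n --> \oo] --> complex.Im (l x)).

Hypothesis q_cvg : forall c u l, pointwise_cvg u l ->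
  q c (u n) @[n --> \oo] --> q c l.
Hypothesis q_eval : forall x, exists2 K : R, 0 < K & forall f M,
  (forall c, q c f <= M) -> sqmod (f x) <= K * M.

Lemma real_cauchy_cvg (u : R^nat) :
  (forall e : R, 0 < e -> exists n0 : nat, forall n m,
     (n0 <= n)%N -> (n0 <= m)%N -> `|u n - u m| <= e) -> cvgn u.
Proof.
move=> h; apply/cauchy_cvgP/cauchy_ballP => e e0.
have [|n0 n0P] := h (e / 2); first by rewrite divr_gt0.
rewrite near_map2.
exists ([set n | n0 <= n]%N, [set n | n0 <= n]%N); first by split; exists n0.
move=> [n m] [/= nn nm]; rewrite /ball /= (le_lt_trans (n0P _ _ nn nm)) //.
by rewrite ltr_pdivrMr // ltr_pMr // ltr1n.
Qed.

(** A space of functions normed by the supremum of pointwise continuous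
    quantities is complete as soon as its evaluations are bounded. *)
Lemma pointwise_complete (u : nat -> X -> R[i]) :
  (forall e : R, 0 < e -> exists n0 : nat, forall n m,
     (n0 <= n)%N -> (n0 <= m)%N -> forall c, q c (fun x => u n x - u m x) <= e) ->
  exists l, forall e : R, 0 < e -> exists n0 : nat, forall n,
     (n0 <= n)%N -> forall c, q c (fun x => u n x - l x) <= e.
Proof.
move=> uc.
have sq x (e : R) : 0 < e -> exists n0 : nat, forall n m,
    (n0 <= n)%N -> (n0 <= m)%N -> sqmod (u n x - u m x) <= e ^+ 2.
  move=> e0; have [K K0 KP] := q_eval x.
  have [|n0 n0P] := uc (e ^+ 2 / K); first by rewrite divr_gt0 ?exprn_gt0.
  exists n0 => n m nn nm; apply: le_trans (KP _ _ (n0P n m nn nm)) _.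
  by rewrite mulrC divfK // gt_eqF.
have le_of_sq (a b e : R) : 0 < e -> 0 <= b -> a ^+ 2 + b <= e ^+ 2 -> `|a| <= e.
  move=> e0 b0 h; rewrite -ler_sqr ?nnegrE ?normr_ge0 ?(ltW e0) //.
  by rewrite real_normK ?num_real //; lra.
have re x : cvgn (fun n => complex.Re (u n x)).
  apply: real_cauchy_cvg => e e0; have [n0 n0P] := sq x e e0; exists n0.
  move=> n m nn nm; have := n0P n m nn nm; rewrite /sqmod raddfB raddfB /=.
  by apply: le_of_sq => //; exact: sqr_ge0.
have im x : cvgn (fun n => complex.Im (u n x)).
  apply: real_cauchy_cvg => e e0; have [n0 n0P] := sq x e e0; exists n0.
  move=> n m nn nm; have := n0P n m nn nm; rewrite /sqmod raddfB raddfB /= addrC.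
  by apply: le_of_sq => //; exact: sqr_ge0.
pose l x := limn (fun n => complex.Re (u n x)) +i*
            limn (fun n => complex.Im (u n x)).
exists l => e e0.
have [n0 n0P] := uc e e0; exists n0 => n nn c.
have : q c (fun x => u n x - u m x) @[m --> \oo] --> q c (fun x => u n x - l x).
  apply: q_cvg => x; rewrite raddfB /= [complex.Im (_ - _)]raddfB /=; split.
    under eq_fun do rewrite raddfB /=.
    by apply: cvgB; [exact: cvg_cst | exact: re].
  under eq_fun do rewrite raddfB /=.
  by apply: cvgB; [exact: cvg_cst | exact: im].
move=> qc; rewrite -(cvg_lim _ qc) //; apply: limr_le.
  by apply/cvg_ex; eexists; exact: qc.
by exists n0 => // m /= nm; exact: n0P.
Qed.

End PointwiseComplete.

Section L2Hilbert.
Variables (R : realType) (G : groupType).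
Local Notation l2 := (l2 R G).
Implicit Types (f g : l2) (h : G -> R[i]).

Lemma sqnorm_leP h (M : R) : (sqnorm h <= M%:E)%E <->
  forall s : seq G, uniq s -> \sum_(x <- s) sqmod (h x) <= M.
Proof.
split=> [hM s us|hs].
  rewrite -lee_fin; apply: le_trans hM; apply: ereal_sup_ubound.
  exists [set` s]; first by split => //; exact: finite_seq.
  by rewrite -fsbig_seq // sumEFin.
apply: ge_ereal_sup => _ [F [finF _] <-].
by rewrite fsbig_finite //= sumEFin lee_fin hs // finmap.fset_uniq.
Qed.

Lemma l2_fin f : exists2 M : R, 0 <= M & sqnorm (val f) = M%:E.
Proof.
have /asboolP := valP f; have := sqnorm_ge0 (val f).
case: (sqnorm (val f)) => // M M0 _; exists M => //.
Qed.

Lemma l2_of_bound h (M : R) : (sqnorm h <= M%:E)%E -> h \in @sq_summable R G.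
Proof. by move=> hM; apply/asboolP; apply: le_lt_trans hM (ltry _). Qed.

Definition l2sqn f : R := fine (sqnorm (val f)).

Lemma l2sqnE f : sqnorm (val f) = (l2sqn f)%:E.
Proof. by rewrite /l2sqn; have [M _ ->] := l2_fin f. Qed.

Lemma l2sqn_leP f (M : R) : l2sqn f <= M <->
  forall s : seq G, uniq s -> \sum_(x <- s) sqmod (val f x) <= M.
Proof. by rewrite -sqnorm_leP l2sqnE lee_fin. Qed.

Lemma l2_eval f x : sqmod (val f x) <= l2sqn f.
Proof.
have /l2sqn_leP/(_ [:: x] isT) := lexx (l2sqn f).
by rewrite big_seq1.
Qed.

Fact l2sqn_ge0 f : 0 <= l2sqn f.
Proof. by rewrite fine_ge0 ?sqnorm_ge0. Qed.

Lemma sqmod_eq0 (z : R[i]) : sqmod z <= 0 -> z = 0.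
Proof.
case: z => a b; rewrite /sqmod /= => h.
have a2 := sqr_ge0 a; have b2 := sqr_ge0 b.
have -> : a = 0 by apply/eqP; rewrite -sqrf_eq0 eq_le a2 andbT; lra.
have -> // : b = 0 by apply/eqP; rewrite -sqrf_eq0 eq_le b2 andbT; lra.
Qed.

Fact l2sqn_eq0 f : l2sqn f = 0 -> f = 0.
Proof.
move=> f0; apply: val_inj; apply/funext => x; apply: sqmod_eq0.
by rewrite -f0 l2_eval.
Qed.

Fact l2sqnZ (c : R[i]) f : l2sqn (c *: f) = sqmod c * l2sqn f.
Proof.
have le (d : R[i]) k : l2sqn (d *: k) <= sqmod d * l2sqn k.
  by rewrite -lee_fin EFinM -!l2sqnE; exact: sqnormZ.
have [->|c0] := eqVneq c 0.
  apply/eqP; rewrite eq_le le /= /sqmod /= expr0n addr0 mul0r.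
  exact: l2sqn_ge0.
apply/eqP; rewrite eq_le le /=.
have := le c^-1 (c *: f); rewrite scalerA mulVf // scale1r => h.
have : sqmod c * l2sqn f <= sqmod c * (sqmod c^-1 * l2sqn (c *: f)).
  by rewrite ler_wpM2l // -lee_fin sqmod_ge0.
rewrite mulrA -sqmodM mulfV //.
by rewrite [sqmod 1]/sqmod /= expr0n expr1n addr0 mul1r.
Qed.

Fact l2_parallelogram f g :
  l2sqn (f + g) + l2sqn (f - g) = (l2sqn f + l2sqn g) *+ 2.
Proof.
apply: EFin_inj; rewrite EFinD -!l2sqnE mulr2n !EFinD -!l2sqnE /sqnorm.
rewrite -!esumD; try by move=> *; rewrite ?adde_ge0 ?sqmod_ge0.
apply: eq_esum => x _; rewrite -!EFinD; congr (_%:E).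
have -> : val (f + g) x = val f x + val g x by [].
have -> : val (f - g) x = val f x - val g x by [].
by rewrite /sqmod; case: (val f x) (val g x) => [a b] [c d] /=; ring.
Qed.

Fact l2_complete (u : nat -> l2) :
  (forall e : R, 0 < e -> exists n0 : nat, forall n m,
     (n0 <= n)%N -> (n0 <= m)%N -> l2sqn (u n - u m) < e) ->
  exists l, forall e : R, 0 < e -> exists n0 : nat, forall n,
     (n0 <= n)%N -> l2sqn (u n - l) < e.
Proof.
move=> uc; pose Q := {s : seq G | uniq s}.
have [|||l lP] := @pointwise_complete R G Q
  (fun c h => \sum_(x <- sval c) sqmod (h x)) _ _ (fun n => val (u n)).
- move=> [s us] v l vl /=; elim: s {us} => [|x s IH].
    by under eq_fun do rewrite big_nil; rewrite big_nil; exact: cvg_cst.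
  under eq_fun do rewrite big_cons; rewrite big_cons; apply: cvgD => //.
  by have [v1 v2] := vl x; apply: cvgD; apply: cvgM.
- move=> x; exists 1 => // h M /(_ (exist _ [:: x] isT)).
  by rewrite /= big_seq1 mul1r.
- move=> e e0; have [n0 n0P] := uc e e0; exists n0 => n m nn nm [s us].
  by apply: (iffLR (l2sqn_leP (u n - u m) e)) => //; exact/ltW/n0P.
have [n1 n1P] := lP 1 ltr01.
have dl : (fun x => val (u n1) x - l x) \in @sq_summable R G.
  apply: (@l2_of_bound _ 1); apply/sqnorm_leP => s us.
  exact: (n1P _ (leqnn _) (exist _ s us)).
pose d : l2 := exist (fun h => h \in @sq_summable R G) _ dl.
have vl : val (u n1 - d) = l by apply/funext => x /=; rewrite subKr.
exists (u n1 - d) => e e0.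
have [|n0 n0P] := lP (e / 2); first by rewrite divr_gt0.
exists n0 => n nn; apply: (@le_lt_trans _ _ (e / 2)); last first.
  by rewrite ltr_pdivrMr // ltr_pMr // ltr1n.
apply/l2sqn_leP => s us; have := n0P n nn (exist _ s us).
by rewrite -vl; exact.
Qed.

HB.instance Definition _ := isHilbert.Build R l2 l2sqn_ge0 l2sqn_eq0 l2sqnZ
  l2_parallelogram l2_complete.

Lemma sqn_l2 f : sqn f = l2sqn f. Proof. by []. Qed.

Lemma sqn_rtr (x : G) f : sqn (rtr x f) = sqn f.
Proof.
by rewrite !sqn_l2; congr fine; rewrite /= sqnorm_reindex //; exact: rtr_bij.
Qed.

Lemma sqn_ltr (x : G) f : sqn (ltr x f) = sqn f.
Proof.
by rewrite !sqn_l2; congr fine; rewrite /= sqnorm_reindex //; exact: ltr_bij.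
Qed.

Definition deltag (x : G) : l2 := rtr x^-1%g (delta1 R G).

Lemma deltagE x y : val (deltag x) y = (y == x)%:R.
Proof. by rewrite /= -(can_eq (mulgK x)) mulgVK mul1g. Qed.

(** Changing f at one point only is how inner products with the functions
    deltag are read off from squared norms. *)
Lemma sqn_addpoint f (c : R[i]) x :
  sqn (f + c *: deltag x) = sqn f - sqmod (val f x) + sqmod (val f x + c).
Proof.
pose rest (k : l2) := \esum_(y in ~` [set x]) (sqmod (val k y))%:E.
have split1 (k : l2) : sqnorm (val k) = ((sqmod (val k x))%:E + rest k)%E.
  rewrite /sqnorm (esumID [set x]); last by move=> *; exact: sqmod_ge0.
  by rewrite !setTI esum_set1 ?sqmod_ge0.
have er : rest (f + c *: deltag x) = rest f.
  apply: eq_esum => y /eqP/negPf yx; congr (sqmod _)%:E.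
  have -> : val (f + c *: deltag x) y = val f y + c * val (deltag x) y by [].
  by rewrite deltagE yx mulr0 addr0.
have := split1 (f + c *: deltag x); have := split1 f; rewrite er.
have -> : val (f + c *: deltag x) x = val f x + c.
  have -> : val (f + c *: deltag x) x = val f x + c * val (deltag x) x by [].
  by rewrite deltagE eqxx mulr1.
rewrite !l2sqnE !sqn_l2; case: (rest f) => // r.
by rewrite -!EFinD => -[->] [->]; ring.
Qed.

Lemma ip_deltag f x : ip f (deltag x) = complex.Re (val f x).
Proof.
have := sqn_addpoint f 1 x; have := sqn_addpoint f (-1) x.
rewrite scale1r scaleN1r /ip => -> ->; case: (val f x) => a b.
by rewrite /sqmod /=; lra.
Qed.

Lemma ip_ideltag f x : ip f ('i *: deltag x) = complex.Im (val f x).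
Proof.
have := sqn_addpoint f 'i x; have := sqn_addpoint f (- 'i) x.
rewrite scaleNr /ip => -> ->; case: (val f x) => a b.
by rewrite /sqmod /=; lra.
Qed.

Lemma sum_subset (F : G -> R) (s t : seq G) : (forall x, 0 <= F x) ->
  uniq s -> uniq t -> {subset s <= t} -> \sum_(x <- s) F x <= \sum_(x <- t) F x.
Proof.
move=> F0 us ut st.
have -> : \sum_(x <- s) F x = \sum_(x <- t | x \in s) F x.
  rewrite -[RHS]big_filter; apply: perm_big; apply: uniq_perm; rewrite ?filter_uniq //.
  by move=> x; rewrite mem_filter; case: (boolP (x \in s)) => // /st ->.
by rewrite [leRHS](bigID (mem s)) /= lerDl sumr_ge0.
Qed.

Lemma sqn_approx (fs : seq l2) (e : R) : 0 < e ->
  exists2 s : seq G, uniq s &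
    forall f, f \in fs -> sqn f - e < \sum_(x <- s) sqmod (val f x) <= sqn f.
Proof.
move=> e0.
have sq0 (z : R[i]) : 0 <= sqmod z by rewrite -lee_fin sqmod_ge0.
have ub f s : uniq s -> \sum_(x <- s) sqmod (val f x) <= sqn f.
  by move=> us; apply: (iffLR (l2sqn_leP f (sqn f))).
elim: fs => [|f fs [t ut tP]]; first by exists [::].
have [s us sP] : exists2 s, uniq s & sqn f - e < \sum_(x <- s) sqmod (val f x).
  apply: contrapT => h; suff : sqn f <= sqn f - e by lra.
  apply/l2sqn_leP => s us; rewrite leNgt; apply/negP => hs.
  by apply: h; exists s.
exists (undup (s ++ t)); first exact: undup_uniq.
move=> g; rewrite inE => /predU1P[->|gfs].
  rewrite ub ?undup_uniq // andbT (lt_le_trans sP) // sum_subset ?undup_uniq //.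
  by move=> x xs; rewrite mem_undup mem_cat xs.
have /andP[tg _] := tP g gfs.
rewrite ub ?undup_uniq // andbT (lt_le_trans tg) // sum_subset ?undup_uniq //.
by move=> x xs; rewrite mem_undup mem_cat xs orbT.
Qed.

End L2Hilbert.

(** * Finite direct sums and equivariant operators *)

Definition hsum (I : finType) (H : Type) : Type := I -> H.
HB.instance Definition _ (R : realType) (I : finType) (H : hilbertType R) :=
  GRing.Lmodule.copy (hsum I H) (I -> H).

Section DirectSum.
Variables (R : realType) (I : finType) (H : hilbertType R).
Local Notation HI := (hsum I H).
Implicit Types x y : HI.

Definition hsum_sqn x : R := \sum_i sqn (x i).

Fact hsum_sqn_ge0 x : 0 <= hsum_sqn x.
Proof. by apply: sumr_ge0 => i _; exact: sqn_ge0. Qed.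

Fact hsum_sqn_eq0 x : hsum_sqn x = 0 -> x = 0.
Proof.
move=> x0; apply/funext => i; apply: sqn_eq0; apply/eqP; move/eqP: x0.
rewrite psumr_eq0 => [/allP/(_ i)|j _]; last exact: sqn_ge0.
by rewrite mem_index_enum => /(_ isT).
Qed.

Fact hsum_sqnZ (c : R[i]) x : hsum_sqn (c *: x) = sqmod c * hsum_sqn x.
Proof. by rewrite /hsum_sqn mulr_sumr; apply: eq_bigr => i _; rewrite -sqnZ. Qed.

Fact hsum_parallelogram x y :
  hsum_sqn (x + y) + hsum_sqn (x - y) = (hsum_sqn x + hsum_sqn y) *+ 2.
Proof.
rewrite /hsum_sqn -!big_split /= -sumrMnl; apply: eq_bigr => i _.
exact: sqn_parallelogram.
Qed.

Fact hsum_complete (u : nat -> HI) :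
  (forall e : R, 0 < e -> exists n0 : nat, forall n m,
     (n0 <= n)%N -> (n0 <= m)%N -> hsum_sqn (u n - u m) < e) ->
  exists l, forall e : R, 0 < e -> exists n0 : nat, forall n,
     (n0 <= n)%N -> hsum_sqn (u n - l) < e.
Proof.
move=> uc.
have le1 x i : sqn (x i) <= hsum_sqn x.
  by rewrite /hsum_sqn (bigD1 i) //= lerDl sumr_ge0 // => j _; exact: sqn_ge0.
have /choice[l lP] (i : I) : exists l, forall e : R, 0 < e ->
    exists n0 : nat, forall n, (n0 <= n)%N -> sqn (u n i - l) < e.
  apply: (@sqn_complete _ H (fun n => u n i)) => e e0.
  have [n0 n0P] := uc e e0; exists n0 => n m nn nm.
  exact: le_lt_trans (le1 (u n - u m) i) (n0P n m nn nm).
exists l => e e0; pose d := e / #|I|.+1%:R.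
have d0 : 0 < d by rewrite divr_gt0 // ltr0n.
have /choice[N NP] (i : I) : exists n0 : nat, forall n, (n0 <= n)%N ->
    sqn (u n i - l i) < d by exact: lP.
exists (\max_i N i)%N => n nn; apply: (@le_lt_trans _ _ (\sum_(i : I) d)).
  apply: ler_sum => i _; apply/ltW/NP/(leq_trans _ nn).
  exact: leq_bigmax.
rewrite sumr_const -mulr_natr /d mulrAC ltr_pdivrMr ?ltr0n //.
by rewrite ltr_pM2l // ltr_nat.
Qed.

HB.instance Definition _ := isHilbert.Build R HI hsum_sqn_ge0 hsum_sqn_eq0
  hsum_sqnZ hsum_parallelogram hsum_complete.

Lemma sqn_hsum x : sqn x = \sum_i sqn (x i). Proof. by []. Qed.

Lemma ip_hsum x y : ip x y = \sum_i ip (x i) (y i).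
Proof. by rewrite /ip !sqn_hsum -sumrB mulr_suml. Qed.

Definition hinj (i : I) (f : H) : HI := fun j => if j == i then f else 0.

Lemma ip_hinj x i f : ip x (hinj i f) = ip (x i) f.
Proof.
rewrite ip_hsum (bigD1 i) //= /hinj eqxx big1 ?addr0 // => j /negPf ->.
exact: ip0r.
Qed.

Lemma sqn_hinj i f : sqn (hinj i f) = sqn f.
Proof. by rewrite -!ipxx ip_hinj /hinj eqxx. Qed.

Lemma hinj_sum x : x = \sum_i hinj i (x i).
Proof.
apply/funext => j; rewrite fct_sumE (bigD1 j) //= /hinj eqxx big1 ?addr0 //.
by move=> i; rewrite eq_sym => /negPf ->.
Qed.

Lemma hinj_linear i : linear (hinj i).
Proof.
move=> c f g; apply/funext => j; rewrite !fctE /hinj.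
by case: eqP; rewrite // scaler0 addr0.
Qed.

Lemma hinjZ i (c : R[i]) f : hinj i (c *: f) = c *: hinj i f.
Proof. by apply/funext => j; rewrite fctE /hinj; case: eqP; rewrite ?scaler0. Qed.

End DirectSum.

(** * Equivariant operators and their traces *)

Section Equivariant.
Variables (R : realType) (G : groupType).
Local Notation HG I := (hsum I (l2 R G)).

(** The operators commuting with these translations are the matrices over the
    group von Neumann algebra. *)
Definition rt (I : finType) (g : G) (x : HG I) : HG I := fun i => rtr g (x i).

Section RightTranslation.
Variable I : finType.
Implicit Types x y : HG I.

Lemma rtM g h x : rt g (rt h x) = rt (g * h)%g x.
Proof.
by apply/funext => i; apply: val_inj; apply/funext => y /=; rewrite mulgA.
Qed.

Lemma rt1 x : rt 1%g x = x.
Proof. by apply/funext => i; apply: val_inj; apply/funext => y /=; rewrite mulg1. Qed.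

Lemma rtP g (c : R[i]) x y : rt g (c *: x + y) = c *: rt g x + rt g y.
Proof. by apply/funext => i; apply: val_inj. Qed.

Lemma sqn_rt g x : sqn (rt g x) = sqn x.
Proof. by rewrite !sqn_hsum; apply: eq_bigr => i _; rewrite sqn_rtr. Qed.

Lemma rtD g x y : rt g (x + y) = rt g x + rt g y.
Proof. by have := rtP g 1 x y; rewrite !scale1r. Qed.

Lemma rtN g x : rt g (- x) = - rt g x.
Proof. by apply/funext => i; apply: val_inj. Qed.

Lemma rtZ g c x : rt g (c *: x) = c *: rt g x.
Proof. by apply/funext => i; apply: val_inj. Qed.

Lemma ip_rt g x y : ip (rt g x) (rt g y) = ip x y.
Proof. by rewrite /ip -rtD -rtN -rtD !sqn_rt. Qed.

Lemma ip_rtl g x y : ip (rt g x) y = ip x (rt g^-1%g y).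
Proof. by rewrite -(ip_rt g x) rtM mulgV rt1. Qed.

Definition dlt (i : I) : HG I := hinj i (delta1 R G).

Lemma rt_dlt g i : rt g^-1%g (dlt i) = hinj i (deltag R g).
Proof.
by apply/funext => j; rewrite /rt /dlt /hinj; case: eqP => // _; apply: val_inj.
Qed.

Lemma sqn_dlt i : sqn (dlt i) = 1.
Proof. by rewrite sqn_hinj sqn_l2 /l2sqn /= sqnorm_delta. Qed.

End RightTranslation.

Definition eqop (I J : finType) (T : HG I -> HG J) :=
  bounded_op T /\ forall g x, T (rt g x) = rt g (T x).

Section EqopTheory.
Variables (I J K : finType).

Lemma eqop_id : eqop (fun x : HG I => x).
Proof. by split=> //; exact: bounded_op_id. Qed.

Lemma eqop_comp (S : HG J -> HG K) (T : HG I -> HG J) :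
  eqop S -> eqop T -> eqop (fun x => S (T x)).
Proof.
move=> [Sb SR] [Tb TR]; split; first exact: bounded_op_comp.
by move=> g x; rewrite TR SR.
Qed.

Lemma eqopD (S T : HG I -> HG J) : eqop S -> eqop T -> eqop (fun x => S x + T x).
Proof.
move=> [Sb SR] [Tb TR]; split; first exact: bounded_opD.
by move=> g x; rewrite TR SR rtD.
Qed.

Lemma eqopB (S T : HG I -> HG J) : eqop S -> eqop T -> eqop (fun x => S x - T x).
Proof.
move=> [Sb SR] [Tb TR]; split; first exact: bounded_opB.
by move=> g x; rewrite TR SR rtD rtN.
Qed.

Lemma eqopZ c (T : HG I -> HG J) : eqop T -> eqop (fun x => c *: T x).
Proof.
move=> [Tb TR]; split; first exact: bounded_opZ.
by move=> g x; rewrite TR rtZ.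
Qed.

Lemma eqop_adj (T : HG I -> HG J) : eqop T -> eqop (adj T).
Proof.
move=> [Tb TR]; split; first exact: adj_bounded.
move=> g y; apply: ip_nondeg => x.
by rewrite adjP' // !ip_rtl -TR adjP'.
Qed.

Definition rt_invariant (V : set (HG I)) :=
  closed_subspace V /\ forall g x, V x -> V (rt g x).

Lemma eqop_hproj V : rt_invariant V -> eqop (hproj V).
Proof.
move=> [Vs VR]; split; first exact: hproj_bounded.
move=> g x; apply/esym/(hproj_unique Vs) => [|v Vv].
  by apply: VR; exact: hproj_in.
by rewrite ip_rtl ip_hproj ?ip_rtl //; exact: VR.
Qed.

Lemma ker_invariant (T : HG I -> HG J) : eqop T -> rt_invariant [set x | T x = 0].
Proof.
move=> [Tb TR]; split; first exact: ker_closed_subspace.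
move=> g x /= Tx; rewrite TR Tx.
by apply/funext => i; apply: val_inj.
Qed.

Definition trace (T : HG I -> HG I) : R := \sum_i ip (T (dlt i)) (dlt i).

(** The von Neumann dimension of a closed translation invariant subspace. *)
Definition gdim (V : set (HG I)) : R := \sum_i sqn (hproj V (dlt i)).

(** The projection onto V is equivariant: if it kills the generators dlt, then
    it kills all their translates, which are total. *)
Lemma gdim_eq0 V : rt_invariant V -> gdim V <= 0 -> forall x, V x -> x = 0.
Proof.
move=> Vi d0 x Vx; have Vs := Vi.1.
have pd i : hproj V (dlt i) = 0.
  apply: sqn_eq0; apply/eqP; rewrite eq_le sqn_ge0 andbT.
  by apply: le_trans d0; rewrite /gdim (bigD1 i) //= lerDl sumr_ge0 // => j _;
    exact: sqn_ge0.
have z i g : ip x (hinj i (deltag R g)) = 0.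
  rewrite -rt_dlt -(hproj_id Vs Vx) ip_hprojl // (eqop_hproj Vi).2 pd.
  by rewrite -(ip_rt g) rtM mulgV rt1 ip0r.
have zi i g : ip x ('i *: hinj i (deltag R g)) = 0.
  rewrite -rt_dlt -(hproj_id Vs Vx) ip_hprojl // (opZ (hproj_bounded Vs)).
  rewrite (eqop_hproj Vi).2 pd.
  have -> : rt g^-1%g (0 : HG I) = 0 by apply/funext => j; apply: val_inj.
  by rewrite scaler0 ip0r.
apply/funext => i; apply: val_inj; apply/funext => g.
have := z i g; have := zi i g; rewrite -hinjZ !ip_hinj ip_deltag ip_ideltag.
by case: (val (x i) g) => a b /= -> ->.
Qed.

Lemma gdim_le V W : closed_subspace V -> closed_subspace W -> V `<=` W ->
  gdim V <= gdim W.
Proof.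
move=> Vs Ws VW; apply: ler_sum => i _.
have -> : hproj V (dlt i) = hproj V (hproj W (dlt i)).
  apply: (hproj_unique Vs) => [|v Vv]; first exact: (hproj_in Vs).
  by rewrite (ip_hproj Vs _ Vv) (ip_hproj Ws _ (VW _ Vv)).
exact: (sqn_hproj_le Vs).
Qed.

(** The matrix entries of T and of its adjoint are conjugate to each other, up
    to the inversion of the group. *)
Lemma hilbert_schmidt_adj (T : HG I -> HG J) : eqop T ->
  \sum_i sqn (T (dlt i)) = \sum_j sqn (adj T (dlt j)).
Proof.
move=> Te; have [Tb TR] := Te; have [Ab AR] := eqop_adj Te.
rewrite /= (eq_bigr (fun i => \sum_j sqn (T (dlt i) j))) // exchange_big /=.
apply: eq_bigr => j _; rewrite sqn_hsum; apply: eq_bigr => i _.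
rewrite !sqn_l2; congr fine.
rewrite -(@sqnorm_reindex _ _ (val (adj T (dlt j) i)) (fun x => x^-1)%g); last first.
  by exists (fun x => x^-1)%g; exact: invgK.
apply: eq_esum => x _; congr (_%:E).
have re : complex.Re (val (T (dlt i) j) x) =
    complex.Re (val (adj T (dlt j) i) x^-1%g).
  rewrite -!ip_deltag -!ip_hinj -!rt_dlt.
  by rewrite -ip_rtl -TR adjP // ipC invgK.
have im : complex.Im (val (T (dlt i) j) x) =
    - complex.Im (val (adj T (dlt j) i) x^-1%g).
  rewrite -!ip_ideltag.
  rewrite -!ip_hinj !hinjZ -!rt_dlt invgK -[LHS]opprK -ip_il -(opZ Tb).
  by rewrite -ip_rtl -TR adjP // rtZ ipC.
by rewrite /sqmod re im sqrrN.
Qed.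

Lemma adjK (T : HG I -> HG J) : eqop T -> adj (adj T) = T.
Proof.
by move=> Te; apply: adj_eq; [exact: (eqop_adj Te).1 | move=> x y; apply/adjP'/Te.1].
Qed.

Lemma hilbert_schmidt_ip (S T : HG I -> HG J) : eqop S -> eqop T ->
  \sum_i ip (S (dlt i)) (T (dlt i)) = \sum_j ip (adj S (dlt j)) (adj T (dlt j)).
Proof.
move=> Se Te; rewrite /ip -!mulr_suml !sumrB; congr (_ * _).
have := hilbert_schmidt_adj (eqopD Se Te).
have := hilbert_schmidt_adj (eqopB Se Te).
have -> : adj (fun x => S x + T x) = (fun y => adj S y + adj T y).
  apply: adj_eq; first exact: (eqopD Se Te).1.
  by move=> x y; rewrite ipDl ipDr (adjP Se.1) (adjP Te.1).
have -> : adj (fun x => S x - T x) = (fun y => adj S y - adj T y).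
  apply: adj_eq; first exact: (eqopB Se Te).1.
  by move=> x y; rewrite ipBl ipBr (adjP Se.1) (adjP Te.1).
by move=> -> ->.
Qed.

End EqopTheory.

(** The trace property, by polarization of the previous identities. *)
Lemma trace_comp (I J : finType) (S : HG J -> HG I) (T : HG I -> HG J) :
  eqop S -> eqop T -> trace (fun x => S (T x)) = trace (fun x => T (S x)).
Proof.
move=> Se Te; rewrite /trace.
rewrite (eq_bigr (fun i => ip (T (dlt i)) (adj S (dlt i)))); last first.
  by move=> i _; rewrite adjP //; exact: Se.1.
rewrite hilbert_schmidt_ip //; last exact: eqop_adj.
by rewrite adjK //; apply: eq_bigr => j _; rewrite [LHS]ipC -(adjP Te.1).
Qed.

Lemma trace_id I : trace (fun x : HG I => x) = #|I|%:R.
Proof.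
rewrite /trace (eq_bigr (fun=> 1)) ?sumr_const // => i _.
by rewrite ipxx sqn_dlt.
Qed.

Lemma cvg_sumr (I : Type) (r : seq I) (F : I -> R^nat) (L : I -> R) :
  (forall i, F i k @[k --> \oo] --> L i) ->
  \sum_(i <- r) F i k @[k --> \oo] --> \sum_(i <- r) L i.
Proof.
move=> FL; elim: r => [|i r IH].
  by under eq_fun do rewrite big_nil; rewrite big_nil; exact: cvg_cst.
by under eq_fun do rewrite big_cons; rewrite big_cons; exact: cvgD.
Qed.

(** The kernel of T and that of its adjoint have complementary dimensions up to
    the same rank: after rescaling, the powers of 1 - T^* T and of 1 - T T^*
    converge to the projections onto the two kernels, while the trace property
    makes the difference of the traces independent of the exponent. *)
Lemma index_formula (I J : finType) (T : HG I -> HG J) : eqop T ->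
  #|I|%:R - gdim [set x | T x = 0] = #|J|%:R - gdim [set y | adj T y = 0].
Proof.
move=> Te; have Tb := Te.1; have Ae := eqop_adj Te; have Ab := Ae.1.
have [M M0 MT] := op_bound Tb; have [M' M'0 MA] := op_bound Ab.
(* this scaling puts c T^* T and c T T^* between 0 and 1 *)
pose c := (M + M')^-1; have c0 : 0 < c by rewrite invr_gt0 addr_gt0.
have cM : c * M <= 1 by rewrite mulrC ler_pdivrMr ?addr_gt0 // mul1r lerDl ltW.
have cM' : c * M' <= 1 by rewrite mulrC ler_pdivrMr ?addr_gt0 // mul1r lerDr ltW.
pose X x := c%:C *: adj T (T x); pose X' y := c%:C *: T (adj T y).
have Xe : eqop X by apply: eqopZ; exact: eqop_comp.
have Xe' : eqop X' by apply: eqopZ; exact: eqop_comp.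
pose A x := x - X x; pose A' y := y - X' y.
have Ake k : eqop (iter k A).
  elim: k => [|k IH]; first exact: eqop_id.
  by apply: (eqop_comp _ IH); exact: (eqopB (@eqop_id I) Xe).
have Ake' k : eqop (iter k A').
  elim: k => [|k IH]; first exact: eqop_id.
  by apply: (eqop_comp _ IH); exact: (eqopB (@eqop_id J) Xe').
have TA k x : T (iter k A x) = iter k A' (T x).
  by elim: k => //= k <-; rewrite /A /A' (opB Tb) /X (opZ Tb).
have XA k y : X' (iter k A' y) = iter k A' (X' y).
  by elim: k => //= k IH; rewrite -IH /A' (opB Xe'.1).
have tr k : trace (iter k A) - trace (iter k A') = #|I|%:R - #|J|%:R.
  elim: k => [|k IH]; first by rewrite !trace_id.
  have e1 (K : finType) (B Y : HG K -> HG K) :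
      trace (fun x => B x - Y (B x)) = trace B - trace (fun x => Y (B x)).
    by rewrite /trace -sumrB; apply: eq_bigr => i _; rewrite ipBl.
  have -> : trace (iter k.+1 A) = trace (iter k A) - trace (fun x => X (iter k A x)).
    exact: e1.
  have -> : trace (iter k.+1 A') = trace (iter k A') - trace (fun x => X' (iter k A' x)).
    exact: e1.
  suff -> : trace (fun x => X (iter k A x)) = trace (fun x => X' (iter k A' x)).
    by rewrite -IH opprB addrA subrK.
  transitivity (trace (fun y => T (iter k A (c%:C *: adj T y)))).
    exact: (trace_comp (eqopZ c%:C Ae) (eqop_comp Te (Ake k))).
  by congr (trace _); apply/funext => y; rewrite XA TA /X' (opZ Tb).
have lim (K L : finType) (S : HG K -> HG L) (N : R) : eqop S ->
    (forall x, sqn (adj S x) <= N * sqn x) -> c * N <= 1 ->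
    trace (iter k (fun x => x - c%:C *: adj S (S x))) @[k --> \oo] -->
    gdim [set x | S x = 0].
  move=> Se NS cN.
  have -> : [set x | S x = 0] = [set x | c%:C *: adj S (S x) = 0].
    apply/seteqP; split=> x /= Sx.
      by rewrite Sx (op0 (eqop_adj Se).1) scaler0.
    apply: sqn_eq0; rewrite -ipxx (adjP Se.1).
    move/eqP: Sx; rewrite scaler_eq0 => /orP[/eqP[c00]|/eqP->].
      by move: c0; rewrite c00 ltxx.
    by rewrite ip0r.
  apply: cvg_sumr => i; apply/cvgrPdist_lt => e e0.
  have [|||n nP] := @iter_kernel_proj _ _ (fun x => c%:C *: adj S (S x)) _ _ _ (dlt i) e e0.
  - by apply: bounded_opZ; apply: bounded_op_comp; [exact: (eqop_adj Se).1|exact: Se.1].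
  - by move=> x y; rewrite ipZl ipZr (adjP' Se.1) (adjP Se.1).
  - move=> x; rewrite sqnZ sqmodR ipZl (adjP' Se.1) ipxx.
    rewrite expr2 -mulrA; apply: ler_wpM2l; first exact: ltW.
    apply: (@le_trans _ _ (c * (N * sqn (S x)))); first by rewrite ler_wpM2l ?(ltW c0).
    by rewrite mulrA -[leRHS]mul1r ler_wpM2r ?sqn_ge0.
  by exists n => // k /= /nP; rewrite distrC.
have l1 := lim _ _ _ _ Te MA cM'.
have l2 : trace (iter k A') @[k --> \oo] --> gdim [set y | adj T y = 0].
  have := lim _ _ _ M Ae; rewrite adjK //; exact.
have l3 : trace (iter k A) - trace (iter k A') @[k --> \oo] -->
    gdim [set x | T x = 0] - gdim [set y | adj T y = 0] by exact: cvgB.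
have l4 : ((#|I|%:R - #|J|%:R : R) @[k --> \oo] -->
    gdim [set x | T x = 0] - gdim [set y | adj T y = 0])%classic.
  by move: l3; under eq_fun do rewrite tr.
have : #|I|%:R - #|J|%:R = gdim [set x | T x = 0] - gdim [set y | adj T y = 0].
  by rewrite -(cvg_lim (@Rhausdorff R) l4) lim_cst.
lra.
Qed.

End Equivariant.

(** * Matrices over the group von Neumann algebra *)

Section Matrices.
Variables (R : realType) (G : groupType).
Local Notation N := (vN R G).
Local Notation l2 := (l2 R G).
Local Notation HG I := (hsum I l2).

Lemma vN_bounded (a : N) : bounded_op (val a).
Proof.
have /asboolP[alin [M aM] _] := valP a; split=> //; exists M => f.
by rewrite -lee_fin EFinM -!l2sqnE; exact: aM.
Qed.

Lemma vN_rtr (a : N) g f : val a (rtr g f) = rtr g (val a f).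
Proof. by have /asboolP[_ _ aR] := valP a; exact: aR. Qed.

Lemma vN_addE (a b : N) f : val (a + b) f = val a f + val b f. Proof. by []. Qed.
Lemma vN_mulE (a b : N) f : val (a * b) f = val a (val b f). Proof. by []. Qed.
Lemma vN_0E f : val (0 : N) f = 0. Proof. by []. Qed.
Lemma vN_oppE (a : N) f : val (- a) f = - val a f. Proof. by []. Qed.
Lemma vN_sumE (I : Type) (r : seq I) (P : pred I) (F : I -> N) f :
  val (\sum_(i <- r | P i) F i) f = \sum_(i <- r | P i) val (F i) f.
Proof. by elim/big_rec2: _ => // i _ b _ <-. Qed.

Lemma vN_ext (a b : N) : (forall f, val a f = val b f) -> a = b.
Proof. by move=> e; apply: val_inj; apply/funext. Qed.

Definition rowact (I : finType) (a : I -> N) (x : HG I) : l2 :=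
  \sum_i val (a i) (x i).

Lemma rowact_bounded (I : finType) (a : I -> N) : bounded_op (rowact a).
Proof.
rewrite /rowact; elim: (index_enum I) => [|i r IH].
  have -> : (fun x : HG I => \sum_(i <- [::]) val (a i) (x i)) = (fun=> 0).
    by apply/funext => x; rewrite big_nil.
  by split=> [c x y|]; [rewrite scaler0 addr0 | exists 0 => x; rewrite sqn0 mul0r].
have -> : (fun x : HG I => \sum_(j <- i :: r) val (a j) (x j)) =
    (fun x : HG I => val (a i) (x i) + \sum_(j <- r) val (a j) (x j)).
  by apply/funext => x; rewrite big_cons.
apply: bounded_opD IH.
apply: (@bounded_op_comp _ _ _ _ (val (a i)) (fun x : HG I => x i)).
  exact: vN_bounded.
split=> //; exists 1 => x; rewrite mul1r sqn_hsum (bigD1 i) //= lerDl.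
by apply: sumr_ge0 => j _; exact: sqn_ge0.
Qed.

Lemma rowact_rt (I : finType) (a : I -> N) g x :
  rowact a (rt g x) = rtr g (rowact a x).
Proof.
rewrite /rowact; elim/big_rec2: _ => [|i y z _ ->]; first exact: val_inj.
by rewrite /rt vN_rtr; apply: val_inj.
Qed.

Lemma rowactP (I : finType) (a b : I -> N) c x :
  rowact (fun i => c * a i + b i) x = val c (rowact a x) + rowact b x.
Proof.
rewrite /rowact; have cb := vN_bounded c.
rewrite (eq_bigr (fun i => val c (val (a i) (x i)) + val (b i) (x i))) //.
rewrite !big_split /=; congr (_ + _).
elim/big_rec2: _ => [|i y z _ ->]; first by rewrite (op0 cb).
by rewrite (opD cb).
Qed.

Lemma rowactB (I : finType) (a b : I -> N) x :
  rowact (fun i => a i - b i) x = rowact a x - rowact b x.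
Proof.
have := rowactP b a (-1) x.
have -> : (fun i => -1 * b i + a i) = (fun i => a i - b i).
  by apply/funext => i; rewrite mulN1r addrC.
by move=> ->; rewrite vN_oppE addrC.
Qed.

Lemma rowact_hinj (I : finType) (a : I -> N) i f :
  rowact a (hinj i f) = val (a i) f.
Proof.
rewrite /rowact (bigD1 i) //= /hinj eqxx big1 ?addr0 // => j /negPf ->.
exact: op0 (vN_bounded _).
Qed.

Lemma rowact_sum (I J : finType) (a : I -> N) (b : I -> J -> N) (x : HG J) :
  rowact a (fun i => rowact (b i) x) = rowact (fun j => \sum_i a i * b i j) x.
Proof.
rewrite /rowact; transitivity (\sum_i \sum_j val (a i) (val (b i j) (x j))).
  apply: eq_bigr => i _; elim/big_rec2: _ => [|j y z _ <-].
    exact: op0 (vN_bounded (a i)).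
  by rewrite (opD (vN_bounded (a i))).
by rewrite exchange_big; apply: eq_bigr => j _; rewrite vN_sumE.
Qed.

Definition mxop (I J : finType) (a : J -> I -> N) : HG I -> HG J :=
  fun x j => rowact (a j) x.

Lemma mxop_eqop (I J : finType) (a : J -> I -> N) : eqop (mxop a).
Proof.
split; last by move=> g x; apply/funext => j; rewrite /mxop rowact_rt.
split.
  by move=> c x y; apply/funext => j; rewrite /mxop (opP (rowact_bounded _)).
have /choice[M MP] (j : J) : exists M : R, forall x, sqn (rowact (a j) x) <= M * sqn x.
  by have [M _ MP] := op_bound (rowact_bounded (a j)); exists M.
exists (\sum_j M j) => x; rewrite sqn_hsum mulr_suml; apply: ler_sum => j _.
exact: MP.
Qed.

Section Entries.
Variables (I J : finType) (T : HG I -> HG J).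

(** Conversely, an equivariant operator is given by a matrix over the algebra. *)
Definition entry_fun j i : l2 -> l2 := fun f => T (hinj i f) j.

Lemma entry_vN (Te : eqop T) j i : entry_fun j i \in @vN_pred R G.
Proof.
have [Tb TR] := Te; apply/asboolP; split.
- by move=> c f h; rewrite /entry_fun hinj_linear (opP Tb).
- have [M M0 MP] := op_bound Tb; exists M => f.
  rewrite !l2sqnE -EFinM lee_fin -!sqn_l2 -(sqn_hinj i f).
  apply: le_trans (MP _); rewrite sqn_hsum (bigD1 j) //= lerDl.
  by apply: sumr_ge0 => k _; exact: sqn_ge0.
- move=> g f; rewrite /entry_fun.
  have -> : hinj i (rtr g f) = rt g (hinj i f).
    by apply/funext => k; rewrite /rt /hinj; case: eqP => // _; apply: val_inj.
  by rewrite TR.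
Qed.

Definition entry (Te : eqop T) j i : N :=
  exist (fun a => a \in @vN_pred R G) _ (entry_vN Te j i).

Lemma mxop_entry (Te : eqop T) : mxop (entry Te) = T.
Proof.
apply/funext => x; apply/funext => j; rewrite {2}(hinj_sum x).
have -> : T (\sum_i hinj i (x i)) = \sum_i T (hinj i (x i)).
  by elim/big_rec2: _ => [|i y z _ <-]; rewrite ?(op0 Te.1) // (opD Te.1).
by rewrite fct_sumE.
Qed.
End Entries.

(** ** Approximating an intersection by finite intersections *)

Lemma orthZ (I : finType) (V : set (HG I)) (c : R[i]) y : closed_subspace V ->
  (forall v, V v -> ip y v = 0) -> forall v, V v -> ip (c *: y) v = 0.
Proof.
move=> Vs yV v Vv; case: c => a b.
have -> : (a +i* b) = a%:C + b%:C * 'i by simpc.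
rewrite scalerDl -scalerA ipDl !ipZl ip_il (yV _ Vv) (yV _ (subspaceZ Vs _ Vv)).
by rewrite oppr0 !mulr0 addr0.
Qed.

Section FiniteIntersection.
Variables (J : finType) (K : set (J -> N)).

Definition common_ker (L : set (J -> N)) : set (HG J) :=
  [set x | forall k, L k -> rowact k x = 0].

Lemma common_ker_invariant L : rt_invariant (common_ker L).
Proof.
split.
  split=> [k _|c x y hx hy k Lk|l h k Lk] /=.
  - exact: op0 (rowact_bounded k).
  - by rewrite (opP (rowact_bounded k)) hx ?hy // scaler0 addr0.
  - have [_ _ kcl] := ker_closed_subspace (rowact_bounded k).
    by apply: kcl => e /h[x xP xl]; exists x => //=; exact: xP.
move=> g x xP k Lk; rewrite rowact_rt xP //; exact: val_inj.
Qed.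

Let ck L := (common_ker_invariant L).1.

(** The orthogonal complements of the common kernels of the finite subsets of K
    form a directed family whose union is dense in the complement of the common
    kernel of K, so that finitely many equations suffice up to e. *)
Lemma common_ker_approx (e : R) : 0 < e -> exists2 s : seq (J -> N),
  [set` s] `<=` K & gdim (common_ker [set` s]) <= gdim (common_ker K) + e.
Proof.
move=> e0; pose V0 := common_ker K.
pose C := [set x : HG J | forall d : R, 0 < d -> exists2 s : seq (J -> N),
  [set` s] `<=` K & exists2 y : HG J, (forall v, common_ker [set` s] v -> ip y v = 0) &
   sqn (x - y) < d].
(* C is the closure of the union of the complements for finite subsets *)
have Cs : closed_subspace C.
  split.
  - move=> d d0; exists [::] => //; exists 0 => [v _|]; first exact: ip0l.
    by rewrite subr0 sqn0.
  - move=> c x y Cx Cy d d0; have c1 : 0 < sqmod c + 1.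
      by rewrite ltr_wpDl // -lee_fin sqmod_ge0.
    have [|s sK [x' x'P xx']] := Cx (d / 4 / (sqmod c + 1)); first by rewrite !divr_gt0.
    have [|t tK [y' y'P yy']] := Cy (d / 4); first by rewrite divr_gt0.
    exists (s ++ t); first by move=> k /=; rewrite mem_cat => /orP[/sK|/tK].
    exists (c *: x' + y') => [v vP|].
      rewrite ipDl (@orthZ _ _ c x' (ck [set` s])) ?y'P ?addr0 // => k ks.
        by apply: vP; rewrite /= mem_cat ks orbT.
      by apply: vP; rewrite /= mem_cat ks.
    have -> : c *: x + y - (c *: x' + y') = c *: (x - x') + (y - y').
      by rewrite scalerBr opprD addrACA.
    apply: le_lt_trans (sqnD_le _ _) _; rewrite sqnZ.
    rewrite ltr_pdivlMr // in xx'.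
    have := sqn_ge0 (x - x'); lra.
  - move=> l h d d0; have [|x Cx xl] := h (d / 4); first by rewrite divr_gt0.
    have [|s sK [y yP xy]] := Cx (d / 4); first by rewrite divr_gt0.
    exists s => //; exists y => //; rewrite sqnB in xl.
    have -> : l - y = (l - x) + (x - y) by rewrite addrA subrK.
    by apply: le_lt_trans (sqnD_le _ _) _; lra.
have V0s := ck K.
have inC j : C (dlt R G j - hproj V0 (dlt R G j)).
  set x := dlt R G j - _.
  have xV0 v : V0 v -> ip x v = 0 by have [_] := hprojP V0s (dlt R G j); apply.
  pose c := hproj C x; pose d := x - c.
  have dC y : C y -> ip d y = 0 by have [_] := hprojP Cs x; apply.
  have dV : V0 d.
    move=> k Kk; pose Vk := common_ker [set` [:: k]].
    have Vks : closed_subspace Vk := ck _.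
    have [dk dkP] := hprojP Vks d.
    have Cd : C (d - hproj Vk d).
      move=> r r0; exists [:: k]; first by move=> k'; rewrite /= inE => /eqP ->.
      by exists (d - hproj Vk d) => //; rewrite subrr sqn0.
    have : sqn (d - hproj Vk d) = 0 by rewrite -ipxx ipBl (dC _ Cd) ipC dkP // subr0.
    move/sqn_eq0/eqP; rewrite subr_eq0 => /eqP ->.
    by apply: dk; rewrite /= inE.
  have : sqn d = 0.
    rewrite -ipxx {2}/d ipBr (dC c); last exact: hproj_in.
    by rewrite ipC xV0 // subr0.
  by move/sqn_eq0/eqP; rewrite subr_eq0 => /eqP ->; exact: hproj_in.
pose r := e / #|J|.+1%:R; have r0 : 0 < r by rewrite divr_gt0 // ltr0n.
have /choice[s sP] (j : J) : exists s : seq (J -> N), [set` s] `<=` K /\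
    exists2 y : HG J, (forall v, common_ker [set` s] v -> ip y v = 0) &
    sqn (dlt R G j - hproj V0 (dlt R G j) - y) < r.
  by have [s sK yP] := inC j r r0; exists s.
pose S := flatten [seq s j | j <- enum J].
have sS j k : k \in s j -> k \in S.
  by move=> ks; apply/flattenP; exists (s j) => //; apply/mapP; exists j; rewrite ?mem_enum.
exists S.
  by move=> k /= /flattenP[_ /mapP[j _ ->] /(sP j).1].
pose V := common_ker [set` S]; have Vs : closed_subspace V := ck _.
apply: (@le_trans _ _ (\sum_j (sqn (hproj V0 (dlt R G j)) + r))).
  apply: ler_sum => j _; set p0 := hproj V0 _.
  have [y yP yr] := (sP j).2; rewrite -/p0 in yr.
  have V0V v : V0 v -> V v.
    by move=> vP k /= /flattenP[_ /mapP[i _ ->] /(sP i).1]; exact: vP.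
  have p0V : V p0 by apply: V0V; exact: hproj_in.
  have e1 : hproj V (dlt R G j) = p0 + hproj V (dlt R G j - p0 - y).
    rewrite !(opB (hproj_bounded Vs)) (hproj_id Vs p0V).
    have -> : hproj V y = 0.
      apply/esym/(hproj_unique Vs) => [|v vP]; first exact: subspace0.
      by rewrite ip0l yP // => k ks; apply: vP; exact: sS ks.
    by rewrite subr0 addrC subrK.
  have e2 : ip p0 (hproj V (dlt R G j - p0 - y)) = 0.
    have -> : hproj V (dlt R G j - p0 - y) = hproj V (dlt R G j) - p0.
      by apply/eqP; rewrite eq_sym subr_eq addrC -e1.
    rewrite ipBr -(ip_hprojl Vs) (hproj_id Vs p0V) ipxx.
    by rewrite /p0 (sqn_hproj V0s) subrr.
  rewrite e1 sqnD e2 mul0rn addr0 lerD2l ltW // (le_lt_trans _ yr) //.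
  exact: sqn_hproj_le.
rewrite big_split /= lerD2l sumr_const -mulr_natr /r mulrAC.
by rewrite ler_pdivrMr ?ltr0n // ler_pM2l // ler_nat.
Qed.

End FiniteIntersection.

(** ** Submodules are dense in their closures *)

Section Blocks.
Variables I T : finType.
Definition lblock (x : HG (I + T)%type) : HG I := fun i => x (inl i).
Definition rblock (x : HG (I + T)%type) : HG T := fun t => x (inr t).

Lemma ip_blocks x y :
  ip x y = ip (lblock x) (lblock y) + ip (rblock x) (rblock y).
Proof. by rewrite !ip_hsum big_sumType. Qed.

Lemma sqn_blocks x : sqn x = sqn (lblock x) + sqn (rblock x).
Proof. by rewrite -!ipxx ip_blocks. Qed.
End Blocks.

Lemma vN_sum_mulE (I : finType) (a b : I -> N) f :
  val (\sum_i a i * b i) f = \sum_i val (a i) (val (b i) f).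
Proof. by rewrite vN_sumE; apply: eq_bigr => i _; rewrite vN_mulE. Qed.

(** The rows vanishing on the common kernel of K form the closure of K; modulo K
    they have dimension 0, in the sense that the rows D of relations between the
    X i modulo K have no common kernel.

    Let Y be a finite part of K with almost the same kernel, let Z be X stacked
    on Y, and let E be the projection onto the complement of the image of Z.
    From E Z = 0 the left blocks of the rows of E lie in D, hence a common zero
    of D is killed by the adjoint of F, the left block of E.  The index formulas
    for F, Z and Y bound the dimension of these zeros by the dimension lost
    between the kernels of Y and of K. *)
Lemma dense_annihilator (I J : finType) (K : set (J -> N)) (X : I -> J -> N) :
  K (fun=> 0) ->
  (forall a x y, K x -> K y -> K (fun j => a * x j + y j)) ->
  (forall xi : HG J, common_ker K xi -> forall i, rowact (X i) xi = 0) ->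
  forall u : HG I,
  (forall a : I -> N, K (fun j => \sum_i a i * X i j) -> rowact a u = 0) ->
  u = 0.
Proof.
move=> K0 KP XK u uP.
pose D := [set a : I -> N | K (fun j => \sum_i a i * X i j)].
have Ui := common_ker_invariant D.
apply: (gdim_eq0 Ui _ uP).
apply/ler_addgt0Pr => e e0; rewrite add0r.
have [s sK sd] := common_ker_approx K e0.
pose T : finType := 'I_(size s); pose IT : finType := (I + T)%type.
pose Yrow (t : T) := nth (fun=> 0) s t.
pose Y := mxop Yrow; have Ye : eqop Y := mxop_eqop _.
have kY : [set x | Y x = 0] = common_ker [set` s].
  apply/seteqP; split=> x /= h.
    move=> k /= ks; have kl : (index k s < size s)%N by rewrite index_mem.
    have := congr1 (fun f => f (Ordinal kl)) h.
    by rewrite /Y /mxop /Yrow /= nth_index.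
  by apply/funext => t; apply: h; rewrite /= mem_nth.
pose Zrow (k : IT) := match k with inl i => X i | inr t => Yrow t end.
pose Z := mxop Zrow; have Ze : eqop Z := mxop_eqop _.
have kZ : common_ker K `<=` [set x | Z x = 0].
  move=> x xK; apply/funext => -[i|t] /=; first exact: XK.
  by apply: xK; apply: sK; rewrite /= mem_nth.
have Ae := eqop_adj Ze; have kZi := ker_invariant Ae.
pose E := hproj [set y | adj Z y = 0]; have Ee : eqop E := eqop_hproj kZi.
have EZ x : E (Z x) = 0.
  apply: ip_nondeg => y; rewrite ip0l (ip_hprojl kZi.1) (adjP Ze.1).
  by rewrite (hproj_in kZi.1) ip0r.
pose emb (v : HG I) : HG IT := fun k => if k is inl i then v i else 0.
have sum_emb k v : rowact (entry Ee k) (emb v) = rowact (fun i => entry Ee k (inl i)) v.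
  rewrite /rowact big_sumType -[RHS]addr0; congr (_ + _); apply: big1 => t _.
  exact: (op0 (vN_bounded (entry Ee k (inr t)))).
have Drow k : D (fun i => entry Ee k (inl i)).
  have ZE j : \sum_i entry Ee k (inl i) * X i j =
      - \sum_t entry Ee k (inr t) * Yrow t j.
    apply/eqP; rewrite -addr_eq0; apply/eqP; apply: vN_ext => f.
    have h : E (Z (hinj j f)) k = 0 by rewrite EZ.
    rewrite -{1}(mxop_entry Ee) /mxop /rowact big_sumType /= in h.
    have e1 i : val (entry Ee k (inl i)) (val (X i j) f) =
        entry_fun E k (inl i) (Z (hinj j f) (inl i)).
      by rewrite /Z /mxop rowact_hinj.
    have e2 t : val (entry Ee k (inr t)) (val (Yrow t j) f) =
        entry_fun E k (inr t) (Z (hinj j f) (inr t)).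
      by rewrite /Z /mxop rowact_hinj.
    rewrite vN_addE !vN_sum_mulE (eq_bigr _ (fun i _ => e1 i)).
    by rewrite [X in _ + X](eq_bigr _ (fun t _ => e2 t)).
  have KZ a x : K x -> K (fun j => a * x j).
    by move=> Kx; have := KP a x _ Kx K0; under eq_fun do rewrite addr0.
  have KS (r : seq T) : K (fun j => \sum_(t <- r) entry Ee k (inr t) * Yrow t j).
    elim: r => [|t r IH]; first by under eq_fun do rewrite big_nil.
    under eq_fun do rewrite big_cons.
    by apply: KP IH; apply: sK; rewrite /= mem_nth.
  have e1 : (fun j => -1 * \sum_t entry Ee k (inr t) * Yrow t j) =
      (fun j => \sum_i entry Ee k (inl i) * X i j).
    by apply/funext => j; rewrite mulN1r -ZE.
  by have := KZ (-1) _ (KS (index_enum T)); rewrite e1.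
have Eemb v : common_ker D v -> E (emb v) = 0.
  move=> vD; rewrite -(mxop_entry Ee); apply/funext => k.
  by rewrite /mxop sum_emb; apply: vD.
pose F (y : HG IT) : HG I := lblock (E y).
have Fe : eqop F.
  split; last by move=> g y; rewrite /F Ee.2.
  split; first by move=> c x y; rewrite /F (opP Ee.1).
  exists 1 => y; rewrite mul1r; apply: le_trans (sqn_hproj_le kZi.1 y).
  by rewrite [leRHS]sqn_blocks lerDl sqn_ge0.
have adjF : adj F = (fun v => E (emb v)).
  apply: (adj_eq Fe.1) => y v; rewrite -(ip_hprojl kZi.1) [RHS]ip_blocks.
  by rewrite [X in _ + X](ip0r (rblock (E y))) addr0.
have dU : gdim (common_ker D) <= gdim [set v | adj F v = 0].
  apply: gdim_le; [exact: Ui.1 | exact: (ker_invariant (eqop_adj Fe)).1 |].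
  by move=> v vD; rewrite /= adjF; exact: Eemb.
have AYe := eqop_adj Ye; have kAYi := ker_invariant AYe.
have bound_arith (P a b r r' t m : R) : P = a + b -> r = P - r' ->
    a <= (t + r) / 2 -> b <= (m + r') / 2 -> P <= t + m by lra.
have half_ge0 (x : R) : 0 <= x -> 0 <= (0 + x) / 2 by move=> ?; lra.
have dF : gdim [set y | F y = 0] <=
    (#|IT|%:R - gdim [set y | adj Z y = 0]) + gdim [set y | adj Y y = 0].
  pose B := [set y | adj Y y = 0].
  pose c (k : IT) : R := if k is inr t then sqn (hproj B (dlt R G t)) else 0.
  have cE : \sum_k c k = gdim B by rewrite big_sumType /= big1 ?add0r.
  have dE : #|IT|%:R - gdim [set y | adj Z y = 0] =
      \sum_k sqn (dlt R G k - E (dlt R G k)).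
    rewrite (eq_bigr (fun k => 1 - sqn (E (dlt R G k)))).
      by rewrite sumrB sumr_const.
    by move=> k _; rewrite (sqn_hprojB kZi.1) sqn_dlt.
  rewrite -cE dE -big_split /=; apply: ler_sum => k _.
  have kFs := (ker_invariant Fe).1.
  set d := dlt R G k; pose p := hproj [set y | F y = 0] d; pose q := E p.
  have q0 : lblock q = 0 by exact: (hproj_in kFs d).
  have Zq : adj Z q = 0 by exact: (hproj_in kZi.1).
  have e1 : ip d (p - q) = ip (d - E d) (p - q).
    have [_ pq] := hprojP kZi.1 p.
    have Ed : ip (E d) (p - q) = 0 by rewrite ipC; apply: pq; exact: (hproj_in kZi.1 d).
    by rewrite [RHS]ipBl Ed subr0.
  have e2 : sqn p = ip d (p - q) + ip d q.
    by rewrite -ipDr subrK /p (sqn_hproj kFs) ipC.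
  have e3 : sqn (p - q) = sqn p - sqn q by exact: (sqn_hprojB kZi.1).
  have b1 : ip d (p - q) <= (sqn (d - E d) + sqn (p - q)) / 2.
    by rewrite e1; apply: le_trans (ler_norm _) (ip_bound _ _).
  suff b2 : ip d q <= (c k + sqn q) / 2 by exact: bound_arith e2 e3 b1 b2.
  rewrite ipC /d /dlt ip_hinj; case: (k) => [i|t].
    rewrite -[q (inl i)]/(lblock q i) q0 ip0l.
    exact: half_ge0 (sqn_ge0 q).
  have Yb : B (rblock q).
    apply: ip_nondeg => x; rewrite ip0l (adjP' Ye.1) ipC.
    have <- : ip (Z x) q = ip (Y x) (rblock q) by rewrite ip_blocks q0 ip0r add0r.
    by rewrite (adjP Ze.1) Zq ip0r.
  have sb : sqn (rblock q) = sqn q by rewrite [RHS]sqn_blocks q0 sqn0 add0r.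
  have -> : ip (q (inr t)) (delta1 R G) = ip (hproj B (dlt R G t)) (rblock q).
    by rewrite (ip_hproj kAYi.1 _ Yb) [RHS]ipC ip_hinj.
  apply: le_trans (ler_norm _) _; apply: le_trans (ip_bound _ _) _.
  by rewrite sb.
have iF := index_formula Fe; have iZ := index_formula Ze.
have iY := index_formula Ye; rewrite kY in iY.
have dZ := gdim_le (common_ker_invariant K).1 (ker_invariant Ze).1 kZ.
have cT : #|IT|%:R = #|I|%:R + #|T|%:R :> R by rewrite card_sum natrD.
by rewrite cT in iF iZ dF; lra.
Qed.

End Matrices.

(** * Positive definite kernels *)

Section Kernels.
Variable (R : realType).

Definition kform (X : Type) (K : X -> X -> R) (s : seq (R * X)) : R :=
  \sum_(p <- s) \sum_(q <- s) p.1 * q.1 * K p.2 q.2.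

Definition pos_def (X : Type) (K : X -> X -> R) :=
  (forall x y, K x y = K y x) /\ forall s, 0 <= kform K s.

Section Closure.
Variable X : choiceType.
Implicit Types K L : X -> X -> R.

Lemma pos_def_scale (u : X -> R) K : pos_def K ->
  pos_def (fun x y => u x * u y * K x y).
Proof.
move=> [Ks Kp]; split=> [x y|s]; first by rewrite Ks (mulrC (u x)).
have := Kp [seq (p.1 * u p.2, p.2) | p <- s]; rewrite /kform big_map.
congr (_ <= _); apply: eq_bigr => p _; rewrite big_map; apply: eq_bigr => q _ /=.
by ring.
Qed.

Lemma pos_def_add K L : pos_def K -> pos_def L ->
  pos_def (fun x y => K x y + L x y).
Proof.
move=> [Ks Kp] [Ls Lp]; split=> [x y|s]; first by rewrite Ks Ls.
rewrite /kform; under eq_bigr do under eq_bigr do rewrite mulrDr.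
by under eq_bigr do rewrite big_split; rewrite big_split addr_ge0 //; apply: Kp || apply: Lp.
Qed.

Lemma pos_def0 : pos_def (fun _ _ : X => 0).
Proof. by split=> // s; rewrite /kform big1 // => p _; rewrite big1 // => q _; rewrite mulr0. Qed.

Lemma pos_def1 : pos_def (fun _ _ : X => 1).
Proof.
split=> // s; rewrite /kform.
under eq_bigr do under eq_bigr do rewrite mulr1.
under eq_bigr do rewrite -mulr_sumr.
by rewrite -mulr_suml -expr2 sqr_ge0.
Qed.

(** The product of a kernel with a Gram kernel is a sum of rescalings. *)
Lemma pos_def_gram (us : seq (X -> R)) K : pos_def K ->
  pos_def (fun x y => (\sum_(u <- us) u x * u y) * K x y).
Proof.
move=> Kp; elim: us => [|u us IH].
  by under eq_fun do under eq_fun do rewrite big_nil mul0r; exact: pos_def0.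
under eq_fun do under eq_fun do rewrite big_cons mulrDl.
by apply: pos_def_add IH; exact: pos_def_scale.
Qed.

Lemma pos_def_lim (Kn : nat -> X -> X -> R) K : (forall n, pos_def (Kn n)) ->
  (forall x y, Kn n x y @[n --> \oo] --> K x y) -> pos_def K.
Proof.
move=> Knp KK; split=> [x y|s].
  apply: (cvg_unique (@Rhausdorff R) (KK x y)).
  rewrite (_ : (fun n => Kn n x y) = (fun n => Kn n y x)); first exact: KK.
  by apply/funext => n; exact: (Knp n).1.
have h : kform (Kn n) s @[n --> \oo] --> kform K s.
  apply: cvg_sumr => p; apply: cvg_sumr => q; apply: cvgM; last exact: KK.
  exact: cvg_cst.
rewrite -(cvg_lim (@Rhausdorff R) h); apply: limr_ge; first by apply/cvg_ex; exists (kform K s).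
by near=> n; exact: (Knp n).2.
Unshelve. all: by end_near.
Qed.

(** Being positive definite is a closed condition on finite sets of points. *)
Lemma pos_def_approx K : (forall x y, K x y = K y x) ->
  (forall (s : seq X) (e : R), 0 < e -> exists2 L, pos_def L &
     forall x y, x \in s -> y \in s -> `|K x y - L x y| <= e) ->
  pos_def K.
Proof.
move=> Ks h; split=> // s.
pose M := \sum_(p <- s) \sum_(q <- s) `|p.1 * q.1|.
have M0 : 0 <= M by apply: sumr_ge0 => p _; apply: sumr_ge0.
rewrite -lerN2 oppr0; apply/ler_addgt0Pr => e e0; rewrite add0r.
have [|L [_ Lp] LP] := h [seq p.2 | p <- s] (e / (M + 1)).
  by rewrite divr_gt0 // ltr_wpDl.
have : `|kform K s - kform L s| <= M * (e / (M + 1)).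
  rewrite /kform -sumrB /M mulr_suml; apply: le_trans (ler_norm_sum _ _ _) _.
  rewrite big_seq [leRHS]big_seq; apply: ler_sum => p ps.
  rewrite -sumrB mulr_suml; apply: le_trans (ler_norm_sum _ _ _) _.
  rewrite big_seq [leRHS]big_seq; apply: ler_sum => q qs.
  by rewrite -mulrBr normrM ler_wpM2l // LP // map_f.
have : M * (e / (M + 1)) <= e.
  by rewrite mulrA ler_pdivrMr ?ltr_wpDl // mulrC ler_pM2l // lerDl.
by rewrite ler_norml; have := Lp s; lra.
Qed.

(** With vectors given by their coordinates rs, the kernel
    1 / (1 + |x - y|^2) is a geometric series of Gram kernels, after
    division by (1 + |x|^2) (1 + |y|^2). *)
Lemma pos_def_cauchy_finite (rs : seq (X -> R)) :
  pos_def (fun x y => (1 + \sum_(r <- rs) (r x - r y) ^+ 2)^-1).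
Proof.
pose a x := \sum_(r <- rs) r x ^+ 2; pose c x := 1 + a x.
have a0 x : 0 <= a x by apply: sumr_ge0 => r _; exact: sqr_ge0.
have c0 x : 0 < c x by rewrite ltr_wpDr.
pose k x y := \sum_(r <- rs) r x * r y.
pose psi x y := \sum_(r <- rs) (r x - r y) ^+ 2.
have psiE x y : psi x y = a x + a y - k x y *+ 2.
  rewrite /psi /a /k -big_split -sumrMnl -sumrB; apply: eq_bigr => r _ /=; ring.
have psi0 x y : 0 <= psi x y by apply: sumr_ge0 => r _; exact: sqr_ge0.
pose us := (fun x => a x / c x) :: [seq (fun x => Num.sqrt 2 * r x / c x) | r <- rs].
pose L x y := \sum_(u <- us) u x * u y.
have LE x y : L x y = 1 - (1 + psi x y) / (c x * c y).
  rewrite /L big_cons big_map.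
  have -> : \sum_(r <- rs) Num.sqrt 2 * r x / c x * (Num.sqrt 2 * r y / c y) =
      k x y * (2 / (c x * c y)).
    rewrite /k mulr_suml; apply: eq_bigr => r _.
    have := sqr_sqrtr (ler0n R 2); move: (Num.sqrt 2) => w w2.
    have -> : (2 : R) = w ^+ 2 by [].
    by have := c0 x; have := c0 y => y0 x0; field; rewrite !gt_eqF.
  rewrite psiE /c; have := c0 x; have := c0 y; rewrite /c => y0 x0.
  by field; rewrite !gt_eqF.
have psi_le x y : psi x y <= (a x + a y) *+ 2.
  rewrite /psi /a -big_split -sumrMnl; apply: ler_sum => r _ /=.
  have := sqr_ge0 (r x + r y); lra.
have L1 x y : `|L x y| < 1.
  have cc : 0 < c x * c y by rewrite mulr_gt0.
  have h1 : 0 < (1 + psi x y) / (c x * c y) by rewrite divr_gt0 ?ltr_wpDr.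
  have h2 : (1 + psi x y) / (c x * c y) < 2.
    rewrite ltr_pdivrMr // /c; have := psi_le x y.
    have := mulr_ge0 (a0 x) (a0 y); have := a0 x; have := a0 y; nra.
  by rewrite LE ltr_norml; apply/andP; split; lra.
have Lpow n : pos_def (fun x y => L x y ^+ n).
  elim: n => [|n IH]; first exact: pos_def1.
  by under eq_fun do under eq_fun do rewrite exprS; exact: pos_def_gram.
have Lsum n : pos_def (fun x y => series (geometric 1 (L x y)) n).
  rewrite /series; elim: n => [|n IH] /=.
    by under eq_fun do under eq_fun do rewrite big_nil; exact: pos_def0.
  under eq_fun do under eq_fun do rewrite big_nat_recr //= mul1r.
  exact: pos_def_add.
apply: (pos_def_lim (fun n => pos_def_scale (fun x => (c x)^-1) (Lsum n))) => x y.
have -> : (1 + \sum_(r <- rs) (r x - r y) ^+ 2)^-1 =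
    (c x)^-1 * (c y)^-1 * (1 * (1 - L x y)^-1).
  rewrite LE subKr invf_div -/(psi x y) mul1r.
  have := c0 x; have := c0 y => y0 x0; have := psi0 x y => p0.
  by field; rewrite !gt_eqF // ltr_wpDr.
apply: cvgM; first exact: cvg_cst.
exact: cvg_geometric_series.
Qed.

Lemma pos_def_cauchy (G : groupType) (v : X -> l2 R G) :
  pos_def (fun x y => (1 + sqn (v x - v y))^-1).
Proof.
apply: pos_def_approx => [x y|s e e0]; first by rewrite sqnB.
have [t ut tP] := sqn_approx [seq v x - v y | x <- s, y <- s] e0.
pose rs := [seq (fun x => complex.Re (val (v x) z)) | z <- t] ++
           [seq (fun x => complex.Im (val (v x) z)) | z <- t].
exists (fun x y => (1 + \sum_(r <- rs) (r x - r y) ^+ 2)^-1).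
  exact: pos_def_cauchy_finite.
move=> x y xs ys; have -> : \sum_(r <- rs) (r x - r y) ^+ 2 =
    \sum_(z <- t) sqmod (val (v x - v y) z).
  rewrite /rs big_cat !big_map -[LHS]big_split; apply: eq_bigr => z _.
  have -> : val (v x - v y) z = val (v x) z - val (v y) z by [].
  by rewrite /= /sqmod !raddfB.
have /tP/andP[lo hi] : v x - v y \in [seq v x - v y | x <- s, y <- s].
  by apply/allpairsP; exists (x, y).
set A := sqn _ in lo hi *; set B := \sum_(z <- t) _ in lo hi *.
have B0 : 0 <= B by apply: sumr_ge0 => z _; rewrite -lee_fin sqmod_ge0.
have A0 : 0 <= A by apply: le_trans hi.
have A1 : 0 < 1 + A by rewrite ltr_wpDr.
have B1 : 0 < 1 + B by rewrite ltr_wpDr.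
have -> : (1 + A)^-1 - (1 + B)^-1 = - ((A - B) / ((1 + A) * (1 + B))).
  by field; rewrite !gt_eqF.
rewrite normrN ger0_norm; last by rewrite divr_ge0 ?subr_ge0 // mulr_ge0 // ltW.
rewrite ler_pdivrMr ?mulr_gt0 //; have := mulr_ge0 A0 B0; nra.
Qed.

(** On finitely many points the new factor is the Gram kernel of the indicators
    of the labels. *)
Lemma pos_def_label (T : eqType) (c : X -> T) K : pos_def K ->
  pos_def (fun x y => (c x == c y)%:R * K x y).
Proof.
move=> Kp; apply: pos_def_approx => [x y|s e e0]; first by rewrite Kp.1 eq_sym.
pose us := [seq (fun x => (c x == l)%:R : R) | l <- undup [seq c x | x <- s]].
exists (fun x y => (\sum_(u <- us) u x * u y) * K x y); first exact: pos_def_gram.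
move=> x y xs _; have -> : \sum_(u <- us) u x * u y = (c x == c y)%:R.
  rewrite big_map (bigD1_seq (c x)) ?undup_uniq ?mem_undup ?map_f //= eqxx mul1r.
  rewrite big1 ?addr0 ?(eq_sym (c y)) // => l /negPf lx.
  by rewrite eq_sym lx mul0r.
by rewrite subrr normr0 ltW.
Qed.

End Closure.
End Kernels.

(** * The Hilbert space of a kernel *)

Record pdkernel (R : realType) (X : choiceType) :=
  PDKernel { kfun :> X -> X -> R; kfun_pd : pos_def kfun }.

Section ReproducingKernel.
Variables (R : realType) (X : choiceType) (K : pdkernel R X).
Local Notation C := R[i].
Implicit Types (f g : X -> C) (s t : seq (C * X)).

Definition rdotc (z w : C) : R :=
  complex.Re z * complex.Re w + complex.Im z * complex.Im w.

Definition pair f s : R := \sum_(p <- s) rdotc p.1 (f p.2).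
Definition kip s t : R := \sum_(p <- s) \sum_(q <- t) rdotc p.1 q.1 * K p.2 q.2.
(** If k is the combination of kernel functions given by s, this is
    2 Re <f, k> - |k|^2, and its supremum over s is |f|^2.  Defining the kernel
    space by this supremum avoids both a completion and a quotient by the null
    combinations. *)
Definition legendre s f : R := pair f s *+ 2 - kip s s.
Definition cscale (c : C) s := [seq (c * p.1, p.2) | p <- s].

Definition rk_pred : {pred X -> C} :=
  fun f => `[< exists M : R, forall s, legendre s f <= M >].

Let Kp : pos_def K := kfun_pd K.

Lemma kip_ge0 s : 0 <= kip s s.
Proof.
have [_ h] := Kp.
have := h [seq (complex.Re p.1, p.2) | p <- s].
have := h [seq (complex.Im p.1, p.2) | p <- s].
rewrite /kform !big_map => h1 h2; have := addr_ge0 h2 h1.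
congr (_ <= _); rewrite -big_split; apply: eq_bigr => p _ /=.
rewrite !big_map -big_split; apply: eq_bigr => q _ /=.
by rewrite /rdotc mulrDl.
Qed.

Lemma kipC s t : kip s t = kip t s.
Proof.
rewrite /kip exchange_big; apply: eq_bigr => p _; apply: eq_bigr => q _.
by rewrite Kp.1 /rdotc mulrC (mulrC (complex.Re _)) (mulrC (complex.Im _)) mulrC.
Qed.

Lemma kip_catl s t r : kip (s ++ t) r = kip s r + kip t r.
Proof. by rewrite /kip big_cat. Qed.

Lemma kip_catr s t r : kip r (s ++ t) = kip r s + kip r t.
Proof. by rewrite kipC kip_catl !(kipC r). Qed.

Lemma kip_scale c s t : kip (cscale c s) (cscale c t) = sqmod c * kip s t.
Proof.
rewrite /kip big_map mulr_sumr; apply: eq_bigr => p _ /=.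
rewrite big_map mulr_sumr; apply: eq_bigr => q _ /=; rewrite mulrA; congr (_ * _).
by case: c (p.1) (q.1) => [a b] [u v] [w z]; rewrite /rdotc /sqmod /=; ring.
Qed.

Lemma kip_opp s t : kip (cscale (-1) s) t = - kip s t.
Proof.
rewrite /kip big_map -sumrN; apply: eq_bigr => p _ /=.
rewrite -sumrN; apply: eq_bigr => q _ /=; rewrite -mulNr; congr (_ * _).
by case: (p.1) (q.1) => [u v] [w z]; rewrite /rdotc /=; ring.
Qed.

Lemma pair_cat f s t : pair f (s ++ t) = pair f s + pair f t.
Proof. by rewrite /pair big_cat. Qed.

Lemma pairD f g s : pair (f + g) s = pair f s + pair g s.
Proof.
rewrite /pair -big_split; apply: eq_bigr => p _ /=; rewrite fctE.
by case: (p.1) (f _) (g _) => [u v] [w z] [w' z']; rewrite /rdotc /=; ring.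
Qed.

Lemma pairZ c f s : pair (fun x => c * f x) s = pair f (cscale (c^*)%C s).
Proof.
rewrite /pair big_map; apply: eq_bigr => p _ /=.
by case: c (p.1) (f _) => [a b] [u v] [w z]; rewrite /rdotc /=; ring.
Qed.

Lemma pair_scaler (a : R) f s : pair f (cscale a%:C s) = a * pair f s.
Proof.
rewrite /pair big_map mulr_sumr; apply: eq_bigr => p _ /=.
by case: (p.1) (f _) => [u v] [w z]; rewrite /rdotc /=; ring.
Qed.

Lemma legendreZ c f s : c != 0 ->
  legendre s (fun x => c * f x) =
  sqmod c * legendre (cscale (sqmod c)^-1%:C (cscale (c^*)%C s)) f.
Proof.
move=> c0; have n0 : sqmod c != 0.
  by apply: contra c0 => /eqP h; rewrite (@sqmod_eq0 _ c) ?h.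
have cc : sqmod (c^*)%C = sqmod c by case: (c) => a b; rewrite /sqmod /= sqrrN.
rewrite /legendre pairZ pair_scaler !kip_scale sqmodR cc.
by field.
Qed.

Lemma legendreD f g s t :
  legendre s (f + g) + legendre t (f - g) =
  (legendre (cscale (2^-1)%:C (s ++ t)) f +
   legendre (cscale (2^-1)%:C (s ++ cscale (-1) t)) g) *+ 2.
Proof.
have pairN : pair (- g) t = pair g (cscale (-1) t).
  rewrite /pair big_map; apply: eq_bigr => p _ /=; rewrite fctE.
  by case: (p.1) (g _) => [u v] [w z]; rewrite /rdotc /=; ring.
rewrite /legendre !pair_scaler !kip_scale !sqmodR !pairD pairN !pair_cat.
rewrite !kip_catl !kip_catr (kipC s (cscale _ _)) !kip_opp.
rewrite (kipC t (cscale _ _)) kip_opp (kipC t s).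
by field.
Qed.

Lemma legendre0 s : legendre s 0 <= 0.
Proof.
rewrite /legendre /pair big1 ?mul0rn ?sub0r ?oppr_le0 ?kip_ge0 // => p _.
by rewrite /rdotc /= !mulr0 addr0.
Qed.

Fact rk_submod : submod_closed (rk_pred : {pred X -> C^o}).
Proof.
split; first by apply/asboolP; exists 0; exact: legendre0.
move=> c f g /asboolP[M fM] /asboolP[M' gM]; apply/asboolP.
have [N cfN] : exists N, forall s, legendre s (c *: f) <= N.
  have [->|c0] := eqVneq c 0.
    by exists 0 => s; rewrite scale0r; exact: legendre0.
  exists (sqmod c * M) => s; rewrite [leLHS]legendreZ // ler_wpM2l //.
  by rewrite -lee_fin sqmod_ge0.
exists ((N + M') *+ 2) => s.
have := legendreD (c *: f) g s [::].
rewrite [X in _ + X = _ -> _]/legendre /pair /kip !big_nil mul0rn subr0 addr0 => ->.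
by rewrite lerMn2r /= lerD.
Qed.

HB.instance Definition _ :=
  GRing.isSubmodClosed.Build C (X -> C^o) rk_pred rk_submod.

Definition rk := {f : X -> C^o | f \in rk_pred}.
HB.instance Definition _ := SubChoice.on rk.
HB.instance Definition _ := [SubChoice_isSubLmodule of rk by <:].

Definition rksqn (f : rk) : R := sup [set legendre s (val f) | s in setT].

Lemma rk_sup (f : rk) : has_sup [set legendre s (val f) | s in setT].
Proof.
split; first by exists (legendre [::] (val f)), [::].
by have /asboolP[M fM] := valP f; exists M => _ [s _ <-].
Qed.

Lemma legendre_le (f : rk) s : legendre s (val f) <= rksqn f.
Proof. by apply: sup_upper_bound; [exact: rk_sup | exists s]. Qed.

Lemma rksqn_leP (f : rk) M : rksqn f <= M <-> forall s, legendre s (val f) <= M.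
Proof.
split=> [fM s|fM]; first exact: le_trans (legendre_le f s) fM.
by apply: ge_sup; [case: (rk_sup f) | move=> _ [s _ <-]].
Qed.

Fact rksqn_ge0 (f : rk) : 0 <= rksqn f.
Proof.
apply: le_trans (legendre_le f [::]).
by rewrite /legendre /pair /kip !big_nil mul0rn subr0.
Qed.

Lemma legendre_eval f x M : (forall s, legendre s f <= M) ->
  sqmod (f x) <= (K x x + 1) * M.
Proof.
have Kx : 0 <= K x x.
  have := kip_ge0 [:: (1, x)]; rewrite /kip !big_seq1 /= /rdotc /=.
  by rewrite mulr1 mulr0 addr0 mul1r.
have k0 : 0 < K x x + 1 by rewrite ltr_wpDl.
move=> /(_ [:: ((K x x + 1)^-1%:C * f x, x)]).
rewrite /legendre /pair /kip !big_seq1 /=.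
have -> : rdotc ((K x x + 1)^-1%:C * f x) (f x) = (K x x + 1)^-1 * sqmod (f x).
  by case: (f x) => a b; rewrite /rdotc /sqmod /=; ring.
have -> : rdotc ((K x x + 1)^-1%:C * f x) ((K x x + 1)^-1%:C * f x) =
    (K x x + 1)^-1 ^+ 2 * sqmod (f x).
  by case: (f x) => a b; rewrite /rdotc /sqmod /=; ring.
set k := K x x + 1 in k0 *; set z := sqmod (f x).
have z0 : 0 <= z by rewrite -lee_fin sqmod_ge0.
have -> : K x x = k - 1 by rewrite /k addrK.
have -> : (k^-1 * z) *+ 2 - k^-1 ^+ 2 * z * (k - 1) = z * (k^-1 + k^-1 ^+ 2).
  by field; rewrite gt_eqF.
move=> h; rewrite mulrC -ler_pdivrMr //; apply: le_trans h.
by rewrite ler_wpM2l // lerDl sqr_ge0.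
Qed.

Lemma rk_eval (f : rk) x : sqmod (val f x) <= (K x x + 1) * rksqn f.
Proof. by apply: legendre_eval => s; exact: legendre_le. Qed.

Fact rksqn_eq0 (f : rk) : rksqn f = 0 -> f = 0.
Proof.
move=> f0; apply: val_inj; apply/funext => x; apply: sqmod_eq0.
by have := rk_eval f x; rewrite f0 mulr0.
Qed.

Fact rksqnZ (c : C) (f : rk) : rksqn (c *: f) = sqmod c * rksqn f.
Proof.
have n0 (d : C) : 0 <= sqmod d by rewrite -lee_fin sqmod_ge0.
have le d (g : rk) : d != 0 -> rksqn (d *: g) <= sqmod d * rksqn g.
  move=> d0; apply/rksqn_leP => s.
  by rewrite [leLHS]legendreZ // ler_wpM2l ?legendre_le.
have [->|c0] := eqVneq c 0.
  rewrite scale0r [sqmod 0]/sqmod /= expr0n addr0 mul0r; apply/eqP.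
  by rewrite eq_le rksqn_ge0 andbT; apply/rksqn_leP => s; exact: legendre0.
apply/eqP; rewrite eq_le le //=.
have := le c^-1 (c *: f) (invr_neq0 c0); rewrite scalerA mulVf // scale1r => h.
have : sqmod c * rksqn f <= sqmod c * (sqmod c^-1 * rksqn (c *: f)).
  by rewrite ler_wpM2l.
rewrite mulrA -sqmodM mulfV //.
by rewrite [sqmod 1]/sqmod /= expr0n expr1n addr0 mul1r.
Qed.

Fact rk_parallelogram (f g : rk) :
  rksqn (f + g) + rksqn (f - g) = (rksqn f + rksqn g) *+ 2.
Proof.
have le (h k : rk) : rksqn (h + k) + rksqn (h - k) <= (rksqn h + rksqn k) *+ 2.
  rewrite -lerBrDr; apply/rksqn_leP => s; rewrite lerBrDl -lerBrDr.
  apply/rksqn_leP => t; rewrite lerBrDr addrC.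
  rewrite [leLHS]legendreD lerMn2r /= lerD ?legendre_le //.
apply/eqP; rewrite eq_le le /=.
have := le (f + g) (f - g).
have -> : f + g + (f - g) = 2%:C *: f.
  by rewrite addrACA subrr addr0 -mulr2n -scaler_nat rmorph_nat.
have -> : f + g - (f - g) = 2%:C *: g.
  by rewrite opprB addrC addrA subrK -mulr2n -scaler_nat rmorph_nat.
by rewrite !rksqnZ sqmodR; lra.
Qed.

Fact rk_complete (u : nat -> rk) :
  (forall e : R, 0 < e -> exists n0 : nat, forall n m,
     (n0 <= n)%N -> (n0 <= m)%N -> rksqn (u n - u m) < e) ->
  exists l, forall e : R, 0 < e -> exists n0 : nat, forall n,
     (n0 <= n)%N -> rksqn (u n - l) < e.
Proof.
move=> uc.
have [|||l lP] := @pointwise_complete R X (seq (C * X)) legendre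
  _ _ (fun n => val (u n)).
- move=> s v l vl; rewrite /legendre /pair; apply: cvgB; last exact: cvg_cst.
  rewrite -mulr_natr; under eq_fun do rewrite -mulr_natr.
  apply: cvgM; last exact: cvg_cst; apply: cvg_sumr => p.
  have [v1 v2] := vl p.2.
  by apply: cvgD; apply: cvgM => //; exact: cvg_cst.
- move=> x; exists (K x x + 1) => [|f M]; last exact: legendre_eval.
  have := kip_ge0 [:: (1, x)]; rewrite /kip !big_seq1 /= /rdotc /=.
  by rewrite mulr1 mulr0 addr0 mul1r; lra.
- move=> e e0; have [n0 n0P] := uc e e0; exists n0 => n m nn nm s.
  by apply: (iffLR (rksqn_leP (u n - u m) e)); exact/ltW/n0P.
have [n1 n1P] := lP 1 ltr01.
have dl : (fun x => val (u n1) x - l x) \in rk_pred.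
  by apply/asboolP; exists 1; exact: n1P.
pose d : rk := exist (fun h => h \in rk_pred) _ dl.
have vl : val (u n1 - d) = l by apply/funext => x /=; rewrite subKr.
exists (u n1 - d) => e e0.
have [|n0 n0P] := lP (e / 2); first by rewrite divr_gt0.
exists n0 => n nn; apply: (@le_lt_trans _ _ (e / 2)); last first.
  by rewrite ltr_pdivrMr // ltr_pMr // ltr1n.
apply/rksqn_leP => s; have := n0P n nn s.
by rewrite -vl; exact.
Qed.

HB.instance Definition _ := isHilbert.Build R rk rksqn_ge0 rksqn_eq0 rksqnZ
  rk_parallelogram rk_complete.

Definition kel_fun t : X -> C := fun x => \sum_(p <- t) p.1 * (K x p.2)%:C.

Lemma pair_kel s t : pair (kel_fun t) s = kip s t.
Proof.
rewrite /pair /kip; apply: eq_bigr => p _.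
rewrite /kel_fun; elim: t => [|q t IH].
  by rewrite !big_nil /rdotc /= !mulr0 addr0.
rewrite !big_cons -IH; move: (\sum_(_ <- t) _) => z.
by case: (p.1) (q.1) z => [a b] [c d] [v w]; rewrite /rdotc /=; ring.
Qed.

Lemma kip_sub s t : kip (s ++ cscale (-1) t) (s ++ cscale (-1) t) =
  kip s s - kip s t *+ 2 + kip t t.
Proof.
rewrite !kip_catl !kip_catr (kipC s (cscale _ _)) !kip_opp.
by rewrite (kipC t (cscale _ _)) kip_opp (kipC t s); ring.
Qed.

Lemma legendre_kel s t : legendre s (kel_fun t) <= kip t t.
Proof.
have := kip_ge0 (s ++ cscale (-1) t); rewrite kip_sub /legendre pair_kel; lra.
Qed.

Fact kel_subproof t : kel_fun t \in rk_pred.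
Proof. by apply/asboolP; exists (kip t t); move=> s; exact: legendre_kel. Qed.

Definition kel t : rk := exist (fun h => h \in rk_pred) _ (kel_subproof t).

Lemma sqn_kel t : sqn (kel t) = kip t t.
Proof.
apply/eqP; rewrite eq_le; apply/andP; split.
  by apply/rksqn_leP => s; exact: legendre_kel.
apply: le_trans (legendre_le (kel t) t); rewrite /legendre pair_kel; lra.
Qed.

(** If t almost attains the supremum, then f is close to the combination t:
    the quantity for f - kel t and s is that for f and s ++ t, minus that for f
    and t. *)
Lemma rk_dense (f : rk) e : 0 < e -> exists t, sqn (f - kel t) < e.
Proof.
move=> e0; have [_ [t _ <-] tP] := sup_adherent e0 (rk_sup f).
exists t; apply: (@le_lt_trans _ _ (rksqn f - legendre t (val f))); last first.
  by rewrite -/(rksqn f) in tP; lra.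
apply/rksqn_leP => s.
have -> : legendre s (val (f - kel t)) =
    legendre (s ++ t) (val f) - legendre t (val f).
  rewrite /legendre pair_cat !kip_catl !kip_catr (kipC t s).
  have -> : pair (val (f - kel t)) s = pair (val f) s - pair (kel_fun t) s.
    rewrite /pair -sumrB; apply: eq_bigr => p _.
    have -> : val (f - kel t) p.2 = val f p.2 - kel_fun t p.2 by [].
    by rewrite /rdotc !raddfB /= ; ring.
  by rewrite pair_kel; ring.
by rewrite lerD2r legendre_le.
Qed.

End ReproducingKernel.

(** * Relative property (T) through kernels *)

Section RelativeTKernel.
Variables (R : realType) (G : groupType) (A : set G).

(** An invariant vector of the kernel space is a function that is constant on
    the A-orbits, while decay of the kernel along A forces the functions of the
    space to be small somewhere on each orbit. *)
Lemma relative_T_kernel (X : choiceType) (K : pdkernel R X) (act : G -> X -> X) :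
  is_subgroup A -> relative_T R A ->
  (forall x, act 1%g x = x) -> (forall g h x, act (g * h)%g x = act g (act h x)) ->
  (forall g x y, K (act g x) (act g y) = K x y) ->
  (forall (F : set G) (e : R), finite_set F -> 0 < e ->
     exists x, K x x = 1 /\ forall g, F g -> 1 - K (act g x) x < e) ->
  exists (x : X) (s : seq X) (d : R), 0 < d /\
    forall a, A a -> exists2 y, y \in s & d <= `|K (act a x) y|.
Proof.
move=> [A1 AM AV] T act1 actM Kact ai.
have actK g x : act g (act g^-1%g x) = x by rewrite -actM mulgV act1.
have actKV g x : act g^-1%g (act g x) = x by rewrite -actM mulVg act1.
pose shift g (s : seq (R[i] * X)) := [seq (p.1, act g p.2) | p <- s].
have legs g f s : legendre K s (fun x => f (act g x)) = legendre K (shift g s) f.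
  rewrite /legendre /pair /kip !big_map; congr (_ - _).
  apply: eq_bigr => p _; rewrite big_map; apply: eq_bigr => q _.
  by rewrite Kact.
have pi_sub g (f : rk K) : (fun x => val f (act g^-1%g x)) \in rk_pred K.
  by apply/asboolP; exists (rksqn f) => s; rewrite legs; exact: legendre_le.
pose pi g (f : rk K) : rk K := exist (fun h => h \in rk_pred K) _ (pi_sub g f).
have piE g f x : val (pi g f) x = val f (act g^-1%g x) by [].
have pi_le g f : rksqn (pi g f) <= rksqn f.
  by apply/rksqn_leP => s; rewrite [leLHS]legs; exact: legendre_le.
have pi1 f : pi 1%g f = f.
  by apply: val_inj; apply/funext => x; rewrite piE invg1 act1.
have piM g h f : pi (g * h)%g f = pi g (pi h f).
  by apply: val_inj; apply/funext => x; rewrite !piE invgM actM.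
have pin g f : sqn (pi g f) = sqn f.
  apply/eqP; rewrite eq_le pi_le /=.
  by have := pi_le g^-1%g (pi g f); rewrite -piM mulVg pi1.
have [|||||xi [xi0 xiA]] := @relative_T_hilbert R G A (rk K) pi T.
- by move=> g c f h; apply: val_inj.
- by [].
- by [].
- by [].
- move=> F e Ff e0; have [|x [Kx xP]] := ai F (e / 2) Ff; first by rewrite divr_gt0.
  exists (kel K [:: (1, x)]); split.
    by rewrite sqn_kel /kip !big_seq1 /= Kx /rdotc /= !mulr0 !mulr1 addr0.
  move=> g Fg; have := xP g Fg.
  have -> : pi g (kel K [:: (1, x)]) = kel K [:: (1, act g x)].
    apply: val_inj; apply/funext => y; rewrite piE /= /kel_fun !big_seq1 /=.
    by rewrite -(Kact g) actK.
  have -> : kel K [:: (1, act g x)] - kel K [:: (1, x)] =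
      kel K [:: (1, act g x); (-1, x)].
    apply: val_inj; apply/funext => y.
    rewrite -[RHS]/(kel_fun K _ y) -[LHS]/(kel_fun K _ y - kel_fun K _ y).
    by rewrite /kel_fun !big_cons !big_nil /= !addr0 !mul1r mulN1r.
  rewrite sqn_kel /kip !big_cons !big_nil /= Kact Kx ((kfun_pd K).1 x).
  by rewrite /rdotc /=; lra.
have [x xix] : exists x, val xi x != 0.
  apply: contrapT => h; move/eqP: xi0; apply; apply: val_inj; apply/funext => x.
  by apply/eqP; apply: contrapT => /negP hx; apply: h; exists x.
have xi_orb a : A a -> val xi (act a x) = val xi x.
  by move=> Aa; rewrite -{1}(xiA a Aa) piE actKV.
have z0 : 0 < sqmod (val xi x).
  rewrite lt_def -lee_fin sqmod_ge0 andbT; apply: contra xix => /eqP h.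
  by rewrite (@sqmod_eq0 _ (val xi x)) // h.
set z := sqmod _ in z0.
have Kx0 : 0 <= K x x.
  have := kip_ge0 K [:: (1, x)]; rewrite /kip !big_seq1 /= /rdotc /=.
  by rewrite mulr1 mulr0 addr0 mul1r.
have k0 : 0 < K x x + 1 by rewrite ltr_wpDl.
have [|t tP] := rk_dense xi (e := z / 8 / (K x x + 1)); first by rewrite !divr_gt0.
have kel_big a : A a -> z / 4 <= sqmod (kel_fun K t (act a x)).
  move=> Aa; have := rk_eval (xi - kel K t) (act a x).
  have -> : val (xi - kel K t) (act a x) = val xi x - kel_fun K t (act a x).
    by rewrite -(xi_orb a Aa).
  rewrite Kact; move: tP; rewrite ltr_pdivlMr // mulrC => h1 h2.
  have := le_lt_trans h2 h1; rewrite /z.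
  case: (val xi x) (kel_fun K t (act a x)) => [b c] [d e]; rewrite /sqmod /=.
  have := sqr_ge0 (b - 2 * d); have := sqr_ge0 (c - 2 * e).
  by have := sqr_ge0 b; have := sqr_ge0 c; move=> ? ? ? ? ?; lra.
have small (s : seq (R[i] * X)) : forall e : R, 0 < e -> exists2 d : R, 0 < d &
    forall y, (forall p, p \in s -> `|K y p.2| < d) -> sqmod (kel_fun K s y) < e.
  elim: s => [|p s IH] e e0.
    by exists 1 => // y _; rewrite /kel_fun big_nil /sqmod /= expr0n addr0.
  have [|d d0 dP] := IH (e / 4); first by rewrite divr_gt0.
  have p0 : 0 <= sqmod p.1 by rewrite -lee_fin sqmod_ge0.
  pose d1 : R := Num.min 1 (e / 4 / (sqmod p.1 + 1)).
  have d10 : 0 < d1 by rewrite lt_min ltr01 !divr_gt0 // ltr_wpDl.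
  exists (Num.min d d1); first by rewrite lt_min d0.
  move=> y yP; rewrite /kel_fun big_cons -/(kel_fun K s y).
  have h1 : sqmod (kel_fun K s y) < e / 4.
    by apply: dP => q qs; have := yP q; rewrite inE qs orbT lt_min => /(_ isT)/andP[].
  have := yP p; rewrite inE eqxx !lt_min => /(_ isT)/and3P[_ q1 q2].
  have h2 : sqmod (p.1 * (K y p.2)%:C) < e / 4.
    rewrite sqmodM sqmodR -[K y p.2 ^+ 2]real_normK ?num_real //.
    rewrite ltr_pdivlMr ?ltr_wpDl // in q2.
    have := normr_ge0 (K y p.2); move: (`|K y p.2|) q1 q2 => k q1 q2 kk0.
    apply: le_lt_trans q2; rewrite expr2 mulrC -mulrA ler_wpM2l //.
    by have := ler_piMr p0 (ltW q1); rewrite mulrC; lra.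
  move: h1 h2; case: (kel_fun K s y) (p.1 * _) => [b c] [v w]; rewrite /sqmod /=.
  have := sqr_ge0 (b - v); have := sqr_ge0 (c - w); move=> ? ? ? ?; lra.
have [|d d0 dP] := small t (z / 4); first by rewrite divr_gt0.
exists x, [seq p.2 | p <- t], d; split=> // a Aa.
apply: contrapT => h; have := kel_big a Aa; rewrite leNgt => /negP; apply.
apply: dP => p pt; rewrite ltNge; apply/negP => hp.
by apply: h; exists p.2 => //; apply/mapP; exists p.
Qed.

End RelativeTKernel.

(** * Cocycles are bounded on a conjugate of A *)

Section RelativeTCocycle.
Variables (R : realType) (G : groupType).
Local Notation l2 := (l2 R G).

Definition cocycle_on (Gam : set G) (b : G -> l2) :=
  forall g h, Gam g -> Gam h -> b (g * h)%g = b g + ltr g (b h).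

Definition conj_part (A Gam : set G) (x : G) : set G :=
  [set h | Gam h /\ A (x * h * x^-1)%g].

Lemma cocycle1 Gam b : is_subgroup Gam -> cocycle_on Gam b -> b 1%g = 0.
Proof.
move=> [G1 _ _] bc; have := bc _ _ G1 G1; rewrite mulg1 => /eqP.
rewrite addrC -subr_eq subrr => /eqP e; apply: sqn_eq0.
by rewrite -(sqn_ltr 1%g) -e sqn0.
Qed.

Section CocycleKernel.
Variables (I : choiceType) (Gam : I -> set G) (b : I -> G -> l2) (c : I -> R).
Hypotheses (Gs : forall i, is_subgroup (Gam i)) (bc : forall i, cocycle_on (Gam i) (b i)).
Hypothesis c0 : forall i, 0 <= c i.

(** The kernels 1 / (1 + c |b(x^-1 y)|^2) of the cocycles, extended by 0 outside
    the subgroups, live on disjoint copies of G and are invariant under G. *)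
Definition cocycle_kernel (p q : I * G) : R :=
  if (p.1 == q.1) && `[< Gam p.1 (p.2^-1 * q.2)%g >]
  then (1 + c p.1 * sqn (b p.1 (p.2^-1 * q.2)%g))^-1 else 0.

(** A representative of the left coset of p, on which the kernel becomes that
    of the distance between values of the cocycle. *)
Let rep (p : I * G) : G := xget 1%g [set r | Gam p.1 (r^-1 * p.2)%g].

Let rep_in p : Gam p.1 ((rep p)^-1 * p.2)%g.
Proof.
have [G1 _ _] := Gs p.1.
apply: (@xgetPex _ 1%g [set r | Gam p.1 (r^-1 * p.2)%g]).
by exists p.2; rewrite /= mulVg.
Qed.

Let rep_eq i x y : (rep (i, x) == rep (i, y)) = `[< Gam i (x^-1 * y)%g >].
Proof.
have [G1 GM GV] := Gs i.
apply/eqP/asboolP => [e|xy].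
  have := rep_in (i, x); have := rep_in (i, y); rewrite /= -e => h1 /GV h2.
  by have := GM _ _ h2 h1; rewrite invgM invgK -mulgA mulVKg.
rewrite /rep /=; congr xget; apply/seteqP; split=> r /= h.
  by have := GM _ _ h xy; rewrite -mulgA mulVKg.
by have := GM _ _ h (GV _ xy); rewrite invgM invgK -mulgA mulVKg.
Qed.

Lemma cocycle_kernel_pd : pos_def cocycle_kernel.
Proof.
pose v p := (Num.sqrt (c p.1))%:C *: b p.1 ((rep p)^-1 * p.2)%g.
have -> : cocycle_kernel = fun p q =>
    ((p.1, rep p) == (q.1, rep q))%:R * (1 + sqn (v p - v q))^-1.
  apply/funext => -[i x]; apply/funext => -[j y].
  rewrite /cocycle_kernel xpair_eqE /=; case: (eqVneq i j) => [<-|] /=; last by rewrite mul0r.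
  rewrite rep_eq; case: asboolP => xy; last by rewrite mul0r.
  rewrite mul1r; congr (_ + _)^-1.
  have e : rep (i, x) = rep (i, y) by apply/eqP; rewrite rep_eq; apply/asboolP.
  rewrite /v /= -scalerBr sqnZ sqmodR sqr_sqrtr //; congr (_ * _).
  rewrite -e; set r := rep (i, x).
  have rx : Gam i (r^-1 * x)%g := rep_in (i, x).
  have -> : (r^-1 * y = (r^-1 * x) * (x^-1 * y))%g by rewrite -mulgA mulVKg.
  by rewrite (bc rx xy) opprD addrA subrr sub0r sqnN sqn_ltr.
exact: (pos_def_label (fun p => (p.1, rep p)) (pos_def_cauchy v)).
Qed.
End CocycleKernel.

(** Suppose that for every finite F some cocycle on a subgroup containing F is a
    counterexample.  With a small factor c, its kernel is close to 1 on F, so the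
    space of all these kernels has almost invariant vectors, hence a nonzero
    A-invariant vector.  The kernel of one of the cocycles then stays away from
    0 along an A-orbit, up to finitely many translations: a conjugate of A is
    covered by finitely many translates of the set where this cocycle takes small
    values, which is a contradiction.  Taking all F at once in one space is what
    makes the final F independent of the cocycle. *)
Lemma relative_T_cocycle (A : set G) :
  is_subgroup A -> relative_T R A -> infinite_set A ->
  exists F : seq G, forall (Gam : set G) (b : G -> l2),
    is_subgroup Gam -> (forall x, x \in F -> Gam x) -> cocycle_on Gam b ->
    exists x, [/\ infinite_set (conj_part A Gam x),
      exists M : R, forall h, conj_part A Gam x h -> sqn (b h) <= M &
      exists hs : seq G, forall a, A (x * a * x^-1)%g ->
        exists2 h, h \in hs & conj_part A Gam x (a * h)%g].
Proof.
move=> As T Ainf; apply: contrapT => no.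
have /choice[D DP] (F : seq G) : exists D : set G * (G -> l2),
    [/\ is_subgroup D.1, forall x, x \in F -> D.1 x, cocycle_on D.1 D.2 &
     ~ exists x, [/\ infinite_set (conj_part A D.1 x),
      exists M : R, forall h, conj_part A D.1 x h -> sqn (D.2 h) <= M &
      exists hs : seq G, forall a, A (x * a * x^-1)%g ->
        exists2 h, h \in hs & conj_part A D.1 x (a * h)%g]].
  apply: contrapT => h; apply: no; exists F => Gam b Gs FG bc.
  by apply: contrapT => h'; apply: h; exists (Gam, b).
pose I : choiceType := (seq G * nat)%type.
pose Gam (i : I) := (D i.1).1; pose b (i : I) := (D i.1).2.
pose c (i : I) : R := (i.2.+1%:R)^-1.
have Gs i : is_subgroup (Gam i) by case: (DP i.1).
have bc i : cocycle_on (Gam i) (b i) by case: (DP i.1).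
have c0 i : 0 < c i by rewrite invr_gt0 ltr0n.
have Kpd := cocycle_kernel_pd Gs bc (fun i => ltW (c0 i)).
pose K := PDKernel Kpd.
have [||||||[i x] [s [d [d0 dP]]]] := @relative_T_kernel R G A
  (I * G)%type K (fun g p => (p.1, (g * p.2)%g)).
- exact: As.
- exact: T.
- by move=> [i x]; rewrite /= mul1g.
- by move=> g h [i x]; rewrite /= mulgA.
- by move=> g [i x] [j y]; rewrite /= /cocycle_kernel /= invgM -mulgA mulKg.
- move=> F e /finite_seqP[s ->] e0.
  pose M := \sum_(g <- s) sqn (b (s, 0%N) g^-1%g).
  have M0 : 0 <= M by apply: sumr_ge0 => g _; exact: sqn_ge0.
  pose k := Num.bound (M / e); exists ((s, k), 1%g).
  have [G1 GM GV] := Gs (s, k).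
  split; first rewrite /= /cocycle_kernel /= eqxx mulVg.
    case: asboolP => // _.
    by rewrite (cocycle1 (Gs (s, k)) (bc (s, k))) sqn0 mulr0 addr0 invr1.
  move=> g /= gs; rewrite /cocycle_kernel /= eqxx !mulg1.
  have Gg : Gam (s, k) g^-1%g by apply: GV; case: (DP s) => _ h _ _; exact: h.
  case: asboolP => // _.
  set q := sqn _; have q0 : 0 <= q by exact: sqn_ge0.
  have qM : q <= M.
    by rewrite /M (big_rem g) //= lerDl sumr_ge0 // => ? _; exact: sqn_ge0.
  have cq : c (s, k) * q < e.
    rewrite /c /= mulrC ltr_pdivrMr ?ltr0n // mulrC -ltr_pdivrMr //.
    apply: (@le_lt_trans _ _ (M / e)); first by rewrite ler_pM2r ?invr_gt0.
    apply: (lt_le_trans (archi_boundP _)); first by rewrite divr_ge0 // ltW.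
    by rewrite ler_nat leqnSn.
  have cq0 : 0 <= c (s, k) * q by rewrite mulr_ge0 // ltW.
  move: (c (s, k) * q) cq cq0 => z ze z0.
  have z1 : 0 < 1 + z by rewrite ltr_wpDr.
  have -> : 1 - (1 + z)^-1 = z / (1 + z) by field; rewrite gt_eqF.
  by rewrite ltr_pdivrMr // mulrDr mulr1 (lt_le_trans ze) // lerDl mulr_ge0 // ltW.
have [A1 AM AV] := As; have [G1 GM GV] := Gs i.
have [_ _ _] := DP i.1; apply; exists x; rewrite -/(Gam i) -/(b i).
pose M0 := (d * c i)^-1.
pose ws := [seq (x^-1 * p.2)%g | p <- s].
have near a : A (x * a * x^-1)%g -> exists2 w, w \in ws &
    Gam i (a * w)%g /\ sqn (b i (a * w)%g) <= M0.
  move=> Aa; have [[j y] ys] := dP _ (AV _ Aa).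
  rewrite /= /cocycle_kernel /=.
  have -> : (((x * a * x^-1)^-1 * x)^-1 * y = a * (x^-1 * y))%g.
    by rewrite !invgM !invgK !mulgA mulVg mul1g.
  case: eqP => [_|_] /=; last by rewrite normr0 leNgt d0.
  case: asboolP => [Gaw|_]; last by rewrite normr0 leNgt d0.
  move=> dle; exists (x^-1 * y)%g; first by apply/mapP; exists (j, y).
  split=> //; set q := sqn _ in dle *; have q0 : 0 <= q by exact: sqn_ge0.
  have cq0 : 0 <= c i * q by rewrite mulr_ge0 // ltW.
  have z1 : 0 < 1 + c i * q by rewrite ltr_wpDr.
  have zi : 0 <= (1 + c i * q)^-1 by rewrite invr_ge0 (ltW z1).
  rewrite (ger0_norm zi) in dle.
  have : d * (1 + c i * q) <= 1 by rewrite -ler_pdivlMr // mul1r.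
  rewrite /M0 -[_^-1]mul1r ler_pdivlMr ?mulr_gt0 // mulrCA; nra.
have cover : exists hs : seq G, forall a, A (x * a * x^-1)%g ->
    exists2 h, h \in hs & conj_part A (Gam i) x (a * h)%g.
  have /choice[f fP] (w : G) : exists a0, (exists2 a, A (x * a * x^-1)%g & Gam i (a * w)%g) ->
      A (x * a0 * x^-1)%g /\ Gam i (a0 * w)%g.
    have [[a Aa aw]|h] := pselect (exists2 a, A (x * a * x^-1)%g & Gam i (a * w)%g).
      by exists a.
    by exists 1%g.
  exists [seq (f w)^-1%g | w <- ws] => a Aa; have [w ww [aw _]] := near a Aa.
  have [Af fw] : A (x * f w * x^-1)%g /\ Gam i (f w * w)%g by apply: fP; exists a.
  exists (f w)^-1%g; first by apply/mapP; exists w.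
  split.
    by have := GM _ _ aw (GV _ fw); rewrite invgM !mulgA mulgK.
  have := AM _ _ Aa (AV _ Af); rewrite !invgM invgK !mulgA mulgVK.
  exact.
split=> //.
- move=> Bfin; apply: Ainf; have [hs hsP] := cover.
  apply: (@sub_finite_set _ _ [set (x * (p.1 * p.2^-1) * x^-1)%g |
     p in conj_part A (Gam i) x `*` [set` hs]]).
    move=> a Aa; have [|h hh hB] := hsP (x^-1 * a * x)%g.
      by rewrite !mulgA mulgK mulgV mul1g.
    exists ((x^-1 * a * x * h)%g, h) => //=.
    by rewrite mulgK !mulgA mulgK mulgV mul1g.
  by apply: finite_image; apply: finite_setX => //; exact: finite_seq.
- exists ((M0 + \sum_(w <- ws) sqn (b i w)) *+ 2) => h [Gh Ah].
  have [w ww [hw hwM]] := near h Ah.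
  have Gw : Gam i w by have := GM _ _ (GV _ Gh) hw; rewrite mulKg.
  have -> : b i h = b i (h * w)%g - ltr h (b i w) by rewrite bc // addrK.
  apply: le_trans (sqnD_le _ _) _; rewrite sqnN sqn_ltr lerMn2r /= lerD //.
  by rewrite (big_rem w) //= lerDl sumr_ge0 // => ? _; exact: sqn_ge0.
Qed.

End RelativeTCocycle.

(** * Weakly normal and weakly quasi-normal subgroups *)

Section WeaklyNormal.
Variable G : groupType.
Implicit Types A Lam : set G.

(** By induction, the whole chain stays inside Lam.  In the weakly normal case
    an element g of the next step normalizes the union of the previous steps, so
    that Lam and its conjugate by g both contain the infinite set g A g^-1. *)
Lemma absorbing_full A Lam : is_subgroup A -> infinite_set A -> is_subgroup Lam ->
  A `<=` Lam -> (forall g, infinite_set (Lam `&` conj_set g Lam) -> Lam g) ->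
  weakly_normal A \/ weakly_quasi_normal A -> forall g, Lam g.
Proof.
move=> As Ainf Ls AL Labs W.
have conj_inf g : infinite_set (conj_set g A).
  move=> fin; apply: Ainf; apply: sub_finite_set (finite_image (fun x => g^-1 * x * g)%g fin).
  by move=> a Aa; exists (g * a * g^-1)%g; [exists a | rewrite !mulgA mulVg mul1g mulgVK].
case: W => -[d [T [N]]].
  move=> [wf [Ns Nmono N0 N1] Nn] g; suff h t : N t `<=` Lam by apply: (h \top%O); rewrite N1.
  elim/(well_founded_ind wf): t => t IH.
  have [->|t0] := eqVneq t \bot%O; first by rewrite N0.
  have bt : (\bot < t)%O by rewrite lt0x.
  have [_ _ Unorm] := Nn t bt.
  have UL : \bigcup_(s in [set s | (s < t)%O]) N s `<=` Lam by move=> y [s st]; exact: IH.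
  move=> y Ny; apply: Labs => fin; apply: (conj_inf y).
  apply: sub_finite_set fin => _ [a Aa <-].
  have Ua : (\bigcup_(s in [set s | (s < t)%O]) N s) a by exists \bot%O; rewrite ?N0.
  by split; [exact/UL/Unorm | exists a => //; exact: AL].
move=> [wf [Ns Nmono N0 N1] Npred Nlim] g.
suff h t : N t `<=` Lam by apply: (h \top%O); rewrite N1.
elim/(well_founded_ind wf): t => t IH.
have [->|t0] := eqVneq t \bot%O; first by rewrite N0.
have bt : (\bot < t)%O by rewrite lt0x.
have [[s st]|nolim] := pselect (exists s, is_pred s t); last first.
  by rewrite (Nlim t) // => y [s lts]; exact: IH.
rewrite (Npred s t st) => y; apply; split=> // z zinf; apply: Labs => fin.
have NsL : N s `<=` Lam by apply: IH; case: st.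
apply: zinf; apply: sub_finite_set fin => w [Nw [v Nv zv]].
by split; [exact: NsL | exists v => //; exact: NsL].
Qed.

(** The chain starts at A, but Lam contains a conjugate of A only. *)
Lemma absorbing_full_conj A Lam x : is_subgroup A -> infinite_set A ->
  is_subgroup Lam -> (forall a, A (x * a * x^-1)%g -> Lam a) ->
  (forall g, infinite_set (Lam `&` conj_set g Lam) -> Lam g) ->
  weakly_normal A \/ weakly_quasi_normal A -> forall g, Lam g.
Proof.
move=> As Ainf [L1 LM LV] AL Labs W.
pose c g := (x^-1 * g * x)%g; pose Lx : set G := [set g | Lam (c g)].
have cM g h : c (g * h)%g = (c g * c h)%g by rewrite /c !mulgA mulgK.
have cV g : c g^-1%g = (c g)^-1%g by rewrite /c !invgM invgK mulgA.
have cK g : c (x * g * x^-1)%g = g by rewrite /c !mulgA mulVg mul1g mulgVK.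
have cxK g : (x * c g * x^-1 = g)%g by rewrite /c !mulgA mulgV mul1g mulgK.
have h : forall g, Lx g.
  apply: (@absorbing_full A) => //.
  - split=> [|g h|g]; rewrite /Lx /= ?cM ?cV; [by rewrite /c mulg1 mulVg|exact: LM|exact: LV].
  - by move=> a Aa; apply: AL; rewrite -/(c a) cxK.
  - move=> g ginf; apply: Labs => fin; apply: ginf.
    apply: sub_finite_set (finite_image (fun y => x * y * x^-1)%g fin).
    move=> y [Ly [z Lz zy]]; exists (c y); last exact: cxK.
    by split=> //; exists (c z) => //; rewrite -zy !cM cV.
by move=> g; have := h (x * g * x^-1)%g; rewrite /Lx /= cK.
Qed.

End WeaklyNormal.

(** * Chains of the bar resolution *)

Section Chains.
Variables (R : realType) (G : groupType).
Local Notation N := (vN R G).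
Local Notation l2 := (l2 R G).
Implicit Types (a : N) (g h : G) (z w : G -> N^o).

Lemma fsum_seq (T : choiceType) (F : T -> N) (s : seq T) : uniq s ->
  (forall x, x \notin s -> F x = 0) -> \sum_(x \in [set: T]) F x = \sum_(x <- s) F x.
Proof.
move=> us F0; rewrite [RHS](fsbig_seq _ _ us); apply/esym.
apply: (@fsbig_widen _ _ _ _ [set` s] [set: T]) => // x [_ /= xs].
by apply: F0; apply/negP.
Qed.

(** The elementary chains a [g] and a [g | h]. *)
Definition chain1 a g : G -> N^o := fun x => if x == g then a else 0.
Definition chain2 a (p : G * G) : G * G -> N^o := fun q => if q == p then a else 0.

Lemma vN_ltrM g h : vN_ltr R (g * h)%g = vN_ltr R g * vN_ltr R h.
Proof.
apply: vN_ext => f; apply: val_inj; apply/funext => x /=.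
by rewrite invgM !mulgA.
Qed.

Lemma vN_ltr1 : vN_ltr R (1%g : G) = 1.
Proof. by apply: vN_ext => f; apply: val_inj; apply/funext => x /=; rewrite invg1 mul1g. Qed.

Lemma chain1Z a b g : a *: chain1 b g = chain1 (a * b) g.
Proof. by apply/funext => x; rewrite fctE /chain1; case: eqP; rewrite ?scaler0. Qed.

Lemma chain1D a b g : chain1 (a + b) g = chain1 a g + chain1 b g.
Proof. by apply/funext => x; rewrite fctE /chain1; case: eqP; rewrite ?addr0. Qed.

Lemma finite_chainP (X : choiceType) (c : X -> N) : finite_chain c ->
  exists2 s : seq X, uniq s & forall x, x \notin s -> c x = 0.
Proof.
move=> /finite_seqP[s cs]; exists (undup s); first exact: undup_uniq.
move=> x; rewrite mem_undup => xs; apply/eqP; apply: contrapT => /negP cx.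
by move/negP: xs; apply; have : [set` s] x by rewrite -cs.
Qed.

Lemma chain_of_seq (X : choiceType) (c : X -> N) (s : seq X) :
  (forall x, x \notin s -> c x = 0) -> finite_chain c.
Proof.
move=> c0; apply: (@sub_finite_set _ _ [set` s]); last exact: finite_seq.
by move=> x /= cx; apply: contrapT => /negP/c0 h; move: cx; rewrite h eqxx.
Qed.

Lemma finite_chainD (X : choiceType) (c c' : X -> N) : finite_chain c ->
  finite_chain c' -> finite_chain (fun x => c x + c' x).
Proof.
move=> /finite_chainP[s _ cs] /finite_chainP[t _ ct].
apply: (@chain_of_seq _ _ (s ++ t)) => x; rewrite mem_cat negb_or => /andP[xs xt].
by rewrite cs // ct // addr0.
Qed.

Lemma finite_chainZ (X : choiceType) a (c : X -> N) : finite_chain c ->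
  finite_chain (fun x => a * c x).
Proof.
move=> /finite_chainP[s _ cs].
by apply: (@chain_of_seq _ _ s) => x xs; rewrite cs // mulr0.
Qed.

Lemma finite_chain1 a g : finite_chain (chain1 a g).
Proof. by apply: (@chain_of_seq _ _ [:: g]) => x; rewrite inE /chain1 => /negPf ->. Qed.

Lemma bdry1E (c : G -> N) (s : seq G) : uniq s -> (forall x, x \notin s -> c x = 0) ->
  bdry1 c = \sum_(g <- s) (c g * vN_ltr R g - c g).
Proof. by move=> us cs; apply: fsum_seq => // x /cs ->; rewrite mul0r subrr. Qed.

Lemma bdry1P a (c c' : G -> N) : finite_chain c -> finite_chain c' ->
  bdry1 (fun x => a * c x + c' x) = a * bdry1 c + bdry1 c'.
Proof.
move=> /finite_chainP[s _ cs] /finite_chainP[t _ ct].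
pose u := undup (s ++ t).
have us x : x \notin u -> x \notin s by rewrite mem_undup mem_cat negb_or => /andP[].
have ut x : x \notin u -> x \notin t by rewrite mem_undup mem_cat negb_or => /andP[].
have uu : uniq u := undup_uniq _.
rewrite (@bdry1E _ u) //; last by move=> x xu; rewrite cs ?ct ?mulr0 ?addr0 ?us ?ut.
rewrite (@bdry1E c u) //; last by move=> x /us/cs.
rewrite (@bdry1E c' u) //; last by move=> x /ut/ct.
rewrite mulr_sumr -big_split; apply: eq_bigr => g _ /=.
by rewrite mulrDl mulrBr opprD mulrA addrACA.
Qed.

Lemma bdry1_chain1 a g : bdry1 (chain1 a g) = a * vN_ltr R g - a.
Proof.
rewrite (@bdry1E _ [:: g]) // => [|x]; first by rewrite big_seq1 /chain1 eqxx.
by rewrite inE /chain1 => /negPf ->.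
Qed.

Lemma bdry2E (c : G * G -> N) (s : seq (G * G)) (x : G) :
  (forall p, p \notin s -> c p = 0) ->
  bdry2 c x = \sum_(g <- undup (unzip1 s)) c (g, x) * vN_ltr R g
    - \sum_(g <- undup (unzip1 s)) c (g, (g^-1 * x)%g)
    + \sum_(h <- undup (unzip2 s)) c (x, h).
Proof.
move=> cs; rewrite /bdry2; congr (_ - _ + _); apply: fsum_seq;
  rewrite ?undup_uniq // => y; rewrite mem_undup => ys.
- by rewrite cs ?mul0r //; apply: contra ys => ys; apply/mapP; exists (y, x).
- by rewrite cs //; apply: contra ys => ys; apply/mapP; exists (y, (y^-1 * x)%g).
- by rewrite cs //; apply: contra ys => ys; apply/mapP; exists (x, y).
Qed.

Lemma bdry2P a (c c' : G * G -> N) : finite_chain c -> finite_chain c' ->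
  bdry2 (fun p => a * c p + c' p) = (fun x => a * bdry2 c x + bdry2 c' x).
Proof.
move=> /finite_chainP[s _ cs] /finite_chainP[t _ ct]; apply/funext => x.
pose u := s ++ t.
have us p : p \notin u -> p \notin s by rewrite mem_cat negb_or => /andP[].
have ut p : p \notin u -> p \notin t by rewrite mem_cat negb_or => /andP[].
rewrite (@bdry2E _ u) //; last by move=> p pu; rewrite cs ?ct ?mulr0 ?addr0 ?us ?ut.
rewrite (@bdry2E c u) //; last by move=> p /us/cs.
rewrite (@bdry2E c' u) //; last by move=> p /ut/ct.
under eq_bigr do rewrite mulrDl -mulrA.
rewrite !big_split /= -!mulr_sumr mulrDr mulrBr !opprD.
have acc (V : zmodType) (A B C D E F : V) :
    A + B + (- C - D) + (E + F) = (A - C + E) + (B - D + F).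
  by rewrite (addrACA A B) (addrACA (A - C)).
exact: acc.
Qed.

(** The boundary of a [g | h]. *)
Definition relator a g h : G -> N^o :=
  chain1 (a * vN_ltr R g) h - chain1 a (g * h)%g + chain1 a g.

Lemma bdry2_chain2 a g h : bdry2 (chain2 a (g, h)) = relator a g h.
Proof.
apply/funext => x; rewrite (@bdry2E _ [:: (g, h)]); last first.
  by move=> p; rewrite inE /chain2 => /negPf ->.
rewrite /= !big_seq1 /relator !fctE /chain2 /chain1 !xpair_eqE !eqxx /= andbT.
have -> : (g^-1 * x == h)%g = (x == g * h)%g.
  by apply/eqP/eqP => [<-|->]; rewrite ?mulVKg ?mulKg.
by case: (x == h); rewrite ?mul0r.
Qed.

Lemma boundaries_submod a z w : boundaries1 z -> boundaries1 w ->
  boundaries1 (a *: z + w).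
Proof.
move=> [c cf ->] [c' cf' ->].
exists (fun p => a * c p + c' p); last by rewrite bdry2P.
by apply: finite_chainD => //; exact: finite_chainZ.
Qed.

Lemma boundariesB z w : boundaries1 z -> boundaries1 w -> boundaries1 (z - w).
Proof.
by move=> bz bw; rewrite addrC -scaleN1r; exact: boundaries_submod.
Qed.

Lemma boundaries0 : boundaries1 (0 : G -> N^o).
Proof.
have c0 : forall p : G * G, p \notin [::] -> (0 : N) = 0 by [].
exists (fun=> 0); first exact: chain_of_seq c0.
by apply/funext => x; rewrite (bdry2E x c0) !big_nil subrr addr0.
Qed.

Lemma relator_boundary a g h : boundaries1 (relator a g h).
Proof.
exists (chain2 a (g, h)); last by rewrite bdry2_chain2.
by apply: (@chain_of_seq _ _ [:: (g, h)]) => p; rewrite inE /chain2 => /negPf ->.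
Qed.

Lemma chain_ind (X : choiceType) (P : (X -> N) -> Prop) : P (fun=> 0) ->
  (forall c c', finite_chain c' -> P c -> P c' -> P (fun x => c x + c' x)) ->
  (forall a x, P (fun y => if y == x then a else 0)) ->
  forall c, finite_chain c -> P c.
Proof.
move=> P0 PD P1 c /finite_chainP[s us cs].
have -> : c = fun y => \sum_(x <- s) (if y == x then c x else 0).
  apply/funext => y; have [ys|/[dup] ys /cs ->] := boolP (y \in s).
    rewrite (bigD1_seq y) //= eqxx big1 ?addr0 // => x.
    by rewrite eq_sym => /negPf ->.
  rewrite big_seq big1 // => x xs; case: eqP => // yx.
  by move: ys; rewrite yx xs.
elim: s {us cs} => [|x s IH]; first by under eq_fun do rewrite big_nil.
under eq_fun do rewrite big_cons; apply: PD => //.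
apply: (@chain_of_seq _ _ s) => y ys; rewrite big_seq big1 // => z zs.
by case: eqP => // yz; move: ys; rewrite yz zs.
Qed.

Lemma bdry1_relator a g h : bdry1 (relator a g h) = 0.
Proof.
have -> : relator a g h = (fun x => 1 * (- 1 * chain1 a (g * h)%g x + chain1 a g x) +
    chain1 (a * vN_ltr R g) h x).
  apply/funext => x; rewrite /relator !fctE mul1r mulN1r.
  by rewrite -addrA addrC.
rewrite bdry1P; last exact: finite_chain1.
  rewrite bdry1P; try exact: finite_chain1.
  rewrite !bdry1_chain1 vN_ltrM mulN1r mul1r mulrA.
  move: (a * vN_ltr R g) => b; move: (b * vN_ltr R h) => c.
  by rewrite opprB (addrC (a - c)) subrKA subrKA subrr.
apply: finite_chainD; last exact: finite_chain1.
by apply: finite_chainZ; exact: finite_chain1.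
Qed.

Lemma finite_relator a g h : finite_chain (relator a g h).
Proof.
apply: (@chain_of_seq _ _ [:: h; (g * h)%g; g]) => x; rewrite !inE !negb_or.
by move=> /and3P[/negPf xh /negPf xgh /negPf xg];
  rewrite /relator !fctE /chain1 xh xgh xg subrr addr0.
Qed.

Lemma bdry1_boundary z : boundaries1 z -> finite_chain z /\ bdry1 z = 0.
Proof.
move=> [c cf ->].
pose P (c : G * G -> N) := [/\ finite_chain c, finite_chain (bdry2 c) & bdry1 (bdry2 c) = 0].
suff : P c by case.
apply: chain_ind cf => {c} [|c c' _ [cf df d0] [cf' df' d0']|a [g h]].
- have c0 : forall p : G * G, p \notin [::] -> (0 : N) = 0 by [].
  have z0 : forall p : G, p \notin [::] -> (0 : N) = 0 by [].
  have b0 : bdry2 (fun=> 0 : N) = fun=> 0.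
    by apply/funext => x; rewrite (bdry2E x c0) !big_nil subrr addr0.
  rewrite /P b0; split; [exact: chain_of_seq c0 | exact: chain_of_seq z0 |].
  by rewrite (bdry1E _ z0) ?big_nil.
- have e : (fun x => c x + c' x) = (fun x => 1 * c x + c' x).
    by apply/funext => x; rewrite mul1r.
  rewrite /P e bdry2P //; split; rewrite ?bdry1P ?d0 ?d0' ?mulr0 ?addr0 //.
    by apply: finite_chainD; [exact: finite_chainZ | exact: cf'].
  by apply: finite_chainD; [exact: finite_chainZ | exact: df'].
- rewrite /P -/(chain2 a (g, h)) bdry2_chain2 bdry1_relator.
  split=> //; last exact: finite_relator.
  by apply: (@chain_of_seq _ _ [:: (g, h)]) => p; rewrite inE /chain2 => /negPf ->.
Qed.

End Chains.

(** * Cycles pair trivially with cocycles *)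

Section Submodules.
Variables (R : realType) (G : groupType).
Local Notation N := (vN R G).
Local Notation l2 := (l2 R G).
Local Notation chain := (G -> N^o).
Local Notation bdries := (@boundaries1 R G).
Implicit Types (S : set chain) (z w : chain) (g h : G).

Definition bsubmodule S := bdries `<=` S /\
  forall a z w, S z -> S w -> S (a *: z + w).

Section BSubmodule.
Variables (S : set chain) (Ss : bsubmodule S).

Lemma bsub0 : S 0. Proof. by apply: Ss.1; exact: boundaries0. Qed.
Lemma bsubD z w : S z -> S w -> S (z + w).
Proof. by move=> Sz Sw; rewrite -(scale1r z); exact: Ss.2. Qed.
Lemma bsubZ a z : S z -> S (a *: z).
Proof. by move=> Sz; rewrite -[_ *: _]addr0; apply: Ss.2 => //; exact: bsub0. Qed.
Lemma bsubB z w : S z -> S w -> S (z - w).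
Proof. by move=> Sz Sw; rewrite addrC -scaleN1r; exact: Ss.2. Qed.

Definition support_group : set G := [set g | S (chain1 1 g)].

Lemma chain1_mul g h : chain1 1 (g * h)%g =
  vN_ltr R g *: chain1 1 h + chain1 1 g - relator 1 g h :> chain.
Proof. by rewrite /relator chain1Z mul1r mulr1 opprD opprB addrACA subrr addr0 addrC subrK. Qed.

Lemma support_groupP : is_subgroup support_group.
Proof.
have S1 : S (chain1 1 1%g).
  have := Ss.1 _ (relator_boundary (1 : N) (1%g : G) 1%g).
  by rewrite /relator mulg1 vN_ltr1 mulr1 subrr add0r.
split=> // [g h Sg Sh|g Sg] /=; rewrite /support_group /=.
  rewrite chain1_mul; apply: bsubB; last exact/Ss.1/relator_boundary.
  by apply: bsubD => //; exact: bsubZ.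
have := Ss.1 _ (relator_boundary (vN_ltr R g^-1%g) g g^-1%g).
rewrite /relator -vN_ltrM mulVg mulgV vN_ltr1 => h.
have -> : chain1 1 g^-1%g = (chain1 1 g^-1%g - chain1 (vN_ltr R g^-1%g) 1%g +
    chain1 (vN_ltr R g^-1%g) g) +
    (vN_ltr R g^-1%g *: chain1 1 1%g - vN_ltr R g^-1%g *: chain1 1 g) :> chain.
  by rewrite !chain1Z !mulr1 addrACA addrNK subrr addr0.
by apply: bsubD => //; apply: bsubB; exact: bsubZ.
Qed.

(** If g n g^-1 = m then (1 - m) [g] = [m] - g [n] modulo boundaries. *)
Lemma support_conj g n : support_group n -> support_group (g * n * g^-1)%g ->
  S ((1 - vN_ltr R (g * n * g^-1)%g) *: chain1 1 g).
Proof.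
set m := (g * n * g^-1)%g => Sn Sm.
have mg : (m * g = g * n)%g by rewrite /m mulgVK.
have e1 := chain1_mul m g; have e2 := chain1_mul g n; rewrite mg e2 in e1.
have -> : (1 - vN_ltr R m) *: chain1 1 g = chain1 1 m - vN_ltr R g *: chain1 1 n
    + (relator 1 g n - relator 1 m g) :> chain.
  rewrite scalerBl scale1r.
  have -> : vN_ltr R m *: chain1 1 g =
      vN_ltr R g *: chain1 1 n + chain1 1 g - relator 1 g n
      + relator 1 m g - chain1 1 m :> chain.
    by rewrite e1 subrK addrK.
  set u := _ *: _; set v := chain1 1 g; set w := relator 1 g n.
  set r := relator 1 m g; set c := chain1 1 m.
  rewrite (addrAC u v) (addrAC (u - w) v r) (addrAC _ v (- c)) opprD addrCA subrr.
  by rewrite addr0 !opprD !opprK addrC !addrA.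
apply: bsubD; first by apply: bsubB => //; exact: bsubZ.
by apply: bsubB; exact/Ss.1/relator_boundary.
Qed.

End BSubmodule.

(** A square-summable function takes each value of nonzero modulus finitely
    often. *)
Lemma l2_invariant0 (L : set G) (f : l2) : infinite_set L ->
  (forall m, L m -> ltr m f = f) -> f = 0.
Proof.
move=> Linf Lf; apply: val_inj; apply/funext => x; apply: sqmod_eq0.
rewrite leNgt; apply/negP => z0; set z := sqmod _ in z0.
have [B BL Bn] := infinite_set_fset (Num.bound (sqn f / z)) Linf.
pose s := [seq (m^-1 * x)%g | m <- finmap.enum_fset B].
have us : uniq s.
  by rewrite map_inj_uniq ?finmap.fset_uniq // => m m' /mulIg /invg_inj.
have /(_ s us) := iffLR (l2sqn_leP f (sqn f)) (lexx _).
have -> : \sum_(y <- s) sqmod (val f y) = z *+ size (finmap.enum_fset B).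
  rewrite /s big_map big_seq (eq_bigr (fun=> z)); last first.
    by move=> m mB; rewrite /z -{2}(Lf m) //; exact: BL.
  by rewrite -big_seq big_const_seq count_predT iter_addr_0.
rewrite leNgt => /negP; apply; rewrite -mulr_natr mulrC -ltr_pdivrMr //.
apply: (lt_le_trans (archi_boundP _)); last by rewrite ler_nat.
by rewrite divr_ge0 ?sqn_ge0 // ltW.
Qed.

Lemma sum_unit (V : nmodType) (F : unit -> V) : \sum_i F i = F tt.
Proof. by rewrite (bigD1 tt) //= big1 ?addr0 // => -[]. Qed.

Lemma rowact_unit (a : unit -> N) (x : hsum unit l2) :
  rowact a x = val (a tt) (x tt).
Proof. exact: sum_unit. Qed.

(** If (1 - n) [g] lies in S for infinitely many n, then the a with a [g] in S
    have no common zero in l2, hence neither have the a with a c [g] in S; but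
    r (s + c [g]) is such a common zero. *)
Lemma vanish_on_sum (S M : set chain) (r : chain -> l2) (L : set G) g s c :
  bsubmodule S -> bsubmodule M -> (forall z, S z -> M z -> r z = 0) ->
  (forall a z, M z -> r (a *: z) = val a (r z)) ->
  infinite_set L -> (forall n, L n -> S ((1 - vN_ltr R n) *: chain1 1 g)) ->
  S s -> M (s + c *: chain1 1 g) -> r (s + c *: chain1 1 g) = 0.
Proof.
move=> Ss Ms Sr rZ Linf LS Ss1 Mz.
pose K : set (unit -> N) := [set k | S (k tt *: chain1 1 g)].
pose u : hsum unit l2 := fun=> r (s + c *: chain1 1 g).
suff : u = 0 by move/(congr1 (fun f => f tt)).
apply: (@dense_annihilator R G unit unit K (fun _ _ => c)).
- by rewrite /K /= scale0r; exact: (bsub0 Ss).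
- by move=> a y y' Ky Ky'; rewrite /K /= scalerDl -scalerA; exact: Ss.2.
- move=> zeta zK i.
  have -> : zeta = 0.
    apply/funext => -[]; apply: (l2_invariant0 Linf) => n Ln.
    have := zK (fun=> 1 - vN_ltr R n) (LS n Ln); rewrite rowact_unit.
    by move/eqP; rewrite vN_addE vN_oppE subr_eq0 => /eqP.
  exact: (op0 (rowact_bounded (fun=> c))).
- move=> a; rewrite /K /= sum_unit => aS; rewrite rowact_unit /u -rZ //.
  apply: Sr; last exact: (bsubZ Ms).
  by rewrite scalerDr scalerA; apply: (bsubD Ss) aS; exact: (bsubZ Ss).
Qed.

Section Pairing.
Variables (m : nat) (fs : 'I_m -> G).

Definition chain_on (k : 'I_m -> N) : chain := \sum_j chain1 (k j) (fs j).

Lemma chain_on0 : chain_on (fun=> 0) = 0.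
Proof. by rewrite /chain_on big1 // => j _; apply/funext => x; rewrite /chain1; case: eqP. Qed.

Lemma chain_onP a k k' :
  chain_on (fun j => a * k j + k' j) = a *: chain_on k + chain_on k'.
Proof.
rewrite /chain_on scaler_sumr -big_split; apply: eq_bigr => j _ /=.
by rewrite chain1D chain1Z.
Qed.

Lemma chain_onB k k' : chain_on (fun j => k j - k' j) = chain_on k - chain_on k'.
Proof.
have := chain_onP (-1) k' k.
have -> : (fun j => -1 * k' j + k j) = (fun j => k j - k' j).
  by apply/funext => j; rewrite mulN1r addrC.
by move=> ->; rewrite scaleN1r addrC.
Qed.

Lemma chain_on_sum (I : Type) (r : seq I) (a : I -> N) (k : I -> 'I_m -> N) :
  chain_on (fun j => \sum_(i <- r) a i * k i j) = \sum_(i <- r) a i *: chain_on (k i).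
Proof.
elim: r => [|i r IH].
  by rewrite big_nil; under eq_fun do rewrite big_nil; exact: chain_on0.
rewrite big_cons -IH -chain_onP; congr chain_on.
by apply/funext => j; rewrite big_cons.
Qed.

(** The chains homologous to a chain carried by fs. *)
Definition carried : set chain := [set z | exists k, boundaries1 (z - chain_on k)].

Variable rho : hsum 'I_m l2.
Hypothesis rhoK : forall k, boundaries1 (chain_on k) -> rowact k rho = 0.

(** The values rho on the elements of fs, extended to homologous chains. *)
Definition pairing z : l2 :=
  rowact (xget (fun=> 0) [set k | boundaries1 (z - chain_on k)]) rho.

Lemma pairingE z k : boundaries1 (z - chain_on k) -> pairing z = rowact k rho.
Proof.
move=> zk; rewrite /pairing; set k' := xget _ _.
have zk' : boundaries1 (z - chain_on k').
  by apply: (@xgetPex _ _ [set k | boundaries1 (z - chain_on k)]); exists k.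
apply/eqP; rewrite -subr_eq0 -rowactB rhoK // chain_onB.
by have := boundariesB zk zk'; rewrite opprB addrC subrKA.
Qed.

Lemma carried_bsubmodule : bsubmodule carried.
Proof.
split=> [z bz|a z w [k zk] [k' wk']].
  by exists (fun=> 0); rewrite chain_on0 subr0.
exists (fun j => a * k j + k' j); rewrite chain_onP opprD addrACA -scalerBr.
exact: boundaries_submod.
Qed.

Lemma pairingP a z w : carried z -> carried w ->
  pairing (a *: z + w) = val a (pairing z) + pairing w.
Proof.
move=> [k zk] [k' wk']; rewrite (pairingE zk) (pairingE wk') -rowactP.
apply: pairingE; rewrite chain_onP opprD addrACA -scalerBr.
exact: boundaries_submod.
Qed.

Lemma pairing_boundary z : boundaries1 z -> pairing z = 0.
Proof.
move=> bz; have bl : boundaries1 (z - chain_on (fun=> 0)) by rewrite chain_on0 subr0.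
by rewrite (pairingE bl) rhoK // chain_on0; exact: boundaries0.
Qed.

Lemma carried_finite z : carried z -> finite_chain z.
Proof.
move=> [k zk]; have -> : z = (fun x => (z - chain_on k) x + chain_on k x).
  by apply/funext => x; rewrite -[RHS]/((z - chain_on k + chain_on k) x) subrK.
apply: finite_chainD; first exact: (bdry1_boundary zk).1.
apply: (@chain_of_seq _ _ _ _ [seq fs j | j <- enum 'I_m]) => x xs.
rewrite /chain_on fct_sumE big1 // => j _; rewrite /chain1; case: eqP => // xj.
by move/negP: xs; case; apply/mapP; exists j; rewrite ?mem_enum.
Qed.

End Pairing.

(** Relations rho between the values at fs of an equivariant map on chains modulo
    boundaries define a cocycle g |-> pairing [g] on the group of those g with
    [g] carried by fs.  Relative property (T) makes it inner on a subgroup B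
    close to a conjugate of A.  After subtraction of the coboundary, the map
    vanishes on [B], and a maximal submodule S containing [B] on which it
    vanishes where it is defined turns out to contain all chains: the group of
    the g with [g] in S absorbs every g that moves it to a position with an
    infinite intersection.  Thus the pairing is a coboundary, and cycles do not
    see coboundaries. *)
Lemma cycle_pairing (A : set G) : is_subgroup A -> relative_T R A ->
  infinite_set A -> weakly_normal A \/ weakly_quasi_normal A ->
  exists F : seq G, forall (m : nat) (fs : 'I_m -> G),
    (forall x, x \in F -> exists j, fs j = x) ->
    forall rho : hsum 'I_m l2,
    (forall k, boundaries1 (chain_on fs k) -> rowact k rho = 0) ->
    forall k, bdry1 (chain_on fs k) = 0 -> rowact k rho = 0.
Proof.
move=> As T Ainf W; have [F FP] := relative_T_cocycle As T Ainf.
exists F => m fs Ffs rho rhoK; pose M := carried fs; pose r := pairing fs rho.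
have Ms : bsubmodule M := carried_bsubmodule fs.
pose Gam := support_group M; have Gs : is_subgroup Gam := support_groupP Ms.
pose b g := r (chain1 1 g).
have rP a z w : M z -> M w -> r (a *: z + w) = val a (r z) + r w.
  exact: pairingP.
have rB z : boundaries1 z -> r z = 0 by exact: pairing_boundary.
have bc : cocycle_on Gam b.
  move=> g h Gg Gh.
  have e : chain1 1 (g * h)%g = vN_ltr R g *: chain1 1 h +
      (chain1 1 g + (-1) *: relator 1 g h) :> chain.
    by rewrite chain1_mul scaleN1r addrA.
  have Mr : M (relator 1 g h) by apply: Ms.1; exact: relator_boundary.
  have M2 : M (chain1 1 g + (-1) *: relator 1 g h).
    by apply: (bsubD Ms) => //; exact: (bsubZ Ms).
  rewrite /b e rP // addrC; congr (_ + _).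
  rewrite addrC rP // rB ?(op0 (vN_bounded _)) ?add0r //.
  exact: relator_boundary.
have FG x : x \in F -> Gam x.
  move=> xF; have [j <-] := Ffs x xF; rewrite /Gam /support_group /= /M.
  exists (fun i => if i == j then 1 else 0).
  have -> : chain_on fs (fun i => if i == j then 1 else 0) = chain1 1 (fs j).
    rewrite /chain_on (bigD1 j) //= eqxx big1 ?addr0 // => i /negPf ->.
    by apply/funext => y; rewrite /chain1; case: eqP.
  by rewrite subrr; exact: boundaries0.
have [x [Binf [bd bdP] [hs hsP]]] := FP Gam b Gs FG bc.
set B := conj_part A Gam x in Binf bdP hsP.
have [A1 AM AV] := As; have [G1 GM GV] := Gs.
have Bs : is_subgroup B.
  split=> [|g h [Gg Ag] [Gh Ah]|g [Gg Ag]].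
  - by split=> //; rewrite mulg1 mulgV.
  - split; first exact: GM.
    by have := AM _ _ Ag Ah; rewrite !mulgA mulgVK.
  - by split; [exact: GV | have := AV _ Ag; rewrite !invgM invgK mulgA].
have [B1 BM BV] := Bs.
(* the cocycle is inner on B: the centre of its values is a fixed point *)
have [c0 [cr crP] c0P] := @chebyshev_center R l2 G b B bd (ex_intro _ _ B1) bdP.
pose xi := - c0.
have bxi h : B h -> b h = ltr h xi - xi.
  move=> Bh; have Gh : Gam h by case: Bh.
  have fix_c : ltr h c0 + b h = c0.
    apply: c0P => d dP i Bi; have Bhi : B (h^-1 * i)%g by apply: BM => //; exact: BV.
    have -> : b i = b h + ltr h (b (h^-1 * i)%g).
      by rewrite -bc ?mulVKg //; case: Bhi.
    have -> : ltr h c0 + b h - (b h + ltr h (b (h^-1 * i)%g)) =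
        ltr h (c0 - b (h^-1 * i)%g).
      rewrite opprD addrA addrK.
      have cP := vN_bounded (vN_ltr R h); exact: esym (opB cP _ _).
    by rewrite sqn_ltr; exact: dP.
  have -> : ltr h xi = - ltr h c0 by exact: (opN (vN_bounded (vN_ltr R h))).
  by rewrite /xi opprK -{2}fix_c addKr.
pose r' z := r z - val (bdry1 z) xi.
have r'P a z w : M z -> M w -> r' (a *: z + w) = val a (r' z) + r' w.
  move=> Mz Mw; rewrite /r' rP //.
  have -> : bdry1 (a *: z + w) = a * bdry1 z + bdry1 w.
    by apply: bdry1P; exact: (carried_finite (fs := fs)).
  rewrite vN_addE vN_mulE (opB (vN_bounded a)).
  by rewrite opprD addrACA.
have r'B z : boundaries1 z -> r' z = 0.
  by move=> bz; rewrite /r' rB // (bdry1_boundary bz).2 vN_0E subrr.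
have r'b h : B h -> r' (chain1 1 h) = 0.
  move=> Bh; rewrite /r' -/(b h) bxi // bdry1_chain1 mul1r.
  by rewrite vN_addE vN_oppE subrr.
(* a maximal submodule S such that r' vanishes on S :&: M; the empty set keeps
   the family closed under unions of empty chains *)
pose P S := bsubmodule S /\ (forall h, B h -> S (chain1 1 h)) /\
  (forall z, S z -> M z -> r' z = 0).
have [S [SP0 Smax]] : exists S, (S = set0 \/ P S) /\
    forall S', S `<` S' -> ~ (S' = set0 \/ P S').
  apply: (@Zorn_bigcup _ [set S | S = set0 \/ P S]) => Fam FamP Ftot.
  have [[S0 FS0 PS0]|none] := pselect (exists2 S0, Fam S0 & P S0); last first.
    left; apply/seteqP; split=> // z [S0 FS0 S0z].
    have [e|PS0] := FamP _ FS0; first by rewrite e in S0z.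
    by apply: none; exists S0.
  right; split; [split|split].
  - by move=> z bz; exists S0 => //; exact: PS0.1.1.
  - move=> a z w [S1 F1 S1z] [S2 F2 S2w].
    have P1 : P S1 by have [e|//] := FamP _ F1; rewrite e in S1z.
    have P2 : P S2 by have [e|//] := FamP _ F2; rewrite e in S2w.
    have [S12|S21] := Ftot _ _ F1 F2.
      by exists S2 => //; apply: P2.1.2 => //; exact: S12.
    by exists S1 => //; apply: P1.1.2 => //; exact: S21.
  - by move=> h Bh; exists S0 => //; exact: PS0.2.1.
  - move=> z [S1 F1 S1z]; have [e|P1] := FamP _ F1; first by rewrite e in S1z.
    exact: P1.2.2.
have PS0 : P [set z | M z /\ r' z = 0].
  split; [split|split].
  - by move=> z bz; split; [exact: Ms.1 | exact: r'B].
  - move=> a z w [Mz z0] [Mw w0]; split; first exact: Ms.2.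
    by rewrite r'P // z0 w0 (op0 (vN_bounded a)) addr0.
  - by move=> h Bh; split; [case: Bh | exact: r'b].
  - by move=> z [].
have [Ss [SB Sr]] : P S.
  case: SP0 => // S0; exfalso; apply: (Smax _ _ (or_intror PS0)).
  rewrite S0; split; first by move=> z.
  by move=> /(_ 0); apply; split; [exact: (bsub0 Ms) | apply: r'B; exact: boundaries0].
have Ssat (L : set G) g : infinite_set L ->
    (forall n, L n -> S ((1 - vN_ltr R n) *: chain1 1 g)) -> S (chain1 1 g).
  move=> Linf LS; pose S' := [set z | exists s a, S s /\ z = s + a *: chain1 1 g].
  have SS' : S `<=` S'.
    by move=> z Sz; exists z, 0; rewrite scale0r addr0.
  suff PS' : P S'.
    have gS' : S' (chain1 1 g).
      by exists 0, 1; rewrite scale1r add0r; split=> //; exact: (bsub0 Ss).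
    apply: contrapT => gS; apply: (Smax S'); last by right.
    by split=> // S'S; apply: gS; exact: S'S.
  split; [split|split].
  - by move=> z bz; apply: SS'; exact: Ss.1.
  - move=> a _ _ [s [c [Ss1 ->]]] [t [d [St ->]]].
    exists (a *: s + t), (a * c + d); split; first exact: Ss.2.
    by rewrite scalerDr scalerDl scalerA addrACA.
  - by move=> h Bh; apply: SS'; exact: SB.
  - move=> _ [s [c [Ss1 ->]]] Mz.
    apply: (vanish_on_sum Ss Ms Sr _ Linf LS Ss1 Mz) => a z Mz'.
    have M0 : M 0 := bsub0 Ms.
    by have := r'P a _ _ Mz' M0; rewrite (r'B 0 (@boundaries0 R G)) !addr0.
have SG : is_subgroup (support_group S) := support_groupP Ss.
have Sabs g : infinite_set (support_group S `&` conj_set g (support_group S)) ->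
    support_group S g.
  move=> Linf; apply: (Ssat _ g Linf) => n [Sn [n' Sn' e]].
  by rewrite -e; apply: (support_conj Ss) => //; rewrite e.
(* B has finite index in the conjugate of A by x^-1, so it meets each of its
   conjugates by elements a of the latter in an infinite set *)
have SA a : A (x * a * x^-1)%g -> support_group S a.
  move=> Aa; apply: Sabs.
  pose Bh h := [set n | B n /\ B (a * n * h)%g].
  have [h [hhs hinf]] : exists h, h \in hs /\ infinite_set (Bh h).
    apply: contrapT => no; apply: Binf.
    apply: (@sub_finite_set _ _ (\bigcup_(h in [set` hs]) Bh h)).
      move=> n [Gn An]; have [|h hh Bh'] := hsP (a * n)%g.
        by have := AM _ _ Aa An; rewrite !mulgA mulgVK.
      by exists h.
    apply: bigcup_finite; first exact: finite_seq.
    by move=> h hh; apply: contrapT => hi; apply: no; exists h.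
  have [n0 [Bn0 Ban0]] : exists n0, Bh h n0.
    apply: contrapT => no; apply: hinf.
    by rewrite (_ : Bh h = set0) //; apply/seteqP; split=> // n nB; apply: no; exists n.
  move=> fin; apply: hinf.
  apply: (sub_finite_set _ (finite_image (fun y => a^-1 * y * a * n0)%g fin)).
  move=> n [Bn Ban]; exists (a * (n * n0^-1) * a^-1)%g; last first.
    by rewrite !mulgA mulVg mul1g mulgVK mulgVK.
  split; last by exists (n * n0^-1)%g => //; apply: SB; apply: BM => //; exact: BV.
  apply: SB; have := BM _ _ Ban (BV _ Ban0).
  by rewrite !invgM !mulgA mulgK.
have Sall := absorbing_full_conj As Ainf SG SA Sabs W.
have Schain z : finite_chain z -> S z.
  move=> zf; apply: (chain_ind _ _ _ zf).
  - exact: (bsub0 Ss).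
  - by move=> y y' _ Sy Sy'; exact: (bsubD Ss Sy Sy').
  - move=> a g; have := bsubZ Ss a (Sall g); rewrite chain1Z mulr1.
    exact.
move=> k kc.
have Mk : M (chain_on fs k) by exists k; rewrite subrr; exact: boundaries0.
have := Sr _ (Schain _ (carried_finite Mk)) Mk.
rewrite /r' kc vN_0E subr0 /r (pairingE rhoK (k := k)) // subrr.
exact: boundaries0.
Qed.

End Submodules.

(** * The first L2-Betti number *)

Lemma linear_rows (K : pzRingType) (M : lmodType K) n (phi : {linear 'rV[K]_n -> M})
    (v : 'rV[K]_n) : phi v = \sum_i v 0 i *: phi (delta_mx 0 i).
Proof.
by rewrite {1}[v]row_sum_delta linear_sum; apply: eq_bigr => i _; rewrite linearZ.
Qed.

Lemma chain_on_nth (R : realType) (G : groupType) (s : seq G) (z : G -> (vN R G)^o) :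
  uniq s -> (forall x, x \notin s -> z x = 0) ->
  chain_on (fun j : 'I_(size s) => nth 1%g s j) (fun j => z (nth 1%g s j)) = z.
Proof.
move=> us z0; apply/funext => x; rewrite /chain_on fct_sumE.
have [xs|xs] := boolP (x \in s).
  have xm : (index x s < size s)%N by rewrite index_mem.
  rewrite (bigD1 (Ordinal xm)) //= /chain1 /= nth_index // eqxx.
  rewrite big1 ?addr0 // => j /negP jx; case: eqP => // xj.
  by case: jx; apply/eqP/val_inj; rewrite /= xj index_uniq.
rewrite big1 => [|j _]; first exact/esym/z0.
by rewrite /chain1; case: eqP => // xj; move: xs; rewrite xj mem_nth.
Qed.

Theorem theorem1p1 (R : realType) (G : groupType) (A : set G) :
  is_subgroup A -> relative_T R A -> infinite_set A ->
  weakly_normal A \/ weakly_quasi_normal A ->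
  beta1 R G = 0%E.
Proof.
move=> As T Ainf W; have [F FP] := cycle_pairing As T Ainf W.
rewrite /beta1 /vN_dim; set D := [set d | _].
have D0 : D 0%E.
  exists 0%N, 0, (\0 : {linear 'rV[vN R G]_0 -> (G -> (vN R G)^o)}).
  split=> [|v|v _ _|].
  - by rewrite mul0mx.
  - have z0 : forall p : G, p \notin [::] -> (0 : vN R G) = 0 by [].
    by split; [exact: chain_of_seq z0 | rewrite (bdry1E _ z0) ?big_nil].
  - by apply/rowP => -[].
  - by rewrite big_ord0.
suff -> : D = [set 0%E] by rewrite ereal_sup1.
apply/seteqP; split=> [d|_ ->] //.
move=> [n [e [phi [ee phiZ phi_inj ->]]]].
(* a finite set s that contains F and carries the images of the generators *)
have /choice[t tP] (i : 'I_n) : exists t : seq G,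
    forall x, x \notin t -> phi (delta_mx 0 i) x = 0.
  by have /finite_chainP[t _ tP] := (phiZ (delta_mx 0 i)).1; exists t.
pose s := undup (F ++ flatten [seq t i | i <- enum 'I_n]).
pose fs (j : 'I_(size s)) := nth 1%g s j.
have Ffs x : x \in F -> exists j, fs j = x.
  move=> xF; have xs : x \in s by rewrite mem_undup mem_cat xF.
  have xm : (index x s < size s)%N by rewrite index_mem.
  by exists (Ordinal xm); rewrite /fs /= nth_index.
pose X (i : 'I_n) j := phi (delta_mx 0 i) (fs j).
have onX i : chain_on fs (X i) = phi (delta_mx 0 i).
  apply: chain_on_nth => [|x xs]; first exact: undup_uniq.
  apply: tP; apply: contra xs => xt; rewrite mem_undup mem_cat.
  by apply/orP; right; apply/flattenP; exists (t i) => //; apply/mapP; exists i;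
    rewrite ?mem_enum.
pose eX (i : 'I_n) j := \sum_l e i l * X l j.
have oneX i : chain_on fs (eX i) = phi (row i e).
  by rewrite chain_on_sum linear_rows; apply: eq_bigr => l _; rewrite onX mxE.
have e0 zeta : mxop (fun i l => e i l) zeta = 0.
  apply: (@dense_annihilator R G _ _ [set k | boundaries1 (chain_on fs k)] eX).
  - by rewrite /= chain_on0; exact: boundaries0.
  - by move=> a x y Kx Ky; rewrite /= chain_onP; exact: boundaries_submod.
  - move=> xi xiK i; apply: (FP _ fs Ffs) => //.
    by rewrite oneX; exact: (phiZ _).2.
  - move=> a; rewrite /= chain_on_sum => aK; pose v := (\row_i a i) *m e.
    have v0 : v = 0.
      apply: phi_inj; first by rewrite -mulmxA ee.
      rewrite /v mulmx_sum_row linear_sum; move: aK; congr boundaries1.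
      by apply: eq_bigr => i _; rewrite linearZ oneX mxE.
    rewrite /mxop rowact_sum /rowact big1 // => l _.
    have /matrixP/(_ 0 l) := v0; rewrite [RHS]mxE mxE => h.
    by rewrite (eq_bigr (fun i => (\row_i a i) 0 i * e i l)) ?h // => i _; rewrite mxE.
have e00 i : e i i = 0.
  apply: vN_ext => f; have := congr1 (fun h => h i) (e0 (hinj i f)).
  by rewrite /mxop rowact_hinj.
by rewrite big1 // => i _; rewrite e00.
Qed.
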